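(* Let $\mathbb{F}$ be a field, let $G\to \mathrm{GL}(n,\mathbb{F})$ be a representation of a finite group $G$, and let $R:=\mathbb{F}[x_1,\dots,x_n]^G$ be the invariant ring. Let $\mathfrak{a}$ be a homogeneous ideal of $R$ such that $H^i_{\mathfrak{a}}(R)$ is of finite length for all $i<\mathrm{cd}(\mathfrak{a})$. Then $H^i_{\mathfrak{a}}(R)=0$ for all $i<\mathrm{cd}(\mathfrak{a})$. In particular, $\mathrm{grade}(\mathfrak{a},R)=\mathrm{ht}(\mathfrak{a})=\mathrm{cd}(\mathfrak{a})=\mathrm{f}_{\mathfrak{a}}(R)$.
   Context: $G$ acts on the polynomial ring $\mathbb{F}[x_1,\dots,x_n]$ by degree-preserving $\mathbb{F}$-algebra automorphisms induced by the representation; $R$ is the graded subring of $G$-invariants (a finitely generated graded $\mathbb{F}$-algebra). $H^i_{\mathfrak{a}}(-)$ denotes local cohomology (cohomology of the Čech complex on a generating set of $\mathfrak{a}$), and length is length as an $R$-module. $\mathrm{cd}(\mathfrak{a})=\mathrm{cd}(\mathfrak{a},R):=\sup\{i: H^i_{\mathfrak{a}}(R)\neq 0\}$; $\mathrm{grade}(\mathfrak{a},R):=\inf\{i: H^i_{\mathfrak{a}}(R)\neq 0\}$; $\mathrm{f}_{\mathfrak{a}}(R):=\inf\{i: H^i_{\mathfrak{a}}(R)\text{ is not finitely generated}\}$; $\mathrm{ht}(\mathfrak{a})$ is the height of $\mathfrak{a}$.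
   Formalization: The chain grade = ht = cd is proved for a ≠ R and cd = f_a for a also ≠ 0; for a = R one has cd = −∞ but grade = ht = +∞, and for a = 0 one has cd = 0 but f_a = +∞, so the equalities fail there. *)

(* Defs.v *)
From HB Require Import structures.
From mathcomp Require Import all_fingroup all_character.
From mathcomp Require Import all_boot all_order all_algebra zify ring.
From mathcomp Require Import boolp classical_sets.
From mathcomp Require Import mpoly.
(* The notations of constructive_ereal are incompatible with those of mpoly. *)
From mathcomp Require Import -(notations) constructive_ereal.

Set Implicit Arguments.
Unset Strict Implicit.
Unset Printing Implicit Defensive.

Import GRing.Theory.

Local Open Scope ring_scope.
Local Open Scope classical_set_scope.
Local Open Scope quotient_scope.

(* Extended integers, as values of suprema and infima of sets of naturals;
   sup of the empty set is -oo and inf of the empty set is +oo. *)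
Notation ext_int := (extended int).

Definition ext_nat (i : nat) : ext_int := EFin (Posz i).

Definition ext_sup (A : set ext_int) : ext_int := supremum (ENInf int) A.

Definition ext_inf (A : set ext_int) : ext_int := infimum (EPInf int) A.

Section ModuleNotions.
Variables (R : comNzRingType) (M : lmodType R).

Definition finitely_generated : Prop :=
  exists (m : nat) (g : 'I_m -> M),
    forall x, exists c : 'I_m -> R, x = \sum_i c i *: g i.

(* N' / N is a simple module. *)
Definition covers (N N' : {pred M}) : Prop :=
  [/\ {subset N <= N'}, ~ {subset N' <= N}
    & forall L : {pred M}, submod_closed L ->
        {subset N <= L} -> {subset L <= N'} -> L =i N \/ L =i N'].

(* Existence of a composition series N 0 = 0 < N 1 < ... < N l = M. *)
Definition finite_length : Prop :=
  exists (l : nat) (N : nat -> {pred M}),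
    [/\ forall j, (j <= l)%N -> submod_closed (N j),
        N 0%N =i pred1 0, N l =i predT
      & forall j, (j < l)%N -> covers (N j) (N j.+1)].

Definition zero_module : Prop := forall x : M, x = 0.

End ModuleNotions.

Section Ideals.
Variable R : comNzRingType.

(* Not necessarily proper, unlike idealr_closed. *)
Definition ideal (a : {pred R}) : Prop := @submod_closed R R^o a.

Definition prime_ideal (p : {pred R}) : Prop :=
  idealr_closed p /\ prime_idealr_closed p.

Definition generates k (f : 'I_k -> R) (a : {pred R}) : Prop :=
  forall x, x \in a <-> exists c : 'I_k -> R, x = \sum_i c i * f i.

Definition prime_chain (p : {pred R}) (l : nat) : Prop :=
  exists q : nat -> {pred R},
    [/\ forall j, (j <= l)%N -> prime_ideal (q j), q l =i p
      & forall j, (j < l)%N ->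
          {subset q j <= q j.+1} /\ ~ {subset q j.+1 <= q j}].

Definition prime_height (p : {pred R}) : ext_int :=
  ext_sup [set ext_nat l | l in [set l | prime_chain p l]].

Definition height (a : {pred R}) : ext_int :=
  ext_inf [set h | exists p : {pred R},
    [/\ prime_ideal p, {subset a <= p} & h = prime_height p]].

End Ideals.

Section LmodQuotient.
Variables (R : comNzRingType) (M : lmodType R) (N : submodClosed M).

(* A copy of N carrying the zmodClosed structure. *)
Definition lquot_pred : {pred M} := fun x => x \in N.
HB.instance Definition _ := GRing.isZmodClosed.Build M lquot_pred
  (GRing.submod_closedB (submodClosedP N)).

Definition lquot := @Quotient.quot M lquot_pred.
HB.instance Definition _ := GRing.Zmodule.on lquot.
HB.instance Definition _ : EqQuotient M (Quotient.equiv lquot_pred) lquot :=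
  EqQuotient.on lquot.

Definition lquot_pi (x : M) : lquot := \pi_lquot x.

Definition lquot_scale (r : R) (u : lquot) : lquot := lquot_pi (r *: repr u).

Lemma lquot_piP (x y : M) : lquot_pi x = lquot_pi y <-> x - y \in N.
Proof.
rewrite -[x - y \in N]/(Quotient.equiv lquot_pred x y).
by split=> [/eqquotP|e] //; apply/eqquotP.
Qed.

Lemma lquot_piW (P : lquot -> Prop) :
  (forall x, P (lquot_pi x)) -> forall u, P u.
Proof. by move=> Ppi u; rewrite -[u]reprK; apply: Ppi. Qed.

Lemma lquot_piD (x y : M) : lquot_pi (x + y) = lquot_pi x + lquot_pi y.
Proof. exact: (raddfD (\pi_(@Quotient.quot M lquot_pred))). Qed.

Lemma lquot_scaleE r x : lquot_scale r (lquot_pi x) = lquot_pi (r *: x).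
Proof.
apply/lquot_piP; rewrite -scalerBr; apply: rpredZ; apply/lquot_piP.
by rewrite /lquot_pi reprK.
Qed.

Lemma lquot_scaleA a b v :
  lquot_scale a (lquot_scale b v) = lquot_scale (a * b) v.
Proof. by elim/lquot_piW: v => x; rewrite !lquot_scaleE scalerA. Qed.

Lemma lquot_scale1 : left_id 1 lquot_scale.
Proof. by elim/lquot_piW=> x; rewrite lquot_scaleE scale1r. Qed.

Lemma lquot_scaleDr : right_distributive lquot_scale +%R.
Proof.
move=> a; elim/lquot_piW=> x; elim/lquot_piW=> y.
by rewrite -lquot_piD !lquot_scaleE scalerDr lquot_piD.
Qed.

Lemma lquot_scaleDl v : {morph lquot_scale^~ v : a b / a + b}.
Proof.
by move=> a b; elim/lquot_piW: v => x; rewrite !lquot_scaleE scalerDl lquot_piD.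
Qed.

HB.instance Definition _ := GRing.Zmodule_isLmodule.Build R lquot
  lquot_scaleA lquot_scale1 lquot_scaleDr lquot_scaleDl.

End LmodQuotient.

(* The localization M_f of a module at the powers of f; the pair (x, m)
   stands for x / f ^+ m. *)
Section Localization.
Variables (R : comNzRingType) (M : lmodType R) (f : R).

Definition loc_equiv (u v : M * nat) : bool :=
  `[< exists k, f ^+ (k + v.2) *: u.1 = f ^+ (k + u.2) *: v.1 >].

Lemma loc_equiv_is_equiv : equiv_class_of loc_equiv.
Proof.
split=> [u|u v|v u w]; first by apply/asboolP; exists 0%N.
  by apply/asboolP/asboolP => -[k e]; exists k.
move=> /asboolP[k e1] /asboolP[l e2]; apply/asboolP; exists (k + l + v.2)%N.
move/(congr1 ( *:%R (f ^+ (l + w.2)))): e1.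
move/(congr1 ( *:%R (f ^+ (k + u.2)))): e2.
rewrite !scalerA -!exprD => e2 e1.
rewrite (_ : _ + w.2 = l + w.2 + (k + v.2))%N; last lia.
rewrite (_ : _ + u.2 = k + u.2 + (l + v.2))%N; last lia.
rewrite -e2 {}e1; congr (f ^+ _ *: _); lia.
Qed.

Canonical loc_equiv_rel := EquivRelPack loc_equiv_is_equiv.
Canonical loc_equiv_enc := defaultEncModRel loc_equiv.

Definition loc := {eq_quot loc_equiv}.
HB.instance Definition _ : EqQuotient (M * nat)%type loc_equiv loc :=
  EqQuotient.on loc.
HB.instance Definition _ := Choice.on loc.

Definition frac (x : M) (m : nat) : loc := \pi_loc (x, m).

Lemma fracP x m y n :
  frac x m = frac y n <-> exists k, f ^+ (k + n) *: x = f ^+ (k + m) *: y.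
Proof.
by split=> [/eqquotP/asboolP|e] //; apply/eqquotP/asboolP.
Qed.

Lemma fracK (u : loc) : frac (repr u).1 (repr u).2 = u.
Proof. by rewrite /frac -surjective_pairing reprK. Qed.

Lemma fracW (P : loc -> Prop) :
  (forall x m, P (frac x m)) -> forall u, P u.
Proof. by move=> Pf u; rewrite -[u]fracK. Qed.

Definition loc_add (u v : loc) : loc :=
  frac (f ^+ (repr v).2 *: (repr u).1 + f ^+ (repr u).2 *: (repr v).1)
       ((repr u).2 + (repr v).2).
Definition loc_opp (u : loc) : loc := frac (- (repr u).1) (repr u).2.
Definition loc_scale (r : R) (u : loc) : loc :=
  frac (r *: (repr u).1) (repr u).2.

Lemma loc_addE x m y n :
  loc_add (frac x m) (frac y n) = frac (f ^+ n *: x + f ^+ m *: y) (m + n).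
Proof.
rewrite /loc_add; case E: (repr (frac x m)) => [x' m'].
case E2: (repr (frac y n)) => [y' n'] /=.
have /fracP[k e] : frac x' m' = frac x m by rewrite -(fracK (frac x m)) E.
have /fracP[l e'] : frac y' n' = frac y n by rewrite -(fracK (frac y n)) E2.
apply/fracP; exists (k + l)%N; rewrite !scalerDr !scalerA -!exprD; congr (_ + _).
  move/(congr1 ( *:%R (f ^+ (l + n + n')))): e; rewrite !scalerA -!exprD => e.
  rewrite (_ : _ + n' = l + n + n' + (k + m))%N; last lia.
  rewrite e; congr (f ^+ _ *: _); lia.
move/(congr1 ( *:%R (f ^+ (k + m + m')))): e'; rewrite !scalerA -!exprD => {}e.
rewrite (_ : _ + m' = k + m + m' + (l + n))%N; last lia.
rewrite e; congr (f ^+ _ *: _); lia.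
Qed.

Lemma loc_oppE x m : loc_opp (frac x m) = frac (- x) m.
Proof.
rewrite /loc_opp; case E: (repr (frac x m)) => [x' m'] /=.
have /fracP[k e] : frac x' m' = frac x m by rewrite -(fracK (frac x m)) E.
by apply/fracP; exists k; rewrite !scalerN e.
Qed.

Lemma loc_scaleE r x m : loc_scale r (frac x m) = frac (r *: x) m.
Proof.
rewrite /loc_scale; case E: (repr (frac x m)) => [x' m'] /=.
have /fracP[k e] : frac x' m' = frac x m by rewrite -(fracK (frac x m)) E.
by apply/fracP; exists k; rewrite !(scalerA, mulrC _ r) -!(scalerA r) e.
Qed.

Lemma loc_addA : associative loc_add.
Proof.
elim/fracW=> x m; elim/fracW=> y n; elim/fracW=> z p; rewrite !loc_addE.
by rewrite !scalerDr !scalerA -!exprD !addrA addnA (addnC p n) (addnC p m).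
Qed.

Lemma loc_addC : commutative loc_add.
Proof.
by elim/fracW=> x m; elim/fracW=> y n; rewrite !loc_addE addrC addnC.
Qed.

Lemma loc_add0 : left_id (frac 0 0) loc_add.
Proof.
by elim/fracW=> x m; rewrite loc_addE scaler0 add0r expr0 scale1r add0n.
Qed.

Lemma loc_addN : left_inverse (frac 0 0) loc_opp loc_add.
Proof.
elim/fracW=> x m; rewrite loc_oppE loc_addE scalerN addNr.
by apply/fracP; exists 0%N; rewrite !scaler0.
Qed.

HB.instance Definition _ :=
  GRing.isZmodule.Build loc loc_addA loc_addC loc_add0 loc_addN.

Lemma loc_scaleA a b v :
  loc_scale a (loc_scale b v) = loc_scale (a * b) v.
Proof. by elim/fracW: v => x m; rewrite !loc_scaleE scalerA. Qed.

Lemma loc_scale1 : left_id 1 loc_scale.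
Proof. by elim/fracW=> x m; rewrite loc_scaleE scale1r. Qed.

Lemma loc_scaleDr : right_distributive loc_scale +%R.
Proof.
move=> a; elim/fracW=> x m; elim/fracW=> y n.
rewrite -[_ + _]/(loc_add _ _) -[RHS]/(loc_add _ _) !(loc_addE, loc_scaleE).
by rewrite scalerDr !scalerA !(mulrC a).
Qed.

Lemma loc_scaleDl v : {morph loc_scale^~ v : a b / a + b}.
Proof.
move=> a b; elim/fracW: v => x m.
rewrite -[RHS]/(loc_add _ _) !(loc_addE, loc_scaleE) scalerDl.
apply/fracP; exists 0%N; rewrite !add0n scalerDr -!scalerDr scalerA -exprD.
by [].
Qed.

HB.instance Definition _ := GRing.Zmodule_isLmodule.Build R loc
  loc_scaleA loc_scale1 loc_scaleDr loc_scaleDl.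

Lemma fracD x m y n :
  frac x m + frac y n = frac (f ^+ n *: x + f ^+ m *: y) (m + n).
Proof. exact: loc_addE. Qed.

Lemma fracZ r x m : r *: frac x m = frac (r *: x) m.
Proof. exact: loc_scaleE. Qed.

End Localization.

(* The localization map M_f -> M_h, when h = g * f. *)
Section LocalizationMap.
Variables (R : comNzRingType) (M : lmodType R) (f g h : R).

Definition loc_map (u : loc M f) : loc M h :=
  frac h (g ^+ (repr u).2 *: (repr u).1) (repr u).2.

Hypothesis hE : h = g * f.

Lemma loc_mapE x m : loc_map (frac f x m) = frac h (g ^+ m *: x) m.
Proof.
rewrite /loc_map; case E: (repr (frac f x m)) => [x' m'] /=.
have /fracP[k e] : frac f x' m' = frac f x m by rewrite -(fracK (frac f x m)) E.
apply/fracP; exists k; rewrite hE.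
have gE (a b : nat) (z : M) : (g * f) ^+ (k + a) *: (g ^+ b *: z)
    = g ^+ (k + a + b) *: (f ^+ (k + a) *: z).
  by rewrite !scalerA exprMn mulrAC -exprD.
by rewrite !gE e (addnAC k m).
Qed.

Lemma loc_map_linear : linear loc_map.
Proof.
move=> a; elim/fracW=> x m; elim/fracW=> y n.
rewrite fracZ fracD !loc_mapE fracZ fracD !scalerDr !scalerA hE !exprMn !exprD.
by congr (frac _ (_ *: _ + _ *: _) _); ring.
Qed.

End LocalizationMap.

Section DffunLmod.
Variables (R : comNzRingType) (I : finType) (T : I -> lmodType R).
Implicit Types c : {dffun forall i, T i}.

Definition dffun_zero : {dffun forall i, T i} := [ffun i => 0 : T i].
Definition dffun_opp c : {dffun forall i, T i} := [ffun i => - c i].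
Definition dffun_add c1 c2 : {dffun forall i, T i} := [ffun i => c1 i + c2 i].
Definition dffun_scale (r : R) c : {dffun forall i, T i} :=
  [ffun i => r *: c i].

Lemma dffun_addA : associative dffun_add.
Proof. by move=> a b c; apply/ffunP=> i; rewrite !ffunE addrA. Qed.
Lemma dffun_addC : commutative dffun_add.
Proof. by move=> a b; apply/ffunP=> i; rewrite !ffunE addrC. Qed.
Lemma dffun_add0 : left_id dffun_zero dffun_add.
Proof. by move=> a; apply/ffunP=> i; rewrite !ffunE add0r. Qed.
Lemma dffun_addN : left_inverse dffun_zero dffun_opp dffun_add.
Proof. by move=> a; apply/ffunP=> i; rewrite !ffunE addNr. Qed.

HB.instance Definition _ := GRing.isZmodule.Build {dffun forall i, T i}
  dffun_addA dffun_addC dffun_add0 dffun_addN.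

Lemma dffun_scaleA a b c :
  dffun_scale a (dffun_scale b c) = dffun_scale (a * b) c.
Proof. by apply/ffunP=> i; rewrite !ffunE scalerA. Qed.
Lemma dffun_scale1 : left_id 1 dffun_scale.
Proof. by move=> c; apply/ffunP=> i; rewrite !ffunE scale1r. Qed.
Lemma dffun_scaleDr : right_distributive dffun_scale +%R.
Proof. by move=> a b c; apply/ffunP=> i; rewrite !ffunE scalerDr. Qed.
Lemma dffun_scaleDl c : {morph dffun_scale^~ c : a b / a + b}.
Proof. by move=> a b; apply/ffunP=> i; rewrite !ffunE scalerDl. Qed.

HB.instance Definition _ :=
  GRing.Zmodule_isLmodule.Build R {dffun forall i, T i}
    dffun_scaleA dffun_scale1 dffun_scaleDr dffun_scaleDl.

End DffunLmod.

Section Cech.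
Variables (R : comNzRingType) (k : nat) (f : 'I_k -> R) (M : lmodType R).

Definition cech_prod (I : {set 'I_k}) : R := \prod_(j in I) f j.

(* The direct sum of all terms of the Cech complex; the term of degree i is
   the submodule of the families supported on the subsets of size i. *)
Definition cech := {dffun forall I : {set 'I_k}, loc M (cech_prod I)}.
HB.instance Definition _ := GRing.Lmodule.on cech.

Definition cech_deg (i : nat) (c : cech) : bool :=
  [forall I : {set 'I_k}, (#|I| != i) ==> (c I == 0)].

Definition cech_d (c : cech) : cech :=
  [ffun I : {set 'I_k} => \sum_(j in I)
     (-1) ^+ #|[set l in I | (l < j)%N]| *:
       loc_map (f j) (cech_prod I) (c (I :\ j))].

Lemma cech_d_linear : linear cech_d.
Proof.
move=> a c c'; apply/ffunP=> I; rewrite !ffunE scaler_sumr -big_split /=.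
apply: eq_bigr => j jI; rewrite !ffunE loc_map_linear.
  by rewrite scalerDr !scalerA (mulrC a).
by rewrite /cech_prod (big_setD1 j).
Qed.

Lemma cech_d0 : cech_d 0 = 0.
Proof. by have := cech_d_linear (-1) 0 0; rewrite !scaleN1r !addNr. Qed.

Definition cocycles (i : nat) : {pred cech} :=
  fun c => cech_deg i c && (cech_d c == 0).

Lemma cocycles_submod_closed i : submod_closed (cocycles i).
Proof.
split=> [|a c c'].
  rewrite unfold_in /cocycles cech_d0 eqxx andbT; apply/forallP=> I; apply/implyP=> _.
  by rewrite ffunE.
rewrite !unfold_in => /andP[/forallP c0 /eqP dc] /andP[/forallP c'0 /eqP dc'].
apply/andP; split; last by rewrite cech_d_linear dc dc' scaler0 addr0.
apply/forallP=> I; apply/implyP=> Ii; have := c0 I; have := c'0 I.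
by rewrite Ii !ffunE => /eqP -> /eqP ->; rewrite scaler0 addr0.
Qed.

HB.instance Definition _ i :=
  GRing.isSubmodClosed.Build R cech (cocycles i) (cocycles_submod_closed i).

Record cocycle (i : nat) :=
  Cocycle { cocycle_val :> cech; _ : cocycle_val \in cocycles i }.

HB.instance Definition _ i := [isSub for @cocycle_val i].
HB.instance Definition _ i := [Choice of cocycle i by <:].
HB.instance Definition _ i := [SubChoice_isSubLmodule of cocycle i by <:].

(* For i = 0 only b = 0 satisfies the degree condition. *)
Definition coboundaries (i : nat) : {pred cocycle i} := fun z =>
  `[< exists2 b : cech, forall I : {set 'I_k}, #|I|.+1 != i -> b I = 0
        & cocycle_val z = cech_d b >].

Lemma coboundaries_submod_closed i : submod_closed (@coboundaries i).
Proof.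
split=> [|a z z'].
  apply/asboolP; exists 0 => [I _|]; first by rewrite ffunE.
  by rewrite cech_d0.
move=> /asboolP[b b0 zE] /asboolP[b' b'0 z'E]; apply/asboolP.
exists (a *: b + b') => [I Ii|]; last by rewrite cech_d_linear -zE -z'E.
by rewrite !ffunE b0 // b'0 // scaler0 addr0.
Qed.

HB.instance Definition _ i :=
  GRing.isSubmodClosed.Build R (cocycle i) (@coboundaries i)
    (@coboundaries_submod_closed i).

(* H^i_a(M) for the ideal a generated by f, computed from the generators f. *)
Definition local_cohomology (i : nat) : lmodType R := lquot (@coboundaries i).

Definition cohomological_dimension : ext_int :=
  ext_sup [set ext_nat i
             | i in [set i | ~ zero_module (local_cohomology i)]].

Definition grade : ext_int :=
  ext_inf [set ext_nat i
             | i in [set i | ~ zero_module (local_cohomology i)]].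

Definition finiteness_dimension : ext_int :=
  ext_inf [set ext_nat i
             | i in [set i | ~ finitely_generated (local_cohomology i)]].

End Cech.

Section Invariants.
Variables (F : fieldType) (gT : finGroupType) (G : {group gT}) (n : nat).
Variable rG : mx_representation F G n.

(* (g . p)(v) = p(g^-1 v) for column vectors v. *)
Definition mpoly_act (g : gT) (p : {mpoly F[n]}) : {mpoly F[n]} :=
  p \mPo [tuple \sum_(j < n) rG (g^-1)%g i j *: 'X_j | i < n].

Definition invariants : {pred {mpoly F[n]}} :=
  fun p => [forall g in G, mpoly_act g p == p].

Lemma invariants_subring_closed : subring_closed invariants.
Proof.
split=> [|p q /forall_inP pG /forall_inP qG|p q /forall_inP pG /forall_inP qG].
- by apply/forall_inP=> g _; rewrite /mpoly_act rmorph1.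
- apply/forall_inP=> g gG; rewrite /mpoly_act rmorphB /=.
  by rewrite -!/(mpoly_act _ _) (eqP (pG g gG)) (eqP (qG g gG)).
apply/forall_inP=> g gG; rewrite /mpoly_act rmorphM /=.
by rewrite -!/(mpoly_act _ _) (eqP (pG g gG)) (eqP (qG g gG)).
Qed.

HB.instance Definition _ :=
  GRing.isSubringClosed.Build {mpoly F[n]} invariants invariants_subring_closed.

Record invariant_ring :=
  Invariant { inv_val :> {mpoly F[n]}; _ : inv_val \in invariants }.

HB.instance Definition _ := [isSub for inv_val].
HB.instance Definition _ := [Choice of invariant_ring by <:].
HB.instance Definition _ :=
  [SubChoice_isSubComNzRing of invariant_ring by <:].

(* a contains the homogeneous components of each of its elements. *)
Definition homogeneous (a : {pred invariant_ring}) : Prop :=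
  forall r (d : nat), r \in a ->
    exists2 h, h \in a & inv_val h = pihomog mdeg d (inv_val r).

End Invariants.

(* Main.v *)
(* Write S = F[x_1, ..., x_n], R = S^G and H^i for H^i_a(R).

   Vanishing (n > 0). A Sylow p-subgroup of G, for p the characteristic, fixes
   some v <> 0, and the stabilizer H of v has index prime to p. The polynomial
   flows x + t x and x + t v act by Hasse-Schmidt derivations on Cech complexes,
   so the annihilator of H^i_a(S^H) is homogeneous and stable under translation by
   v. If H^i has finite length, some power of each homogeneous h in R of positive
   degree kills it; S^H being generically etale over R along v, the annihilator of
   H^i_a(S^H) then contains a homogeneous element nonzero at v, hence 1 by
   translation. The transfer makes R a direct summand of S^H, so H^i = 0.

   Height. Let c be the last degree with H^c <> 0; H^i = 0 for i < c. Then a contains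
   a regular sequence of length c, which gives a chain of c strict inclusions below
   every prime containing a. Conversely, let E be a maximal set of variables
   algebraically independent modulo aS, q a prime of S containing aS such that they
   remain so modulo q, L the fraction field of S/q, and h = n - #|E|. Specializing
   the variables of E gives a map S -> L[X_1, ..., X_n] for which some H^i with
   i >= h is nonzero at a point, so h <= c; and by counting linearly independent
   polynomials of bounded degree, chains of primes below the contraction of q to R
   have length at most h.

   Finiteness. As H^i = 0 for i > c, H^c is the sum of the f_j^N H^c for every N;
   a finitely generated H^c is killed by all the f_j^N for some N. *)
Require Import Defs.
From HB Require Import structures.
From mathcomp Require Import all_fingroup all_character.
From mathcomp Require Import all_boot all_order all_algebra.
From mathcomp Require Import zify ring.
From mathcomp Require Import boolp classical_sets.
From mathcomp Require Import mpoly.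
From mathcomp Require Import -(notations) constructive_ereal.

Set Implicit Arguments.
Unset Strict Implicit.
Unset Printing Implicit Defensive.

Import GRing.Theory.
Local Open Scope ring_scope.

Local Notation frac := Defs.frac.

(** * The Cech complex relative to a submodule *)

(** When the characteristic divides the order of [G], the two tools used on S^H make opposite
    demands: translation by [v] preserves the invariants of a subgroup fixing [v], which asks for a
    small [H], while the normalized transfer divides by the index, which asks for a large one. The
    stabilizer of a vector fixed by a Sylow subgroup meets both. The argument bears on annihilators
    of cohomology rather than on cohomology: they are ordinary ideals of the ring, so gradings and
    derivations need not be transported to the H^i. Cohomology of [M / L] is expressed by cochains
    of [M] that are cocycles up to [L]; exact sequences then become explicit corrections of
    cochains. In the height bound, a chain of length l below the contraction of q yields m^(#|E| +
    l) independent polynomials in degrees linear in m, where only a multiple of m^n fit. The field L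
    needs no algebraic closure: it already contains the coordinates of the required point, the
    residues of the variables modulo q. *)

Lemma zero_submod_closed (R : comNzRingType) (M : lmodType R) : submod_closed (pred1 (0 : M)).
Proof.
by split=> [|a x y]; rewrite !inE // => /eqP-> /eqP->; rewrite scaler0 addr0.
Qed.

Section Loc.
Variables (R : comNzRingType) (M : lmodType R).
Implicit Types (f g h : R) (L : {pred M}).

Lemma fracDm f (x y : M) m : frac f x m + frac f y m = frac f (x + y) m.
Proof.
rewrite fracD -scalerDr; apply/fracP; exists 0%N.
by rewrite scalerA -exprD.
Qed.

Lemma frac0 f m : frac f 0 m = 0 :> loc M f.
Proof. by apply/fracP; exists 0%N; rewrite !scaler0. Qed.

Lemma fracMK f e (x : M) m : frac f (f ^+ e *: x) (e + m) = frac f x m.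
Proof. by apply/fracP; exists 0%N; rewrite scalerA -exprD; congr (_ ^+ _ *: _); lia. Qed.

Lemma frac_eq0 f (x : M) m : frac f x m = 0 <-> exists e, f ^+ e *: x = 0.
Proof.
rewrite -[0](frac0 f 0); split=> [/fracP[e]|[e fx]].
  by rewrite addn0 scaler0 => fx; exists e.
by apply/fracP; exists e; rewrite addn0 scaler0.
Qed.

Lemma loc_map_is_additive f g h : h = g * f ->
  {morph @loc_map _ M f g h : u v / u + v}.
Proof. by move=> hE u v; have := loc_map_linear hE 1 u v; rewrite !scale1r. Qed.

Lemma loc_map0 f g h : h = g * f -> @loc_map _ M f g h 0 = 0.
Proof.
by move=> hE; rewrite -[0 in LHS](frac0 f 0) loc_mapE // scaler0 frac0.
Qed.

Lemma loc_mapZ f g h : h = g * f ->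
  forall r u, @loc_map _ M f g h (r *: u) = r *: loc_map g h u.
Proof.
by move=> hE r u; have := loc_map_linear hE r u 0; rewrite loc_map0 // !addr0.
Qed.

Lemma loc_map_sum f g h : h = g * f -> forall I (r : seq I) P (F : I -> loc M f),
  loc_map g h (\sum_(i <- r | P i) F i) = \sum_(i <- r | P i) loc_map g h (F i).
Proof.
move=> hE I r P F; apply: (big_morph _ (loc_map_is_additive hE)).
exact: loc_map0.
Qed.

Lemma loc_map_comp f0 g1 h1 g2 h2 g : h1 = g1 * f0 -> h2 = g2 * h1 -> g = g2 * g1 ->
  forall u : loc M f0, loc_map g2 h2 (loc_map g1 h1 u) = loc_map g h2 u.
Proof.
move=> e1 e2 ->; elim/fracW=> x m; rewrite !loc_mapE ?scalerA -?exprMn //.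
by rewrite e2 e1 mulrA.
Qed.

(** The image of [L_f] in [M_f]. Localization being exact, [M_f] modulo this image is [(M / L)_f],
    so the cohomology of [M / L] can be computed without forming the quotient. *)
Definition inloc L f (u : loc M f) : Prop :=
  exists x m, x \in L /\ u = frac f x m.

Section InLoc.
Variable L : {pred M}.
Hypothesis hL : submod_closed L.

Lemma sub0 : 0 \in L. Proof. by case: hL. Qed.
Lemma subZ r x : x \in L -> r *: x \in L.
Proof. by case: hL => L0 LZ Lx; rewrite -[_ *: _]addr0; apply: LZ. Qed.
Lemma subD x y : x \in L -> y \in L -> x + y \in L.
Proof. by case: hL => L0 LZ Lx Ly; rewrite -[x]scale1r; apply: LZ. Qed.
Lemma subN x : x \in L -> - x \in L.
Proof. by rewrite -scaleN1r; apply: subZ. Qed.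
Lemma subB x y : x \in L -> y \in L -> x - y \in L.
Proof. by move=> Lx /subN; apply: subD. Qed.
Lemma sub_sum I (r : seq I) (P : pred I) F :
  (forall i, P i -> F i \in L) -> \sum_(i <- r | P i) F i \in L.
Proof. by move=> LF; apply: (big_ind (fun x => x \in L)) => //; [exact: sub0 | exact: subD]. Qed.

Lemma inloc_frac f x m : inloc L (frac f x m) <-> exists e, f ^+ e *: x \in L.
Proof.
split=> [[y [n [Ly /fracP[e exy]]]]|[e Lx]].
  by exists (e + n)%N; rewrite exy subZ.
by exists (f ^+ e *: x), (e + m)%N; split=> //; rewrite fracMK.
Qed.

Lemma inloc0 f : inloc L (0 : loc M f).
Proof. by exists 0, 0%N; split; [exact: sub0|]. Qed.

Lemma inlocD f (u v : loc M f) : inloc L u -> inloc L v -> inloc L (u + v).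
Proof.
move=> [x [m [Lx ->]]] [y [n [Ly ->]]]; rewrite fracD; exists (f ^+ n *: x + f ^+ m *: y), (m + n)%N.
by split=> //; apply: subD; apply: subZ.
Qed.

Lemma inlocZ f r (u : loc M f) : inloc L u -> inloc L (r *: u).
Proof. by move=> [x [m [Lx ->]]]; rewrite fracZ; exists (r *: x), m; split=> //; apply: subZ. Qed.

Lemma inloc_sum f I (r : seq I) (P : pred I) (F : I -> loc M f) :
  (forall i, P i -> inloc L (F i)) -> inloc L (\sum_(i <- r | P i) F i).
Proof. by move=> LF; apply: (big_ind (@inloc L f)) => //; [exact: inloc0 | exact: inlocD]. Qed.

Lemma inloc_map f g h (u : loc M f) : h = g * f -> inloc L u -> inloc L (loc_map g h u).
Proof.
move=> hE [x [m [Lx ->]]]; rewrite loc_mapE //; exists (g ^+ m *: x), m.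
by split=> //; apply: subZ.
Qed.

(** The kernel of [(M / L)_f -> (M / L)_(g f)] is torsion for the powers of [g]. *)
Lemma inloc_map_inv f g h (u : loc M f) : h = g * f -> inloc L (loc_map g h u) ->
  exists e, inloc L (g ^+ e *: u).
Proof.
elim/fracW: u => x m hE; rewrite loc_mapE // => /inloc_frac[e Lx].
exists (e + m)%N; rewrite fracZ; apply/inloc_frac; exists e.
have -> : f ^+ e *: (g ^+ (e + m) *: x) = h ^+ e *: (g ^+ m *: x); last by [].
by rewrite !scalerA hE exprMn exprD; congr (_ *: _); ring.
Qed.

End InLoc.

End Loc.

Lemma lquot_pi_eq0 (R : comNzRingType) (M : lmodType R) (N : submodClosed M) (x : M) :
  lquot_pi N x = 0 <-> x \in N.
Proof.
have e0 : lquot_pi N 0 = 0.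
  have /eqP := lquot_piD N 0 0; rewrite addr0 -subr_eq0 opprD addrA subrr sub0r.
  by rewrite oppr_eq0 => /eqP.
by rewrite -e0; split=> [/lquot_piP|H]; [|apply/lquot_piP]; rewrite subr0.
Qed.

Section CechD.
Variables (R : comNzRingType) (k : nat) (f : 'I_k -> R) (M : lmodType R).
Implicit Types (c : cech f M) (I A : {set 'I_k}).

Lemma cech_prodD1 I j : j \in I -> cech_prod f I = f j * cech_prod f (I :\ j).
Proof. by move=> jI; rewrite /cech_prod (big_setD1 j). Qed.

Definition sgn I (j : 'I_k) : R := (-1) ^+ #|[set l in I | (l < j)%N]|.

Lemma sgn_sqr I j : sgn I j * sgn I j = 1.
Proof. by rewrite /sgn -expr2 sqrr_sign. Qed.

(** Removing [j] flips the sign of exactly the indices above [j]. *)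
Lemma sgnD1 I j l : j \in I -> sgn (I :\ j) l = (-1) ^+ (j < l)%N * sgn I l.
Proof.
move=> jI; rewrite /sgn; case: ltnP => jl.
  rewrite [in RHS](cardsD1 j) inE jI jl exprD mulrA -expr2 sqrr_sign mul1r.
  by congr (_ ^+ #|pred_of_set _|); apply/setP=> x; rewrite !inE andbA.
rewrite mul1r; congr (_ ^+ #|pred_of_set _|); apply/setP=> x; rewrite !inE.
by case: eqP => //= ->; rewrite ltnNge jl andbF.
Qed.

Lemma cech_dE c I : cech_d c I = \sum_(j in I)
   sgn I j *: loc_map (f j) (cech_prod f I) (c (I :\ j)).
Proof. by rewrite ffunE. Qed.

Lemma cech_dD : {morph @cech_d _ _ f M : c c' / c + c'}.
Proof. by move=> c c'; have := cech_d_linear 1 c c'; rewrite !scale1r. Qed.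
Lemma cech_dZ r c : cech_d (r *: c) = r *: cech_d c.
Proof. by have := cech_d_linear r c 0; rewrite cech_d0 !addr0. Qed.
Lemma cech_dN c : cech_d (- c) = - cech_d c.
Proof. by rewrite -scaleN1r cech_dZ scaleN1r. Qed.
Lemma cech_dB c c' : cech_d (c - c') = cech_d c - cech_d c'.
Proof. by rewrite cech_dD cech_dN. Qed.
Lemma cech_sumE T (r : seq T) (P : pred T) (F : T -> cech f M) I :
  (\sum_(i <- r | P i) F i) I = \sum_(i <- r | P i) F i I.
Proof. by apply: (big_morph (fun c : cech f M => c I)) => [c c'|]; rewrite ffunE. Qed.
Lemma cech_d_sum T (r : seq T) (P : pred T) (F : T -> cech f M) :
  cech_d (\sum_(i <- r | P i) F i) = \sum_(i <- r | P i) cech_d (F i).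
Proof. by apply: (big_morph _ cech_dD); exact: cech_d0. Qed.

(** The double sum runs over ordered pairs of distinct indices of [I]; by [sgnD1] the terms [(j, l)]
    and [(l, j)] have opposite signs and the same composite localization map. *)
Lemma cech_dd c : cech_d (cech_d c) = 0.
Proof.
apply/ffunP=> I; rewrite cech_dE [RHS]ffunE.
pose g A := loc_map (cech_prod f (I :\: A)) (cech_prod f I) (c A).
pose t j l : loc M (cech_prod f I) := (sgn I j * sgn (I :\ j) l) *: g (I :\ j :\ l).
transitivity (\sum_(j in I) \sum_(l in I | l != j) t j l).
  apply: eq_bigr => j jI; rewrite cech_dE loc_map_sum ?cech_prodD1 //.
  rewrite scaler_sumr; apply: eq_big => [l|l]; first by rewrite !inE andbC.
  rewrite !inE => /andP[lj lI]; rewrite loc_mapZ ?scalerA; last exact: cech_prodD1.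
  rewrite /t /g; congr (_ *: _).
  have lIj : l \in I :\ j by rewrite !inE lj.
  apply: loc_map_comp.
  - exact: cech_prodD1.
  - exact: cech_prodD1.
  have -> : I :\: (I :\ j :\ l) = [set j; l].
    apply/setP=> x; rewrite !inE; case: (eqVneq x l) => [->|] /=.
      by rewrite lI orbT.
    by case: (eqVneq x j) => [->|] //=; rewrite ?jI //; case: (x \in I).
  by rewrite /cech_prod big_setU1 /= ?inE 1?eq_sym // big_set1.
  exact: cech_prodD1.
transitivity (\sum_(j in I) (\sum_(l : 'I_k | (l \in I) && (l < j)%N) t j l
           + \sum_(l : 'I_k | (l \in I) && (j < l)%N) t j l)).
  apply: eq_bigr => j jI; rewrite (bigID (fun l : 'I_k => (l < j)%N)) /=; congr (_ + _).
    by apply: eq_bigl => l; rewrite -andbA; congr (_ && _); rewrite -val_eqE; case: ltngtP.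
  by apply: eq_bigl => l; rewrite -andbA; congr (_ && _); rewrite -val_eqE /=; case: ltngtP.
rewrite big_split /= (exchange_big_dep (mem I)) /=; last by move=> ? ? _ /andP[].
rewrite -big_split /= big1 // => j jI.
rewrite [X in X + _](eq_bigl (fun l => (l \in I) && (j < l)%N)); last by move=> l; rewrite jI.
rewrite -big_split big1 //= => l /andP[lI jl]; rewrite /t finset.setDDl finset.setUC -finset.setDDl -scalerDl.
rewrite (sgnD1 _ lI) (sgnD1 _ jI) jl ltnNge (ltnW jl) /= mul1r mulN1r.
by rewrite mulrN mulrC addrN scale0r.
Qed.

Lemma cech_degP i c : reflect (forall I, #|I| != i -> c I = 0) (cech_deg i c).
Proof.
apply: (iffP forallP) => H I; first by move=> Ii; apply/eqP; apply: (implyP (H I)).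
by apply/implyP=> Ii; apply/eqP; apply: H.
Qed.

(* The degree condition "degree [i - 1]", which forces [c = 0] when [i = 0]. *)
Definition cech_degp i c : Prop := forall I, #|I|.+1 != i -> c I = 0.

Lemma cech_degpS i c : cech_degp i.+1 c <-> cech_deg i c.
Proof. by split=> [H|/cech_degP H]; [apply/cech_degP=> I Ii|move=> I Ii]; apply: H; rewrite ?eqSS // -eqSS. Qed.

Lemma cech_degp0 c : cech_degp 0 c -> c = 0.
Proof. by move=> H; apply/ffunP=> I; rewrite H // ffunE. Qed.

Lemma cech_degZD i r c c' : cech_deg i c -> cech_deg i c' -> cech_deg i (r *: c + c').
Proof.
move=> /cech_degP H /cech_degP H'; apply/cech_degP=> I Ii.
by rewrite !ffunE H // H' // scaler0 addr0.
Qed.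
Lemma cech_deg0 i : cech_deg i (0 : cech f M).
Proof. by apply/cech_degP=> I _; rewrite ffunE. Qed.
Lemma cech_degZ i r c : cech_deg i c -> cech_deg i (r *: c).
Proof. by move=> H; rewrite -[_ *: _]addr0; apply: cech_degZD (cech_deg0 i). Qed.
Lemma cech_degD i c c' : cech_deg i c -> cech_deg i c' -> cech_deg i (c + c').
Proof. by move=> H H'; rewrite -[c]scale1r; apply: cech_degZD. Qed.
Lemma cech_degN i c : cech_deg i c -> cech_deg i (- c).
Proof. by rewrite -scaleN1r; apply: cech_degZ. Qed.
Lemma cech_degB i c c' : cech_deg i c -> cech_deg i c' -> cech_deg i (c - c').
Proof. by move=> H /cech_degN; apply: cech_degD. Qed.
Lemma cech_degpZD i r c c' : cech_degp i c -> cech_degp i c' -> cech_degp i (r *: c + c').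
Proof. by move=> H H' I Ii; rewrite !ffunE H // H' // scaler0 addr0. Qed.
Lemma cech_degp_0 i : cech_degp i (0 : cech f M).
Proof. by move=> I _; rewrite ffunE. Qed.
Lemma cech_degpZ i r c : cech_degp i c -> cech_degp i (r *: c).
Proof. by move=> H; rewrite -[_ *: _]addr0; exact: (cech_degpZD r H (@cech_degp_0 i)). Qed.
Lemma cech_degpD i c c' : cech_degp i c -> cech_degp i c' -> cech_degp i (c + c').
Proof. by move=> H H'; have := cech_degpZD 1 H H'; rewrite scale1r. Qed.
Lemma cech_degpN i c : cech_degp i c -> cech_degp i (- c).
Proof. by move=> H; rewrite -scaleN1r; exact: (cech_degpZ (-1) H). Qed.

Lemma cech_deg_d i c : cech_deg i c -> cech_deg i.+1 (cech_d c).
Proof.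
move=> /cech_degP H; apply/cech_degP=> I Ii; rewrite cech_dE big1 // => j jI.
rewrite H; first by rewrite loc_map0 ?scaler0 //; exact: cech_prodD1.
by apply: contraNN Ii => /eqP <-; rewrite (cardsD1 j I) jI.
Qed.

Lemma cech_degp_d i c : cech_degp i c -> cech_deg i (cech_d c).
Proof.
case: i => [/cech_degp0->|i /cech_degpS]; first by rewrite cech_d0 cech_deg0.
exact: cech_deg_d.
Qed.

Lemma cech_deg_gt i c : (k < i)%N -> cech_deg i c -> c = 0.
Proof.
move=> ki /cech_degP H; apply/ffunP=> I; rewrite H ?ffunE //.
by rewrite neq_ltn (leq_ltn_trans (max_card _)) // card_ord.
Qed.

Definition incech (L : {pred M}) c : Prop := forall I, inloc L (c I).

Section InCech.
Variable L : {pred M}.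
Hypothesis hL : submod_closed L.

Lemma incech0 : incech L 0. Proof. by move=> I; rewrite ffunE; apply: inloc0. Qed.
Lemma incechD c c' : incech L c -> incech L c' -> incech L (c + c').
Proof. by move=> H H' I; rewrite ffunE; apply: inlocD. Qed.
Lemma incechZ r c : incech L c -> incech L (r *: c).
Proof. by move=> H I; rewrite ffunE; apply: inlocZ. Qed.
Lemma incechN c : incech L c -> incech L (- c).
Proof. by rewrite -scaleN1r; apply: incechZ. Qed.
Lemma incechB c c' : incech L c -> incech L c' -> incech L (c - c').
Proof. by move=> H /incechN; apply: incechD. Qed.
Lemma incech_d c : incech L c -> incech L (cech_d c).
Proof.
move=> H I; rewrite cech_dE; apply: inloc_sum => // j jI.
by apply: inlocZ => //; apply: inloc_map => //; apply: cech_prodD1.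
Qed.
End InCech.

Lemma incech_pred1 c : incech (pred1 0) c <-> c = 0.
Proof.
split=> [H|->]; last by move=> I; rewrite ffunE; exists 0, 0%N; rewrite inE.
apply/ffunP=> I; have [x [m [/eqP-> ->]]] := H I; rewrite ffunE; exact: frac0.
Qed.

(* The vanishing of [H^i_f(M / L)], expressed with cochains of [M]. *)
Definition rvan i (L : {pred M}) : Prop :=
  forall c, cech_deg i c -> incech L (cech_d c) ->
  exists b, cech_degp i b /\ incech L (c - cech_d b).

Lemma rvan_gt i L : submod_closed L -> (k < i)%N -> rvan i L.
Proof.
move=> hL ki c /cech_deg_gt-> // _; exists 0; split; first exact: cech_degp_0.
by rewrite cech_d0 subr0; apply: incech0.
Qed.

(** Vanishing of [H^i_f(M)] on the level of cochains; [hvanP] relates it to the quotient module of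
    the statement. *)
Definition hvan i : Prop := forall c, cech_deg i c -> cech_d c = 0 ->
  exists b : cech f M, cech_degp i b /\ c = cech_d b.

Lemma rvan0P i : rvan i (pred1 0) <-> hvan i.
Proof.
split=> H c ci.
  move=> /incech_pred1 /(H c ci)[b [bi /incech_pred1/eqP]].
  by rewrite subr_eq0 => /eqP; exists b.
move=> /incech_pred1 /(H c ci)[b [bi ->]]; exists b; split=> //.
by apply/incech_pred1; rewrite subrr.
Qed.

Lemma hvanP i : zero_module (local_cohomology f M i) <-> hvan i.
Proof.
split=> [H c ci dc|H].
  have cz : c \in cocycles (f := f) (M := M) i.
    by rewrite unfold_in; apply/andP; split=> //; apply/eqP.
  have /lquot_pi_eq0/asboolP[b bi] := H (lquot_pi _ (Cocycle cz)).
  by exists b.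
elim/lquot_piW => -[c cz].
have := cz; rewrite unfold_in => /andP[ci /eqP dc].
have [b [bi cb]] := H c ci dc.
by apply/lquot_pi_eq0; apply/asboolP; exists b.
Qed.

End CechD.

(** * Functoriality of the Cech complex *)

Section LocFun.
Variables (R R' : comNzRingType) (M : lmodType R) (M' : lmodType R').
Variables (f : R) (f' : R') (phi : M -> M').

(** Only additivity and compatibility with the inverted elements are asked of [phi], so that one
    construction serves coordinate maps, extensions of scalars, the inclusion of invariants and the
    transfer. *)
Definition loc_fun (u : loc M f) : loc M' f' := frac f' (phi (repr u).1) (repr u).2.

Hypothesis phiD : {morph phi : x y / x + y}.
Hypothesis phif : forall x, phi (f *: x) = f' *: phi x.

Lemma semilin_exp e x : phi (f ^+ e *: x) = f' ^+ e *: phi x.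
Proof.
elim: e => [|e IH]; first by rewrite !expr0 !scale1r.
by rewrite !exprS -!scalerA phif IH.
Qed.

Lemma semilin0 : phi 0 = 0.
Proof. by apply: (@addrI _ (phi 0)); rewrite -phiD !addr0. Qed.

Lemma loc_funE x m : loc_fun (frac f x m) = frac f' (phi x) m.
Proof.
rewrite /loc_fun; case E: (repr (frac f x m)) => [x' m'] /=.
have /fracP[k e] : frac f x' m' = frac f x m by rewrite -(fracK (frac f x m)) E.
by apply/fracP; exists k; rewrite -!semilin_exp e.
Qed.

Lemma loc_funD : {morph loc_fun : u v / u + v}.
Proof.
elim/fracW=> x m; elim/fracW=> y n.
by rewrite fracD !loc_funE fracD phiD !semilin_exp.
Qed.

Lemma loc_fun0 : loc_fun 0 = 0.
Proof. by rewrite -[0 in LHS](frac0 M f 0) loc_funE semilin0 frac0. Qed.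

Lemma loc_fun_sum T (r : seq T) P (F : T -> loc M f) :
  loc_fun (\sum_(i <- r | P i) F i) = \sum_(i <- r | P i) loc_fun (F i).
Proof. by apply: (big_morph _ loc_funD); exact: loc_fun0. Qed.

Lemma loc_funZ r r' u : (forall x, phi (r *: x) = r' *: phi x) ->
  loc_fun (r *: u) = r' *: loc_fun u.
Proof. by elim/fracW: u => x m Hr; rewrite fracZ !loc_funE Hr fracZ. Qed.

End LocFun.

Lemma loc_fun_map (R R' : comNzRingType) (M : lmodType R) (M' : lmodType R')
  (f g h : R) (f' g' h' : R') (phi : M -> M') : {morph phi : x y / x + y} ->
  (forall x, phi (f *: x) = f' *: phi x) -> (forall x, phi (g *: x) = g' *: phi x) ->
  h = g * f -> h' = g' * f' -> forall u : loc M f,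
  loc_fun h' phi (loc_map g h u) = loc_map g' h' (loc_fun f' phi u).
Proof.
move=> phiD ff gg hE h'E; elim/fracW=> x m.
rewrite loc_mapE // !loc_funE //; last by move=> y; rewrite hE h'E -!scalerA gg ff.
by rewrite loc_mapE // (semilin_exp gg).
Qed.

Section CechFun.
Variables (R R' : comNzRingType) (k : nat) (f : 'I_k -> R) (f' : 'I_k -> R').
Variables (M : lmodType R) (M' : lmodType R') (phi : M -> M').

Definition cech_fun (c : cech f M) : cech f' M' :=
  [ffun I : {set 'I_k} => loc_fun (cech_prod f' I) phi (c I)].

Hypothesis phiD : {morph phi : x y / x + y}.
Hypothesis phif : forall j x, phi (f j *: x) = f' j *: phi x.
Implicit Types (c : cech f M) (I : {set 'I_k}).

Lemma semilin_prod I x : phi (cech_prod f I *: x) = cech_prod f' I *: phi x.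
Proof.
rewrite /cech_prod; elim/big_ind2: _ x => [x|a a' b b' Ha Hb x|j _ x] //.
  by rewrite !scale1r.
by rewrite -!scalerA Ha Hb.
Qed.

Lemma cech_funD : {morph cech_fun : c c' / c + c'}.
Proof.
move=> c c'; apply/ffunP=> I; rewrite !ffunE loc_funD //; exact: semilin_prod.
Qed.

Lemma cech_fun0 : cech_fun 0 = 0.
Proof. by apply: (@addrI _ (cech_fun 0)); rewrite -cech_funD !addr0. Qed.

Lemma cech_funN c : cech_fun (- c) = - cech_fun c.
Proof. by apply/eqP; rewrite -addr_eq0 -cech_funD addNr cech_fun0. Qed.

Lemma cech_funB c c' : cech_fun (c - c') = cech_fun c - cech_fun c'.
Proof. by rewrite cech_funD cech_funN. Qed.

Lemma cech_funZ r r' c : (forall x, phi (r *: x) = r' *: phi x) ->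
  cech_fun (r *: c) = r' *: cech_fun c.
Proof.
move=> Hr; apply/ffunP=> I; rewrite !ffunE (loc_funZ _ _ Hr) //; exact: semilin_prod.
Qed.

Lemma cech_fun_deg i c : cech_deg i c -> cech_deg i (cech_fun c).
Proof.
move=> /cech_degP H; apply/cech_degP=> I Ii; rewrite ffunE H //.
by apply: loc_fun0 => //; exact: semilin_prod.
Qed.

Lemma cech_fun_degp i c : cech_degp i c -> cech_degp i (cech_fun c).
Proof.
move=> H I Ii; rewrite ffunE H //.
by apply: loc_fun0 => //; exact: semilin_prod.
Qed.

Lemma cech_fun_d c : cech_d (cech_fun c) = cech_fun (cech_d c).
Proof.
apply/ffunP=> I; rewrite cech_dE ffunE cech_dE loc_fun_sum //; last exact: semilin_prod.
apply: eq_bigr => j jI; rewrite ffunE.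
have sg x : phi (sgn R I j *: x) = sgn R' I j *: phi x.
  by rewrite /sgn -signr_odd -[in RHS]signr_odd; case: odd; rewrite ?expr0 ?expr1 ?scale1r // !scaleN1r;
     apply/eqP; rewrite -addr_eq0 -phiD addNr (semilin0 phiD).
rewrite (loc_funZ _ _ sg); last exact: semilin_prod.
congr (_ *: _); apply/esym; apply: loc_fun_map => //; try exact: semilin_prod.
- exact: cech_prodD1.
- exact: cech_prodD1.
Qed.

Definition kerp : {pred M} := fun x => phi x == 0.

(** Exactness of localization: a fraction mapped to 0 has, after multiplication by a power of the
    denominator, a numerator in the kernel. *)
Lemma cech_fun_ker c : cech_fun c = 0 <-> incech kerp c.
Proof.
split=> [/ffunP H I|H].
  move: (H I); rewrite !ffunE; elim/fracW: (c I) => x m.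
  rewrite loc_funE //; last exact: semilin_prod.
  move=> /frac_eq0[e He]; exists (cech_prod f I ^+ e *: x), (e + m)%N.
  rewrite fracMK; split=> //; rewrite unfold_in /kerp; apply/eqP.
  by rewrite -He (semilin_exp (semilin_prod I)).
apply/ffunP=> I; rewrite !ffunE; have [x [m [/eqP x0 ->]]] := H I.
by rewrite loc_funE // ?x0 ?frac0 //; exact: semilin_prod.
Qed.

Lemma cech_fun_incech (L : {pred M'}) c : (forall x, phi x \in L) -> incech L (cech_fun c).
Proof.
move=> H I; rewrite ffunE; elim/fracW: (c I) => x m.
by rewrite loc_funE //; [exists (phi x), m|exact: semilin_prod].
Qed.

Lemma cech_fun_lift i (c' : cech f' M') : cech_deg i c' ->
  (forall I, exists u : loc M (cech_prod f I), c' I = loc_fun (cech_prod f' I) phi u) ->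
  exists c, cech_deg i c /\ cech_fun c = c'.
Proof.
move=> /cech_degP ci H.
exists [ffun I : {set 'I_k} => if #|I| == i then sval (cid (H I)) else 0]; split.
  by apply/cech_degP=> I /negbTE Ii; rewrite ffunE Ii.
apply/ffunP=> I; rewrite !ffunE; case: eqP => [_|/eqP Ii].
  by case: (cid _) => u /= <-.
by rewrite ci // loc_fun0 //; exact: semilin_prod.
Qed.

End CechFun.

Lemma kerp_submod (R : comNzRingType) (M : lmodType R) (R' : comNzRingType) (M' : lmodType R')
  (s : R -> R') (phi : M -> M') : {morph phi : x y / x + y} ->
  (forall r x, phi (r *: x) = s r *: phi x) -> submod_closed (kerp phi).
Proof.
move=> phiD phiZ; split; first by rewrite unfold_in /kerp (semilin0 phiD).
move=> r x y; rewrite !unfold_in /kerp phiD phiZ => /eqP-> /eqP->.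
by rewrite scaler0 addr0.
Qed.

Lemma cech_fun_comp (R1 R2 R3 : comNzRingType) k (f1 : 'I_k -> R1) (f2 : 'I_k -> R2)
  (f3 : 'I_k -> R3) (M1 : lmodType R1) (M2 : lmodType R2) (M3 : lmodType R3)
  (phi : M1 -> M2) (psi : M2 -> M3) (chi : M1 -> M3) :
  (forall j x, phi (f1 j *: x) = f2 j *: phi x) ->
  (forall j x, psi (f2 j *: x) = f3 j *: psi x) ->
  chi =1 psi \o phi -> forall c : cech f1 M1,
  cech_fun f3 psi (cech_fun f2 phi c) = cech_fun f3 chi c.
Proof.
move=> pf qf /funext -> c; apply/ffunP=> I; rewrite !ffunE; elim/fracW: (c I) => x m.
have sp := semilin_prod pf I; have sq := semilin_prod qf I.
by rewrite !loc_funE //= => y; rewrite sp sq.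
Qed.

Lemma cech_fun_scale (R : comNzRingType) k (f : 'I_k -> R) (M : lmodType R) (r : R)
   (phi : M -> M) : (forall x, phi x = r *: x) ->
  forall c : cech f M, cech_fun f phi c = r *: c.
Proof.
move=> /funext -> c; apply/ffunP=> I; rewrite !ffunE; elim/fracW: (c I) => x m.
by rewrite loc_funE ?fracZ // => y; rewrite !scalerA mulrC.
Qed.

(** * Finitely generated modules and extension of scalars above the top degree *)

Section Free.
Variables (R : comNzRingType) (k : nat) (f : 'I_k -> R).

(** Semilinear map [R^t -> M] along [s]. A cochain has finitely many components, hence finitely many
    numerators; taking these for [l] reduces questions about large modules to quotients of free
    ones. *)
Definition lincomb (R' : comNzRingType) (M : lmodType R') (s : R -> R') t (l : 'I_t -> M) (x : 'rV[R]_t) : M :=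
  \sum_j s (x 0 j) *: l j.

Section LinComb.
Variables (R' : comNzRingType) (M : lmodType R') (s : {rmorphism R -> R'}) (t : nat) (l : 'I_t -> M).

Lemma lincombD : {morph lincomb s l : x y / x + y}.
Proof.
by move=> x y; rewrite -big_split; apply: eq_bigr => j _; rewrite mxE rmorphD scalerDl.
Qed.

Lemma lincombZ r x : lincomb s l (r *: x) = s r *: lincomb s l x.
Proof.
by rewrite scaler_sumr; apply: eq_bigr => j _; rewrite mxE rmorphM scalerA.
Qed.

Lemma lincomb_delta j r : lincomb s l (r *: delta_mx 0 j) = s r *: l j.
Proof.
rewrite lincombZ /lincomb (bigD1 j) //= big1 => [|i ij].
  by rewrite mxE !eqxx rmorph1 scale1r addr0.
by rewrite mxE (negbTE ij) andbF rmorph0 scale0r.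
Qed.

Lemma kerp_lincomb : submod_closed (kerp (lincomb s l)).
Proof. by apply: (kerp_submod (s := s)); [exact: lincombD|exact: lincombZ]. Qed.

End LinComb.

(** Project to each coordinate, solve there and reinject. *)
Lemma hvan_free i t : hvan f R^o i -> hvan f 'rV[R]_t i.
Proof.
move=> H c ci dc.
pose pr j (x : 'rV[R]_t) : R^o := x 0 j.
pose inj j (x : R^o) : 'rV[R]_t := (x : R) *: delta_mx 0 j.
have prD j : {morph pr j : x y / x + y} by move=> x y; rewrite /pr mxE.
have injD j : {morph inj j : x y / x + y} by move=> x y; rewrite /inj scalerDl.
have prZ j r x : pr j (r *: x) = r *: pr j x by rewrite /pr mxE.
have injZ j r x : inj j (r *: x) = r *: inj j x by rewrite /inj scalerA.
have Hj j : exists b : cech f R^o, cech_degp i b /\ cech_fun f (pr j) c = cech_d b.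
  apply: H; first exact: cech_fun_deg.
  by rewrite cech_fun_d // dc cech_fun0.
have [b /all_and2[bi bE]] := choice Hj.
exists (\sum_j cech_fun f (inj j) (b j)); split.
  apply: big_ind; [exact: cech_degp_0|exact: cech_degpD|move=> j _; exact: cech_fun_degp].
rewrite cech_d_sum; under eq_bigr => j _ do rewrite cech_fun_d // -bE.
have pm j x m I : loc_fun (cech_prod f I) (inj j) (loc_fun (cech_prod f I) (pr j) (frac (cech_prod f I) x m)) = frac (cech_prod f I) (inj j (pr j x)) m.
  by rewrite !loc_funE.
apply/ffunP=> I; rewrite cech_sumE.
under eq_bigr => j _ do rewrite !ffunE.
elim/fracW: (c I) => x m; under eq_bigr => j _ do rewrite pm.
rewrite [in LHS](row_sum_delta x).
by elim/big_ind2: _ => [|u v y z <- <-|] //; rewrite ?frac0 ?fracDm.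
Qed.

(** Vanishing of [H^i_f] on every finitely generated module, presented as [R^t / L]. *)
Definition qvan i := forall t (L : {pred 'rV[R]_t}), submod_closed L -> rvan f i L.

(** The numerators of [e] span the image of a map [psi] from a free module. Lift [e] to that free
    module, apply the hypothesis modulo the kernel of [psi], and push the solution back into [L]. *)
Lemma qvan_sub i t (L : {pred 'rV[R]_t}) : submod_closed L -> qvan i ->
  forall e : cech f 'rV[R]_t, cech_deg i e -> incech L e -> cech_d e = 0 ->
  exists v : cech f 'rV[R]_t, [/\ cech_degp i v, incech L v & e = cech_d v].
Proof.
move=> hL H e ei eL de.
have [l hl] := choice (fun I => eL I).
pose l' (j : 'I_#|{set 'I_k}|) := l (enum_val j).
pose psi := lincomb idfun l'.
have psiD : {morph psi : x y / x + y} by exact: lincombD.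
have psiZ r x : psi (r *: x) = r *: psi x by exact: lincombZ.
have psif j x : psi (f j *: x) = f j *: psi x by exact: psiZ.
have psiL x : psi x \in L.
  apply: (sub_sum hL) => j _; apply: (subZ hL); by have [m []] := hl (enum_val j).
have [|y [yi ye]] := cech_fun_lift psiD (fun j x => psiZ (f j) x) ei.
  move=> I; have [m [_ ->]] := hl I.
  exists (frac (cech_prod f I) (1 *: delta_mx 0 (enum_rank I)) m); rewrite loc_funE //.
  by rewrite /psi lincomb_delta /l' enum_rankK scale1r.
have dyK : incech (kerp psi) (cech_d y).
  by apply/(cech_fun_ker psif); rewrite -cech_fun_d // ye.
have [b [bi /(cech_fun_ker psif)]] := H _ _ (kerp_lincomb _ _) y yi dyK.
rewrite cech_funB // ye => /eqP; rewrite subr_eq0 => /eqP eE; exists (cech_fun f psi b); split.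
- exact: cech_fun_degp.
- exact: cech_fun_incech.
- by rewrite cech_fun_d.
Qed.

(** Descending induction from [i > k], through [H^i(R^t) -> H^i(R^t / L) -> H^(i+1)(L)]. *)
Lemma hvan_qvan c : (forall i, (c < i)%N -> hvan f R^o i) ->
  forall i, (c < i)%N -> qvan i.
Proof.
move=> H i; move: {2}(k.+1 - i)%N (erefl (k.+1 - i)%N) => d.
elim: d i => [|d IH] i; first by move=> /eqP ki ci t L hL; apply: rvan_gt.
move=> dE ci t L hL z zi dz.
have {}IH : qvan i.+1 by apply: IH; lia.
have [v [/cech_degpS vi vL vE]] := qvan_sub hL IH (cech_deg_d zi) dz (cech_dd z).
have [||w [wi wE]] := hvan_free (t := t) (H i ci) (c := z - v).
- exact: cech_degB.
- by rewrite cech_dB vE subrr.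
by exists w; split=> //; rewrite -wE opprB addrC subrK.
Qed.

(** A cocycle over [B] lives in the [R]-module spanned by its numerators, a quotient of a free
    module. Its lift [y] has coboundary in the kernel, and vanishing in degree [i + 1] corrects [y]
    to a cocycle of the free module. *)
Lemma hvan_alg c (B : comNzRingType) (s : {rmorphism R -> B}) :
  (forall i, (c < i)%N -> hvan f R^o i) ->
  forall i, (c < i)%N -> hvan (s \o f) B^o i.
Proof.
move=> H i ci z zi dz.
have hz (I : {set 'I_k}) : exists x : B^o, exists m, z I = frac (cech_prod (s \o f) I) x m.
  by elim/fracW: (z I) => x m; exists x, m.
have [l hl] := choice hz.
pose l' (j : 'I_#|{set 'I_k}|) := l (enum_val j).
pose psi := lincomb s l'.
have psiD : {morph psi : x y / x + y} by exact: lincombD.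
have psiZ r x : psi (r *: x) = s r *: psi x by exact: lincombZ.
have psif j x : psi (f j *: x) = (s \o f) j *: psi x by exact: psiZ.
have [|y [yi ye]] := cech_fun_lift psiD psif zi.
  move=> I; have [m ->] := hl I.
  exists (frac (cech_prod f I) (1 *: delta_mx 0 (enum_rank I)) m).
  rewrite loc_funE //; last exact: semilin_prod.
  by rewrite /psi lincomb_delta /l' enum_rankK rmorph1 scale1r.
have dyK : incech (kerp psi) (cech_d y).
  by apply/(cech_fun_ker psif); rewrite -cech_fun_d // ye.
have [|v [/cech_degpS vi vK vE]] := qvan_sub (kerp_lincomb s l') (hvan_qvan H (i := i.+1) _) (cech_deg_d yi) dyK (cech_dd y).
  exact: ltnW.
have [||w [wi wE]] := hvan_free (t := #|{set 'I_k}|) (H i ci) (c := y - v).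
- exact: cech_degB.
- by rewrite cech_dB vE subrr.
exists (cech_fun (s \o f) psi w); split; first exact: cech_fun_degp.
rewrite cech_fun_d // -wE cech_funB // ye.
by have /(cech_fun_ker psif) -> := vK; rewrite subr0.
Qed.

(** The map [psi : R^k -> R] with coordinates [f j ^+ N] becomes surjective once some [f j] is
    inverted, so [z] lifts; the obstruction to lifting it as a cocycle is a class of degree [c + 1]
    in the kernel. *)
Lemma top_cocycle_comb c N : (0 < c)%N -> (forall i, (c < i)%N -> hvan f R^o i) ->
  forall z : cech f R^o, cech_deg c z -> cech_d z = 0 ->
  exists w : 'I_k -> cech f R^o,
    [/\ forall j, cech_deg c (w j), forall j, cech_d (w j) = 0
      & z = \sum_j f j ^+ N *: w j].
Proof.
move=> c0 H z zi dz.
pose psi : 'rV[R]_k -> R^o := lincomb idfun (fun j => f j ^+ N : R^o).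
have psiD : {morph psi : x y / x + y} by exact: lincombD.
have psiZ r x : psi (r *: x) = r *: psi x by exact: lincombZ.
have psif j x : psi (f j *: x) = f j *: psi x by exact: psiZ.
have [|y [yi ye]] := cech_fun_lift psiD psif zi.
  move=> I; have [Ic|Ic] := eqVneq #|I| c; last first.
    move/cech_degP: zi => -> //; exists 0; rewrite loc_fun0 //; exact: (semilin_prod psif).
  (* [c > 0] matters: at the empty set nothing is inverted. *)
  have /card_gt0P[j jI] : (0 < #|I|)%N by rewrite Ic.
  elim/fracW: (z I) => x m.
  exists (frac (cech_prod f I) ((cech_prod f (I :\ j) ^+ N * x) *: delta_mx 0 j) (N + m)).
  rewrite loc_funE; last exact: (semilin_prod psif).
  have -> : psi ((cech_prod f (I :\ j) ^+ N * x) *: delta_mx 0 j) = cech_prod f I ^+ N *: x.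
    rewrite /psi lincomb_delta (cech_prodD1 f jI) exprMn /GRing.scale /=; ring.
  by rewrite fracMK.
have dyK : incech (kerp psi) (cech_d y).
  by apply/(cech_fun_ker psif); rewrite -cech_fun_d // ye.
have [|v [/cech_degpS vi vK vE]] := qvan_sub (kerp_lincomb _ _) (hvan_qvan H (i := c.+1) _) (cech_deg_d yi) dyK (cech_dd y).
  exact: ltnSn.
pose pr j (x : 'rV[R]_k) : R^o := x 0 j.
have prD j : {morph pr j : x y / x + y} by move=> x y'; rewrite /pr mxE.
have prZ j r x : pr j (r *: x) = r *: pr j x by rewrite /pr mxE.
exists (fun j => cech_fun f (pr j) (y - v)); split=> [j|j|].
- by apply: cech_fun_deg => //; apply: cech_degB.
- by rewrite cech_fun_d // cech_dB vE subrr cech_fun0.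
have -> : z = cech_fun f psi (y - v).
  by rewrite cech_funB // ye; have /(cech_fun_ker psif) -> := vK; rewrite subr0.
apply/ffunP=> I; rewrite ffunE cech_sumE; move: (y - v) => u.
under eq_bigr => j _ do rewrite !ffunE.
elim/fracW: (u I) => x m.
rewrite loc_funE; last exact: (semilin_prod psif).
have pm j : loc_fun (cech_prod f I) (pr j) (frac (cech_prod f I) x m) = frac (cech_prod f I) (pr j x) m.
  by rewrite loc_funE.
under eq_bigr => j _ do rewrite pm fracZ.
rewrite /psi /lincomb.
elim/big_ind2: _ => [|x1 x2 y1 y2 <- <-|j _] //; rewrite ?frac0 ?fracDm //.
by congr (frac _ _ _); rewrite /GRing.scale /= mulrC.
Qed.

End Free.

(** * Torsion and regular sequences *)

Section Radical.
Variables (R : comNzRingType) (J : {pred R}).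
Hypothesis hJ : ideal J.

Definition inrad (x : R) : Prop := exists N, x ^+ N \in J.

Lemma idealD x y : x \in J -> y \in J -> x + y \in J.
Proof. exact: (subD hJ). Qed.
Lemma idealM r x : x \in J -> r * x \in J.
Proof. exact: (subZ hJ r). Qed.
Lemma idealMr r x : x \in J -> x * r \in J.
Proof. by rewrite mulrC; apply: idealM. Qed.
Lemma ideal0 : 0 \in J. Proof. exact: (sub0 hJ). Qed.
Lemma idealN x : x \in J -> - x \in J.
Proof. exact: (subN hJ). Qed.
Lemma idealB x y : x \in J -> y \in J -> x - y \in J.
Proof. exact: (subB hJ). Qed.
Lemma ideal_sum T (r : seq T) (P : pred T) (F : T -> R) :
  (forall i, P i -> F i \in J) -> \sum_(i <- r | P i) F i \in J.
Proof. exact: (sub_sum hJ). Qed.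

Lemma ideal_expW x m n : (m <= n)%N -> x ^+ m \in J -> x ^+ n \in J.
Proof. by move=> /subnK <-; rewrite exprD => /idealM; apply. Qed.

Lemma inrad0 : inrad 0. Proof. by exists 1%N; rewrite expr1 ideal0. Qed.

Lemma inradM r x : inrad x -> inrad (r * x).
Proof. by case=> N xN; exists N; rewrite exprMn idealM. Qed.

Lemma inradD x y : inrad x -> inrad y -> inrad (x + y).
Proof.
move=> [m xm] [n yn]; exists (m + n)%N; rewrite exprDn ideal_sum // => i _.
rewrite -mulr_natl; apply: idealM; case: (leqP n i) => ni.
  by apply: idealM; apply: ideal_expW yn.
apply: idealMr; apply: ideal_expW xm; lia.
Qed.

Lemma inradN x : inrad x -> inrad (- x).
Proof. by rewrite -mulN1r; apply: inradM. Qed.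

Lemma inradB x y : inrad x -> inrad y -> inrad (x - y).
Proof. by move=> xr /inradN; apply: inradD. Qed.

Lemma inrad_sum T (r : seq T) (P : pred T) (F : T -> R) :
  (forall i, P i -> inrad (F i)) -> inrad (\sum_(i <- r | P i) F i).
Proof. by move=> H; apply: (big_ind inrad) => //; [exact: inrad0|exact: inradD]. Qed.

Lemma inrad_in x : x \in J -> inrad x.
Proof. by exists 1%N. Qed.

End Radical.

Section Relative.
Variables (R : comNzRingType) (k : nat) (f : 'I_k -> R) (M : lmodType R).
Implicit Types (L : {pred M}) (I J : {set 'I_k}) (b c z : cech f M).

Section Torsion.
Variables (L : {pred M}) (hL : submod_closed L).

(* Contracting the Cech complex by the [j]-th generator: [f j ^ N z] is the
   coboundary of the cochain [I |-> +/- f j ^ N z (j |: I)], once [N] clears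
   the powers of [f j] in the denominators. *)
Lemma cech_torsion i j z : cech_deg i z -> incech L (cech_d z) ->
  exists N b, cech_degp i b /\ incech L (f j ^+ N *: z - cech_d b).
Proof.
move=> /cech_degP zi dz.
pose N0 := \max_(I : {set 'I_k}) (repr (z I)).2.
pose b0 : cech f M := [ffun I : {set 'I_k} => if (j \in I) || (#|I|.+1 != i) then 0 else
   sgn R I j *: frac (cech_prod f I) (f j ^+ (N0 - (repr (z (j |: I))).2) *: (repr (z (j |: I))).1) (repr (z (j |: I))).2].
have b0i : cech_degp i b0 by move=> I Ii; rewrite ffunE Ii orbT.
have b0j I : j \in I -> b0 I = 0 by move=> jI; rewrite ffunE jI.
have b0E J : j \in J -> loc_map (f j) (cech_prod f J) (b0 (J :\ j)) = sgn R J j *: (f j ^+ N0 *: z J).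
  move=> jJ; rewrite ffunE !inE eqxx /= finset.setD1K //.
  have cJ : #|J :\ j|.+1 = #|J| by rewrite [in RHS](cardsD1 j) jJ.
  rewrite cJ; case: eqP => [_|/eqP/zi-> /=]; last first.
    by rewrite loc_map0 ?scaler0 //; apply: cech_prodD1.
  have zN0 : ((repr (z J)).2 <= N0)%N by rewrite /N0 (bigD1 J) //= leq_maxl.
  rewrite loc_mapZ; last exact: cech_prodD1.
  rewrite loc_mapE; last exact: cech_prodD1.
  rewrite (sgnD1 R _ jJ) ltnn mul1r scalerA -exprD subnKC //.
(* [b0] vanishes on the sets containing [j], so only the term removing [j] survives. *)
have dA I : j \in I -> cech_d b0 I = f j ^+ N0 *: z I.
  move=> jI; rewrite cech_dE (bigD1 j) //= big1 ?addr0 => [|l /andP[lI lj]].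
    by rewrite b0E // scalerA sgn_sqr scale1r.
  rewrite b0j ?loc_map0 ?scaler0 //; last by rewrite !inE eq_sym lj.
  exact: cech_prodD1.
(* Away from [j], inverting [f j] turns the error into a multiple of [cech_d z]; it therefore lies
   in [L] up to a power of [f j]. *)
have dB J : j \in J -> exists e, inloc L (f j ^+ e *: (f j ^+ N0 *: z (J :\ j) - cech_d b0 (J :\ j))).
  move=> jJ; apply: (inloc_map_inv hL (cech_prodD1 f jJ)).
  have hJ := cech_prodD1 f jJ.
  have -> : loc_map (f j) (cech_prod f J) (f j ^+ N0 *: z (J :\ j) - cech_d b0 (J :\ j))
     = (f j ^+ N0 * sgn R J j) *: cech_d z J; last by apply: inlocZ.
  rewrite (loc_map_is_additive hJ) -[- cech_d b0 _]scaleN1r !loc_mapZ //.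
  rewrite (cech_dE _ J) (bigD1 j) //= scalerDr scalerA -mulrA sgn_sqr mulr1; congr (_ + _).
  rewrite cech_dE loc_map_sum // !scaler_sumr; apply: eq_big => [l|l].
    by rewrite !inE andbC.
  rewrite !inE => /andP[lj lJ]; rewrite loc_mapZ //.
  have hl : cech_prod f (J :\ j) = f l * cech_prod f (J :\ j :\ l).
    by apply: cech_prodD1; rewrite !inE lj.
  have hl' : cech_prod f (J :\ l) = f j * cech_prod f (J :\ j :\ l).
    rewrite finset.setDDl finset.setUC -finset.setDDl; apply: cech_prodD1.
    by rewrite !inE eq_sym lj.
  rewrite (loc_map_comp hl hJ (erefl _)).
  have := b0E (J :\ l); rewrite !inE eq_sym lj => /(_ jJ).
  rewrite finset.setDDl finset.setUC -finset.setDDl.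
  move=> /(congr1 (loc_map (f l) (cech_prod f J))).
  rewrite (loc_map_comp hl' (cech_prodD1 f lJ) (erefl _)) mulrC => ->.
  rewrite !loc_mapZ ?(cech_prodD1 f lJ) // !scalerA; congr (_ *: _).
  rewrite (sgnD1 R _ jJ) (sgnD1 R _ lJ); have := lj; rewrite -val_eqE /= neq_ltn.
  by move=> /orP[lt|lt]; rewrite lt ltnNge (ltnW lt) expr0 expr1;
    move: (f j ^+ N0) (sgn R J j) (sgn R J l) => A s t; ring.
have he0 I : exists e, inloc L (f j ^+ e *: (f j ^+ N0 *: z I - cech_d b0 I)).
  have [jI|jI] := boolP (j \in I).
    by exists 0%N; rewrite dA // subrr scaler0; apply: inloc0.
  by have := dB (j |: I); rewrite finset.setU11 finset.setU1K //; apply.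
have [e he] := choice he0.
pose E := \max_(I : {set 'I_k}) e I.
exists (E + N0)%N, (f j ^+ E *: b0); split; first exact: cech_degpZ.
move=> I; rewrite cech_dZ exprD -scalerA -scalerBr.
have eE : (e I <= E)%N by rewrite /E (bigD1 I) //= leq_maxl.
rewrite ffunE -(subnK eE) exprD -scalerA; apply: inlocZ => //.
by have := he I; rewrite !ffunE.
Qed.

(* The annihilator of the class of [z] in [H^i_f(M / L)]. *)
Definition ann_class i z : {pred R} := fun r =>
  `[< exists b, cech_degp i b /\ incech L (r *: z - cech_d b) >].

Lemma ann_class_ideal i z : ideal (ann_class i z).
Proof.
split.
  apply/asboolP; exists 0; split; first exact: cech_degp_0.
  by rewrite scale0r cech_d0 subr0; apply: incech0.
move=> a r r' /asboolP[b [bi bL]] /asboolP[b' [b'i b'L]]; apply/asboolP.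
exists (a *: b + b'); split; first exact: cech_degpZD.
rewrite scalerDl cech_d_linear opprD addrACA -scalerA -scalerBr.
by apply: incechD => //; apply: incechZ.
Qed.

(** By [cech_torsion] the generators lie in the radical of the annihilator, which is an ideal. *)
Lemma comb_torsion i z g (c : 'I_k -> R) : cech_deg i z -> incech L (cech_d z) ->
  g = \sum_j c j * f j -> inrad (ann_class i z) g.
Proof.
move=> zi dz ->; have hA := ann_class_ideal i z.
apply: inrad_sum => // j _; apply: inradM => //.
by have [N [b H]] := cech_torsion j zi dz; exists N; apply/asboolP; exists b.
Qed.

End Torsion.

(** The submodule [L + r M]: successive quotients by a sequence keep the form [M / L]. *)
Definition addmul L r : {pred M} := fun x => `[< exists l y, l \in L /\ x = l + r *: y >].

Lemma addmul_submod L r : submod_closed L -> submod_closed (addmul L r).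
Proof.
move=> hL; split; first by apply/asboolP; exists 0, 0; rewrite scaler0 addr0; split=> //; apply: sub0.
move=> a x x' /asboolP[l [y [Ll ->]]] /asboolP[l' [y' [Ll' ->]]]; apply/asboolP.
exists (a *: l + l'), (a *: y + y'); split; first by apply: subD => //; apply: subZ.
by rewrite !scalerDr addrACA !scalerA mulrC.
Qed.

Lemma addmulL L r : {subset L <= addmul L r}.
Proof. by move=> l Ll; apply/asboolP; exists l, 0; rewrite scaler0 addr0. Qed.

Lemma incechS L L' c : {subset L <= L'} -> incech L c -> incech L' c.
Proof. by move=> LL' H I; have [x [m [/LL' Lx ->]]] := H I; exists x, m. Qed.

Lemma incech_addmul i L r c : submod_closed L -> cech_deg i c -> incech (addmul L r) c ->
  exists w y, [/\ cech_deg i w, incech L w, cech_deg i y & c = w + r *: y].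
Proof.
move=> hL /cech_degP ci H.
have H' I : exists p : loc M (cech_prod f I) * loc M (cech_prod f I),
   [/\ inloc L p.1, c I = p.1 + r *: p.2 & #|I| != i -> p = (0, 0)].
  have [Ii|Ii] := eqVneq #|I| i; last first.
    by exists (0, 0); rewrite ci // scaler0 addr0; split=> //; apply: inloc0.
  have [x [m [/asboolP[l [y [Ll ->]]] ->]]] := H I.
  exists (frac _ l m, frac _ y m) => /=; rewrite fracZ fracDm; split=> //.
  by exists l, m.
exists [ffun I : {set 'I_k} => (sval (cid (H' I))).1], [ffun I : {set 'I_k} => (sval (cid (H' I))).2].
split.
- by apply/cech_degP=> I Ii; rewrite ffunE; case: (cid _) => p /= [_ _ /(_ Ii) ->].
- by move=> I; rewrite ffunE; case: (cid _) => p /= [].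
- by apply/cech_degP=> I Ii; rewrite ffunE; case: (cid _) => p /= [_ _ /(_ Ii) ->].
- by apply/ffunP=> I; rewrite !ffunE; case: (cid _) => p /= [].
Qed.

(** [r] is a nonzerodivisor on [M / L]; the quotient [M / (L + r M)] may be zero. *)
Definition regular_mod L r := forall x, r *: x \in L -> x \in L.

Lemma incech_regular L r c : submod_closed L -> regular_mod L r ->
  incech L (r *: c) -> incech L c.
Proof.
move=> hL hr H I; move: (H I); rewrite ffunE; elim/fracW: (c I) => x m.
rewrite fracZ => /(inloc_frac hL)[e]; rewrite scalerA mulrC -scalerA => /hr Lx.
by apply/(inloc_frac hL); exists e.
Qed.

Lemma incech_scale_addmul L r c : submod_closed L -> incech (addmul L r) (r *: c).
Proof.
move=> hL I; rewrite ffunE; elim/fracW: (c I) => x m; rewrite fracZ.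
exists (r *: x), m; split=> //; apply/asboolP; exists 0, x; rewrite add0r.
by split=> //; apply: sub0.
Qed.

(** In the long exact sequence of multiplication by [r] on [M / L], the group [H^i(M / (L + r M))]
    sits between [H^i(M / L)] and [H^(i+1)(M / L)]. *)
Lemma rvan_addmul i L r : submod_closed L -> regular_mod L r ->
  rvan f i L -> rvan f i.+1 L -> rvan f i (addmul L r).
Proof.
move=> hL hr H H1 z zi dz; have hLr := addmul_submod r hL.
have [w [y [wi Lw yi dzE]]] := incech_addmul hL (cech_deg_d zi) dz.
have dy : incech L (cech_d y).
  apply: (incech_regular hL hr); rewrite -cech_dZ.
  have -> : r *: y = cech_d z - w by rewrite dzE addrC addKr.
  rewrite cech_dB cech_dd sub0r; apply: incechN => //; exact: incech_d.
have [b [/cech_degpS bi Lb]] := H1 y yi dy.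
have [||c [ci Lc]] := H (z - r *: b).
- by apply: cech_degB => //; apply: cech_degZ.
- rewrite cech_dB cech_dZ dzE -addrA -scalerBr.
  by apply: incechD => //; apply: incechZ.
exists c; split=> //.
have -> : z - cech_d c = (z - r *: b - cech_d c) + r *: b by rewrite addrAC subrK.
apply: incechD => //; first by apply: incechS Lc; apply: addmulL.
exact: incech_scale_addmul.
Qed.

(** Injectivity of [r] on [H^(i+1)(M / L)]: its kernel is the image of [H^i(M / (L + r M))]. *)
Lemma regular_class i L r z b : submod_closed L -> regular_mod L r ->
  rvan f i (addmul L r) -> cech_deg i.+1 z -> incech L (cech_d z) ->
  cech_deg i b -> incech L (r *: z - cech_d b) ->
  exists b', cech_deg i b' /\ incech L (z - cech_d b').
Proof.
move=> hL hr H zi dz bi Lb; have hLr := addmul_submod r hL.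
have [|c [ci Lc]] := H b bi.
  have -> : cech_d b = r *: z - (r *: z - cech_d b) by rewrite opprB addrC subrK.
  apply: incechB => //; first exact: incech_scale_addmul.
  by apply: incechS Lb; apply: addmulL.
have [|w [y [wi Lw yi bE]]] := incech_addmul (i := i) hL _ Lc.
  by apply: cech_degB => //; apply: cech_degp_d.
exists y; split=> //; apply: (incech_regular hL hr).
have -> : r *: (z - cech_d y) = (r *: z - cech_d b) + cech_d w.
  rewrite scalerBr -cech_dZ.
  have -> : r *: y = b - cech_d c - w by rewrite bE addrC addKr.
  by rewrite !cech_dB cech_dd subr0 opprB addrA addrAC.
by apply: incechD => //; apply: incech_d.
Qed.

Fixpoint regular_seq L (rs : seq R) : Prop :=
  if rs is r :: rs' then regular_mod L r /\ regular_seq (addmul L r) rs' else True.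

Definition adjoin L rs : {pred M} := foldl addmul L rs.

Lemma adjoin_submod L rs : submod_closed L -> submod_closed (adjoin L rs).
Proof. by elim: rs L => //= r rs IH L hL; apply/IH/addmul_submod. Qed.

Definition in_comb (r : R) : Prop := exists c : 'I_k -> R, r = \sum_j c j * f j.

(** By induction the first element [r] acts injectively on cohomology, while every class is killed
    by a power of [r] because [r] lies in the ideal of the [f j]. *)
Lemma regular_seq_rvan L rs : submod_closed L -> regular_seq L rs ->
  (forall r, r \in rs -> in_comb r) -> forall i, (i < size rs)%N -> rvan f i L.
Proof.
elim: rs L => //= r rs IH L hL [hr hrs] rsf i.
have hLr := addmul_submod r hL.
have {}IH : forall i, (i < size rs)%N -> rvan f i (addmul L r).
  by apply: IH => // s srs; apply: rsf; rewrite inE srs orbT.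
have [c rE] : in_comb r by apply: rsf; rewrite inE eqxx.
case: i => [_ z zi dz|i ir z zi dz].
  have [N /asboolP[b [/cech_degp0 -> ]]] := comb_torsion hL zi dz rE.
  rewrite cech_d0 subr0 => H; exists 0; rewrite cech_d0 subr0; split; first exact: cech_degp_0.
  by elim: N H => [|N IHN]; rewrite ?scale1r // exprS -scalerA => /(incech_regular hL hr).
have [N /asboolP[b [/cech_degpS bi Lb]]] := comb_torsion hL zi dz rE.
suff [b' [b'i Lb']] : exists b', cech_deg i b' /\ incech L (z - cech_d b').
  by exists b'; split=> //; apply/cech_degpS.
elim: N b bi Lb => [|N IHN] b bi Lb; first by exists b; rewrite scale1r in Lb.
have [||||b' [b'i Lb']] := @regular_class i L r (r ^+ N *: z) b hL hr (IH i ir).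
- exact: cech_degZ.
- by rewrite cech_dZ; apply: incechZ.
- exact: bi.
- by rewrite scalerA -exprS.
exact: IHN Lb'.
Qed.

(** Each quotient by a regular element costs one degree of vanishing. *)
Lemma adjoin_rvan L rs : submod_closed L -> regular_seq L rs ->
  forall m, (forall i, (i <= size rs + m)%N -> rvan f i L) ->
  forall i, (i <= m)%N -> rvan f i (adjoin L rs).
Proof.
elim: rs L => [|r rs IH] L hL; first by move=> _ m H; apply: H.
move=> [hr hrs] m H; apply: IH => //; first exact: addmul_submod.
by move=> i im; apply: rvan_addmul => //; apply: H => /=; lia.
Qed.

(** Placed at the empty set, where nothing is inverted, such an [x] is a cocycle modulo [L]; in
    degree 0 only 0 is a coboundary. *)
Lemma rvan0_torsion L x : submod_closed L -> rvan f 0 L ->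
  (forall j, exists N, f j ^+ N *: x \in L) -> x \in L.
Proof.
move=> hL H Hx.
pose c : cech f M := [ffun I : {set 'I_k} => if I == finset.set0 then frac (cech_prod f I) x 0 else 0].
have ci : cech_deg 0 c.
  by apply/cech_degP=> I; rewrite cards_eq0 ffunE => /negbTE ->.
have dc : incech L (cech_d c).
  move=> I; rewrite cech_dE; apply: inloc_sum => // j jI; apply: inlocZ => //.
  have hI := cech_prodD1 f jI.
  rewrite ffunE; case: eqP => I0; last by rewrite loc_map0 //; apply: inloc0.
  rewrite loc_mapE //; apply/(inloc_frac hL); rewrite scale1r.
  by rewrite hI I0 /cech_prod big_set0 mulr1.
have [b [/cech_degp0 ->]] := H c ci dc; rewrite cech_d0 subr0 => /(_ finset.set0).
rewrite ffunE eqxx => /(inloc_frac hL)[e].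
by rewrite /cech_prod big_set0 expr1n scale1r.
Qed.

End Relative.

(** * Annihilators and Hasse-Schmidt derivations *)

Section Annihilator.
Variables (R : comNzRingType) (k : nat) (f : 'I_k -> R) (M : lmodType R).

(* The annihilator of [H^i_f(M)]. *)
Definition hann (i : nat) : {pred R} := fun r =>
  `[< forall z : cech f M, cech_deg i z -> cech_d z = 0 ->
      exists b : cech f M, cech_degp i b /\ r *: z = cech_d b >].

Lemma hann_ideal i : ideal (hann i).
Proof.
split; first by apply/asboolP=> z _ _; exists 0; rewrite scale0r cech_d0; split=> //; exact: cech_degp_0.
move=> a r r' /asboolP H /asboolP H'; apply/asboolP=> z zi dz.
have [b [bi bE]] := H z zi dz; have [b' [b'i b'E]] := H' z zi dz.
exists (a *: b + b'); split; first exact: cech_degpZD.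
by rewrite cech_d_linear -bE -b'E scalerDl scalerA.
Qed.

Lemma hann1 i : 1 \in hann i -> hvan f M i.
Proof. by move=> /asboolP H z zi dz; have := H z zi dz; rewrite scale1r. Qed.

Lemma hann_local_cohomology i r :
  (forall x : local_cohomology f M i, r *: x = 0) -> r \in hann i.
Proof.
move=> H; apply/asboolP=> z zi dz.
have cz : z \in cocycles (f := f) (M := M) i.
  by rewrite unfold_in; apply/andP; split=> //; apply/eqP.
have := H (lquot_pi _ (Cocycle cz)).
rewrite [_ *: _]lquot_scaleE => /lquot_pi_eq0/asboolP[b bi].
by exists b.
Qed.

End Annihilator.

(** On a simple quotient [h] acts by zero or invertibly, so [h] or some [1 - h * a] kills it;
    products of such factors keep the shape [h ^+ q * (1 - h * r)]. *)
Lemma finite_length_ann (R : comNzRingType) (M : lmodType R) (h : R) :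
  finite_length M -> exists q r, forall x : M, (h ^+ q * (1 - h * r)) *: x = 0.
Proof.
move=> [l [N [Nsub N0 Nl Ncov]]].
suff H j : (j <= l)%N -> exists q r, forall x, x \in N j -> (h ^+ q * (1 - h * r)) *: x = 0.
  by have [q [r Hr]] := H l (leqnn l); exists q, r => x; apply: Hr; rewrite Nl.
elim: j => [_|j IH jl].
  by exists 0%N, 0 => x; rewrite N0 => /eqP->; rewrite scaler0.
have [q [r Hr]] := IH (ltnW jl); have [NN notNN Nmax] := Ncov j jl.
have hN := Nsub j (ltnW jl); have hN1 := Nsub j.+1 jl.
pose L : {pred M} := fun x => `[< exists u v, [/\ u \in N j, v \in N j.+1 & x = u + h *: v] >].
have hL : submod_closed L.
  split; first by apply/asboolP; exists 0, 0; rewrite scaler0 addr0; split=> //; apply: sub0.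
  move=> a x y /asboolP[u [v [Hu Hv ->]]] /asboolP[u' [v' [Hu' Hv' ->]]]; apply/asboolP.
  exists (a *: u + u'), (a *: v + v'); split; try by apply: subD => //; apply: subZ.
  by rewrite !scalerDr addrACA !scalerA mulrC.
have NL : {subset N j <= L}.
  by move=> x xN; apply/asboolP; exists x, 0; rewrite scaler0 addr0; split=> //; apply: sub0.
have LN : {subset L <= N j.+1}.
  by move=> x /asboolP[u [v [/NN Hu Hv ->]]]; apply: subD => //; apply: subZ.
have [LE|LE] := Nmax L hL NL LN.
  exists q.+1, r => x xN; rewrite exprSr -mulrA [h * _]mulrC mulrA -scalerA; apply: Hr.
  rewrite -LE; apply/asboolP; exists 0, x; rewrite add0r; split=> //; exact: sub0.
(* Here [h] is surjective modulo [N j]. A single [x] outside [N j] generates [N j.+1] over it,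
   whence [x = h a x] modulo [N j] for some [a]. *)
have [x xN xnN] : exists2 x, x \in N j.+1 & x \notin N j.
  case: (EM (exists2 x, x \in N j.+1 & x \notin N j)) => // E; case: notNN => x xN.
  by apply/negPn/negP=> xnN; apply: E; exists x.
pose L2 : {pred M} := fun y => `[< exists u a, u \in N j /\ y = u + a *: x >].
have hL2 : submod_closed L2.
  split; first by apply/asboolP; exists 0, 0; rewrite scale0r addr0; split=> //; apply: sub0.
  move=> a y y' /asboolP[u [b [Hu ->]]] /asboolP[u' [b' [Hu' ->]]]; apply/asboolP.
  exists (a *: u + u'), (a * b + b'); split; first by apply: subD => //; apply: subZ.
  by rewrite scalerDr scalerDl addrACA scalerA.
have NL2 : {subset N j <= L2}.
  by move=> y yN; apply/asboolP; exists y, 0; rewrite scale0r addr0.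
have L2N : {subset L2 <= N j.+1}.
  by move=> y /asboolP[u [a [/NN Hu ->]]]; apply: subD => //; apply: subZ.
have [L2E|L2E] := Nmax L2 hL2 NL2 L2N.
  case/negP: xnN; rewrite -L2E; apply/asboolP; exists 0, 1; rewrite add0r scale1r.
  by split=> //; apply: sub0.
have /asboolP[u [v [Hu Hv xE]]] : x \in L by rewrite LE.
have /asboolP[u' [a [Hu' vE]]] : v \in L2 by rewrite L2E.
have xa : (1 - h * a) *: x \in N j.
  have -> : (1 - h * a) *: x = u + h *: u'.
    rewrite scalerBl scale1r {1}xE vE scalerDr scalerA -addrA -addrA; congr (_ + _).
    by rewrite subrr addr0.
  by apply: subD => //; apply: subZ.
exists q, (r + a - h * r * a) => y yN.
have -> : 1 - h * (r + a - h * r * a) = (1 - h * r) * (1 - h * a) by ring.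
rewrite mulrA -scalerA; apply: Hr.
have /asboolP[w [b [Hw ->]]] : y \in L2 by rewrite L2E.
rewrite scalerDr; apply: subD => //; first exact: subZ.
by rewrite scalerA mulrC -scalerA; apply: subZ.
Qed.

Section HasseSchmidt.
Variables (A : comNzRingType) (tau : {rmorphism A -> {poly A}}) (K : nat).
Hypothesis tau0 : forall a, (tau a)`_0 = a.

(** Congruence modulo [t ^ (K + 1)]: the inverse of [tau g] over [A_g] is a power series, of which
    polynomials only hold truncations. *)
Definition eqt (p q : {poly A}) := forall i, (i <= K)%N -> p`_i = q`_i.

Lemma eqt_trans p q r : eqt p q -> eqt q r -> eqt p r.
Proof. by move=> pq qr i iK; rewrite pq ?qr. Qed.

Lemma eqtM p p' q q' : eqt p p' -> eqt q q' -> eqt (p * q) (p' * q').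
Proof.
move=> pp qq i iK; rewrite !coefM; apply: eq_bigr => j _.
by rewrite pp ?qq //; have := ltn_ord j; lia.
Qed.

Lemma eqtX p q m : eqt p q -> eqt (p ^+ m) (q ^+ m).
Proof. by move=> pq; elim: m => [|m IH]; rewrite ?expr0 // !exprS; apply: eqtM. Qed.

Lemma eqtMl p q r : eqt q r -> eqt (p * q) (p * r).
Proof. exact: eqtM. Qed.

(* An inverse of [tau g] modulo [t ^ (K + 1)], up to a power of [g]. *)
Definition tinv (g : A) : {poly A} :=
  \sum_(i < K.+1) g%:P ^+ (K - i) * (g%:P - tau g) ^+ i.

(** With [a = g] and [b = g - tau g], the geometric sum times [a - b] is
    [a ^ (K + 1) - b ^ (K + 1)], and [t] divides [b]. *)
Lemma tinvP g : eqt (tinv g * tau g) (g ^+ K.+1)%:P.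
Proof.
have -> : tinv g * tau g = (g ^+ K.+1)%:P - (g%:P - tau g) ^+ K.+1.
  rewrite polyC_exp subrXX subKr mulrC; congr (_ * _).
have -> : g%:P - tau g = 'X * (drop_poly 1 (g%:P - tau g)).
  rewrite -[LHS](poly_take_drop 1) expr1 mulrC -[RHS]add0r; congr (_ + _).
  by apply/polyP=> i; rewrite coef_take_poly coef0; case: i => //=; rewrite coefB coefC tau0 subrr.
by move=> i iK; rewrite exprMn coefB coefXnM ltnS iK subr0.
Qed.

(** The coefficient of [t ^ i] in [tau x / tau g ^ m], with [tinv g / g ^ (K + 1)] in place of
    [1 / tau g]: the extension of the derivation to [A_g]. *)
Definition hsloc (g : A) (i : nat) (u : loc A^o g) : loc A^o g :=
  frac g ((tinv g ^+ (repr u).2 * tau ((repr u).1 : A^o))`_i : A^o) (K.+1 * (repr u).2).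

Lemma hslocE g i (x : A^o) m : (i <= K)%N ->
  hsloc i (frac g x m) = frac g ((tinv g ^+ m * tau x)`_i : A^o) (K.+1 * m).
Proof.
move=> iK; rewrite /hsloc; case E: (repr (frac g x m)) => [y n] /=.
have /fracP[l /= e] : frac g (y : A^o) n = frac g x m by rewrite -(fracK (frac g x m)) E.
apply/fracP; exists (K.+1 * l)%N; rewrite -!mulnDr !exprM /GRing.scale /= -!coefCM.
move: e; rewrite /GRing.scale /= => /(congr1 tau); rewrite !rmorphM !rmorphXn /= => e.
have H a b c (z : A) : eqt (g%:P ^+ K.+1 ^+ (a + b) * (tinv g ^+ c * tau z))
    (tinv g ^+ (a + b + c) * (tau g ^+ (a + b) * tau z)).
  have -> : tinv g ^+ (a + b + c) * (tau g ^+ (a + b) * tau z) = (tinv g * tau g) ^+ (a + b) * (tinv g ^+ c * tau z).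
    by rewrite exprMn exprD; ring.
  apply: eqtM => //; rewrite -polyC_exp => j jK; apply/esym.
  by apply: eqtX jK; apply: tinvP.
by rewrite !H // e addnAC.
Qed.

Lemma hslocD g i : (i <= K)%N -> {morph @hsloc g i : u v / u + v}.
Proof.
move=> iK; elim/fracW=> x m; elim/fracW=> y n.
rewrite fracD !hslocE // fracD -mulnDr; apply/fracP; exists 0%N; congr (_ *: _).
rewrite rmorphD /GRing.scale /= !rmorphM !rmorphXn mulrDr coefD !exprM -!coefCM; congr (_ + _).
- have -> : tinv g ^+ (m + n) * (tau g ^+ n * tau x) = (tinv g * tau g) ^+ n * (tinv g ^+ m * tau x).
    by rewrite exprMn exprD; ring.
  by rewrite [in RHS]polyC_exp; apply: eqtM iK => //; apply/eqtX/tinvP.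
- have -> : tinv g ^+ (m + n) * (tau g ^+ m * tau y) = (tinv g * tau g) ^+ m * (tinv g ^+ n * tau y).
    by rewrite exprMn exprD; ring.
  by rewrite [in RHS]polyC_exp; apply: eqtM iK => //; apply/eqtX/tinvP.
Qed.

Lemma hsloc_id g (u : loc A^o g) : hsloc 0 u = u.
Proof.
elim/fracW: u => x m; rewrite hslocE //.
have -> : (tinv g ^+ m * tau x)`_0 = g ^+ (K * m) * x.
  rewrite coef0M tau0; congr (_ * _).
  have -> : (tinv g ^+ m)`_0 = (tinv g)`_0 ^+ m.
    by elim: m => [|m IH]; rewrite ?coef1 // !exprS coef0M IH.
  rewrite exprM; congr (_ ^+ _); rewrite coef_sum big_ord_recl big1 => [|i _].
    by rewrite expr0 mulr1 addr0 subn0 -polyC_exp coefC.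
  by rewrite exprS !coef0M coefB coefC tau0 subrr mul0r mulr0.
by rewrite mulSn addnC; apply: (fracMK g (K * m) x m).
Qed.

Lemma hslocZ g i r (u : loc A^o g) : (i <= K)%N ->
  hsloc i (r *: u) = \sum_(j < i.+1) (tau r)`_j *: hsloc (i - j) u.
Proof.
elim/fracW: u => x m iK; rewrite fracZ hslocE //.
rewrite /GRing.scale /= rmorphM mulrCA coefM.
have H (j : 'I_i.+1) : (tau r)`_j *: hsloc (i - j) (frac g x m) =
   frac g ((tau r)`_j *: ((tinv g ^+ m * tau x)`_(i - j) : A^o)) (K.+1 * m).
  by rewrite hslocE ?fracZ //; lia.
rewrite (eq_bigr _ (fun j _ => H j)).
by elim/big_ind2: _ => [|x1 x2 y1 y2 <- <-|] //; rewrite ?frac0 ?fracDm.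
Qed.

Lemma hsloc_map g' g h i (u : loc A^o g) : (i <= K)%N -> h = g' * g ->
  hsloc i (loc_map g' h u) = loc_map g' h (hsloc i u).
Proof.
elim/fracW: u => x m iK hE; rewrite [in LHS]loc_mapE // [in LHS]hslocE // [in RHS]hslocE // loc_mapE //.
apply/fracP; exists 0%N; rewrite !add0n /GRing.scale /= !exprM -!coefCM.
rewrite (rmorphM tau) (rmorphXn tau) /=; move: i iK.
have := tinvP h; have := tinvP g; set th := tinv h; set tg := tinv g => Hg Hh.
apply: (@eqt_trans _ ((th * tau h) ^+ m * (th ^+ m * (tau g' ^+ m * tau x)))).
  apply: eqtM => //; rewrite polyC_exp => j jK; apply/esym; by apply: eqtX jK.
have -> : (th * tau h) ^+ m * (th ^+ m * (tau g' ^+ m * tau x)) = th ^+ m * tau g' ^+ m * ((th * tau h) ^+ m * tau x).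
  by ring.
apply: (@eqt_trans _ (th ^+ m * tau g' ^+ m * ((h ^+ K.+1)%:P ^+ m * tau x))).
  by apply: eqtMl; apply: eqtM => //; apply: eqtX.
apply: (@eqt_trans _ ((th * tau h) ^+ m * ((g' ^+ K.+1)%:P ^+ m * (tg ^+ m * tau x)))); last first.
  rewrite [(h ^+ _ ^+ _)%:P]polyC_exp [(g' ^+ _ ^+ _)%:P]polyC_exp.
  by apply: eqtM => //; apply: eqtX.
have -> : (th * tau h) ^+ m * ((g' ^+ K.+1)%:P ^+ m * (tg ^+ m * tau x))
   = th ^+ m * tau g' ^+ m * ((g' ^+ K.+1)%:P ^+ m * ((tg * tau g) ^+ m * tau x)).
  rewrite hE (rmorphM tau) /= !exprMn.
  move: (th ^+ m) (tg ^+ m) (tau g' ^+ m) (tau g ^+ m) ((_)%:P ^+ m) (tau x) => *; ring.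
apply: eqtMl.
have -> : (h ^+ K.+1)%:P ^+ m * tau x = (g' ^+ K.+1)%:P ^+ m * ((g ^+ K.+1)%:P ^+ m * tau x).
  by rewrite hE exprMn polyCM exprMn mulrA.
apply: eqtMl; apply: eqtM => //; rewrite -polyC_exp polyC_exp => j jK; apply/esym; by apply: eqtX jK.
Qed.

Variables (k : nat) (f : 'I_k -> A).

Definition hscech i (c : cech f A^o) : cech f A^o :=
  [ffun I : {set 'I_k} => hsloc i (c I)].

Lemma hsloc0 g i : (i <= K)%N -> hsloc i (0 : loc A^o g) = 0.
Proof.
by move=> iK; apply: (@addrI _ (hsloc i (0 : loc A^o g))); rewrite -hslocD // !addr0.
Qed.

Lemma hslocN g i (u : loc A^o g) : (i <= K)%N -> hsloc i (- u) = - hsloc i u.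
Proof. by move=> iK; apply/eqP; rewrite -addr_eq0 -hslocD // addNr hsloc0. Qed.

Lemma hscech_d i c : (i <= K)%N -> cech_d (hscech i c) = hscech i (cech_d c).
Proof.
move=> iK; apply/ffunP=> I; rewrite [RHS]ffunE !cech_dE.
rewrite (big_morph _ (hslocD iK) (hsloc0 _ iK)); apply: eq_bigr => j jI.
rewrite ffunE -hsloc_map //; last exact: cech_prodD1.
rewrite /sgn -signr_odd; case: odd; first by rewrite expr1 !scaleN1r hslocN.
by rewrite expr0 !scale1r.
Qed.

Lemma hscechZ i r c : (i <= K)%N ->
  hscech i (r *: c) = \sum_(j < i.+1) (tau r)`_j *: hscech (i - j) c.
Proof.
move=> iK; apply/ffunP=> I; rewrite !ffunE hslocZ // cech_sumE.
by apply: eq_bigr => j _; rewrite !ffunE.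
Qed.

Lemma hscech_deg i d c : (i <= K)%N -> cech_deg d c -> cech_deg d (hscech i c).
Proof. by move=> iK /cech_degP H; apply/cech_degP=> I Id; rewrite ffunE H // hsloc0. Qed.

Lemma hscech_degp i d c : (i <= K)%N -> cech_degp d c -> cech_degp d (hscech i c).
Proof. by move=> iK H I Id; rewrite ffunE H // hsloc0. Qed.

Lemma hscech_id c : hscech 0 c = c.
Proof. by apply/ffunP=> I; rewrite ffunE hsloc_id. Qed.

(** Leibniz rule and induction on [i]: the [i]-th derivative of the coboundary [r *: z] is a
    coboundary, and so are its terms where [z] is differentiated, since derivatives of cocycles are
    cocycles. The term where [r] takes all [i] derivatives remains. *)
Lemma hann_hs_le d r : r \in hann f A^o d -> forall i, (i <= K)%N -> (tau r)`_i \in hann f A^o d.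
Proof.
move=> rd; elim/ltn_ind => i IH iK; apply/asboolP=> z zd dz.
have /asboolP H := rd; have [b [bd bE]] := H z zd dz.
have := hscechZ r z iK; rewrite bE -hscech_d // big_ord_recr /= subnn hscech_id.
have [w [wd wE]] : exists w : cech f A^o, cech_degp d w /\
    \sum_(j < i) (tau r)`_j *: hscech (i - j) z = cech_d w.
  have H' (j : 'I_i) : exists w : cech f A^o, cech_degp d w /\ (tau r)`_j *: hscech (i - j) z = cech_d w.
    have /asboolP := IH j (ltn_ord j) (leq_trans (ltnW (ltn_ord j)) iK).
    have ij : (i - j <= K)%N by lia.
    by apply; [apply: hscech_deg | rewrite hscech_d // dz; apply/ffunP=> I; rewrite !ffunE hsloc0].
  have [w /all_and2[wd wE]] := choice H'.
  exists (\sum_j w j); rewrite cech_d_sum; split; last by apply: eq_bigr.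
  by apply: (big_ind (fun w : cech f A^o => cech_degp d w)) => //; [exact: cech_degp_0|exact: cech_degpD].
rewrite wE => E; exists (hscech i b - w); split.
  by apply: cech_degpD; [exact: hscech_degp|exact: cech_degpN].
by rewrite cech_dB E [RHS]addrC addKr.
Qed.

End HasseSchmidt.

Lemma hann_hs (A : comNzRingType) (tau : {rmorphism A -> {poly A}}) k (f : 'I_k -> A) d r :
  (forall a, (tau a)`_0 = a) -> r \in hann f A^o d -> forall i, (tau r)`_i \in hann f A^o d.
Proof. by move=> tau0 rd i; exact: (hann_hs_le tau0 rd (leqnn i)). Qed.

Lemma mpoly_rmorph_ext (F : fieldType) n (S : nzRingType) (phi psi : {rmorphism {mpoly F[n]} -> S}) :
  (forall c, phi c%:MP = psi c%:MP) -> (forall i, phi 'X_i = psi 'X_i) -> phi =1 psi.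
Proof.
move=> HC HX p; rewrite (mpolyE p) !rmorph_sum; apply: eq_bigr => m _.
rewrite -mul_mpolyC !rmorphM HC; congr (_ * _); rewrite mpolyXE_id !rmorph_prod.
by apply: eq_bigr => i _; rewrite !rmorphXn HX.
Qed.

(** A unitriangular system, solved from the top index down without division, hence in every
    characteristic. *)
Lemma binomial_separation (A : comNzRingType) (J : {pred A}) D (x : nat -> A) : ideal J ->
  (forall l, \sum_(d < D) x d *+ 'C(d, l) \in J) -> forall d, (d < D)%N -> x d \in J.
Proof.
move=> hJ H d; move: {2}(D - d)%N (leqnn (D - d)) => e; elim: e d => [|e IH] d.
  by rewrite leqn0 subn_eq0 ltnNge => ->.
move=> De dD; have := H d; rewrite (bigD1 (Ordinal dD)) //= binn mulr1n.
set y := (X in _ + X); have Jy : y \in J.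
  apply: (ideal_sum hJ) => i; rewrite -val_eqE /= => id; case: (ltngtP i d) => [lt|gt|eq].
  - by rewrite bin_small // mulr0n ideal0.
  - rewrite -mulr_natl; apply: (idealM hJ); apply: IH => //.
    by rewrite leq_subLR; move: De; rewrite leq_subLR; lia.
  - by rewrite eq eqxx in id.
by move=> xy; rewrite -[x d](addrK y); apply: (idealB hJ).
Qed.

(** * Flows on the polynomial ring and descent from a stabilizer *)

Section Action.
Variables (F : fieldType) (gT : finGroupType) (G : {group gT}) (n : nat).
Variable rG : mx_representation F G n.
Local Notation S := {mpoly F[n]}.
Local Notation R := (invariant_ring rG).

HB.instance Definition _ g := GRing.RMorphism.copy (mpoly_act rG g)
  (comp_mpoly [tuple \sum_(j < n) rG (g^-1)%g i j *: 'X_j | i < n]).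

Lemma actC g c : mpoly_act rG g c%:MP = c%:MP.
Proof. exact: comp_mpolyC. Qed.

Lemma actX g i : mpoly_act rG g 'X_i = \sum_(j < n) rG (g^-1)%g i j *: 'X_j.
Proof. by rewrite /mpoly_act comp_mpolyXU -tnth_nth tnth_mktuple. Qed.

Lemma actZ g c p : mpoly_act rG g (c *: p) = c *: mpoly_act rG g p.
Proof. exact: comp_mpolyZ. Qed.

Lemma actM g h p : g \in G -> h \in G ->
  mpoly_act rG (g * h)%g p = mpoly_act rG g (mpoly_act rG h p).
Proof.
move=> gG hG; pose phi : {rmorphism S -> S} := mpoly_act rG g \o mpoly_act rG h.
apply: (mpoly_rmorph_ext (phi := mpoly_act rG (g * h)%g) (psi := phi)) => [c|i] /=.
  by rewrite !actC.
rewrite !actX rmorph_sum /= invMg repr_mxM ?groupV //.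
under [RHS]eq_bigr => j _ do rewrite actZ actX scaler_sumr.
rewrite exchange_big; apply: eq_bigr => j _ /=; rewrite mxE scaler_suml.
by apply: eq_bigr => l _; rewrite scalerA.
Qed.

Lemma act1 p : mpoly_act rG 1%g p = p.
Proof.
apply: (mpoly_rmorph_ext (phi := mpoly_act rG 1%g) (psi := idfun)) => [c|i] /=.
  by rewrite actC.
rewrite actX invg1 repr_mx1 (bigD1 i) //= big1 => [|j ji]; rewrite mxE.
  by rewrite eqxx scale1r addr0.
by rewrite eq_sym (negbTE ji) scale0r.
Qed.

Lemma act_meval g p (v : 'cV[F]_n) :
  (mpoly_act rG g p).@[fun i => v i 0] = p.@[fun i => (rG (g^-1)%g *m v) i 0].
Proof.
rewrite /mpoly_act comp_mpoly_meval; apply: meval_eq => i.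
rewrite tnth_mktuple rmorph_sum /= mxE; apply: eq_bigr => j _.
by rewrite mevalZ mevalXU.
Qed.

Lemma invP (x : S) : reflect (forall g, g \in G -> mpoly_act rG g x = x) (x \in invariants rG).
Proof. by apply: (iffP forall_inP) => H g gG; apply/eqP/H. Qed.

Lemma inv_valP (x : R) g : g \in G -> mpoly_act rG g (inv_val x) = inv_val x.
Proof. by move=> gG; apply/invP: gG; case: x. Qed.

Lemma inv_val_inj : injective (@inv_val F gT G n rG).
Proof. exact: val_inj. Qed.

HB.instance Definition _ := GRing.RMorphism.copy (@inv_val F gT G n rG) (val : R -> S).

Lemma act_mdeg g (m : 'X_{1..n}) : mpoly_act rG g 'X_[m] \is (mdeg m).-homog.
Proof.
rewrite mpolyXE_id rmorph_prod mdegE.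
apply: (big_ind2 (fun p d => p \is d.-homog)) => [|p d q e|i _]; first exact: dhomog1.
  exact: dhomogM.
rewrite rmorphXn /= actX -[X in X.-homog]mul1n; apply: dhomogMn.
by apply: rpred_sum => j _; apply: rpredZ; rewrite dhomogX; apply/eqP; exact: mdeg1.
Qed.

Lemma act_dhomog g d (p : S) : p \is d.-homog -> mpoly_act rG g p \is d.-homog.
Proof.
move=> /dhomogP pd; rewrite (mpolyE p) rmorph_sum big_seq.
apply: rpred_sum => m mp; rewrite /= actZ; apply: rpredZ.
by rewrite -(pd m mp); apply: act_mdeg.
Qed.

Lemma pihomog_sum_ge (p : S) D : (msize p <= D)%N -> p = \sum_(d < D) pihomog mdeg d p.
Proof. exact: pihomog_partitionE. Qed.

Lemma pihomog_sum_dhomog D (q : nat -> S) d : (forall e, q e \is e.-homog) -> (d < D)%N ->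
  pihomog mdeg d (\sum_(e < D) q e) = q d.
Proof.
move=> qh dD; rewrite linear_sum (bigD1 (Ordinal dD)) //= pihomog_dE // big1 ?addr0 // => i.
by rewrite -val_eqE /= => id; apply: pihomog_ne0 (qh i).
Qed.

Lemma act_pihomog g d p :
  mpoly_act rG g (pihomog mdeg d p) = pihomog mdeg d (mpoly_act rG g p).
Proof.
pose D := maxn d.+1 (msize p).
have -> : mpoly_act rG g p = \sum_(e < D) mpoly_act rG g (pihomog mdeg e p).
  by rewrite {1}(@pihomog_sum_ge p D) ?leq_maxr // rmorph_sum.
apply/esym; apply: (@pihomog_sum_dhomog D (fun e => mpoly_act rG g (pihomog mdeg e p))).
  by move=> e; apply: act_dhomog; apply: pihomogP.
by rewrite leq_max ltnSn.
Qed.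

Lemma pihomog_inv d p : p \in invariants rG -> pihomog mdeg d p \in invariants rG.
Proof. by move=> /invP pG; apply/invP => g gG; rewrite act_pihomog pG. Qed.

Definition inv_comp d (x : R) : R := Invariant (pihomog_inv d (valP x)).

Lemma inv_compE d x : inv_val (inv_comp d x) = pihomog mdeg d (inv_val x).
Proof. by []. Qed.

Lemma inv_const_subproof c : c%:MP \in invariants rG.
Proof. by apply/invP => g _; rewrite actC. Qed.
Definition inv_const c : R := Invariant (inv_const_subproof c).

Section Flow.
Variable xi : 'I_n -> S.

(* The polynomial flow [p (x + t xi)] of the vector field [xi]. *)
Definition flow (p : S) : {poly S} :=
  mmap (polyC \o @mpolyC n F) (fun i => ('X_i)%:P + (xi i)%:P * 'X) p.

HB.instance Definition _ := GRing.RMorphism.copy flow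
  (mmap (polyC \o @mpolyC n F) (fun i => ('X_i)%:P + (xi i)%:P * 'X)).

Lemma flowC c : flow c%:MP = c%:MP%:P.
Proof. exact: mmapC. Qed.

Lemma flowX i : flow 'X_i = ('X_i)%:P + (xi i)%:P * 'X.
Proof. by rewrite /flow mmapX mmap1U. Qed.

Lemma flow_coef0 p : (flow p)`_0 = p.
Proof.
pose phi : {rmorphism S -> S} := horner_eval (0 : S) \o flow.
rewrite -horner_coef0; apply: (mpoly_rmorph_ext (phi := phi) (psi := idfun)) => [c|i] /=.
  by rewrite /horner_eval flowC hornerC.
by rewrite /horner_eval flowX hornerD hornerM hornerX mulr0 addr0 hornerC.
Qed.

Hypothesis xi_equivariant : forall g, g \in G -> forall i,
  mpoly_act rG g (xi i) = \sum_(j < n) rG (g^-1)%g i j *: xi j.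

(** Equivariance of the vector field makes its flow commute with the action; coefficients of the
    flow of an invariant are then invariant. *)
Lemma act_flow g p : g \in G ->
  map_poly (mpoly_act rG g) (flow p) = flow (mpoly_act rG g p).
Proof.
move=> gG; pose phi : {rmorphism S -> {poly S}} := map_poly (mpoly_act rG g) \o flow.
pose psi : {rmorphism S -> {poly S}} := flow \o mpoly_act rG g.
apply: (mpoly_rmorph_ext (phi := phi) (psi := psi)) => [c|i] /=.
  by rewrite flowC map_polyC /= actC flowC.
rewrite flowX actX rmorphD rmorphM /= !map_polyC map_polyX /= actX xi_equivariant //.
rewrite !rmorph_sum /= mulr_suml -big_split; apply: eq_bigr => j _ /=.
rewrite -!mul_mpolyC !rmorphM /= flowC flowX mulrDr; congr (_ + _).
by rewrite mulrA.
Qed.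

Lemma flow_inv p i : p \in invariants rG -> (flow p)`_i \in invariants rG.
Proof.
move=> /invP pG; apply/invP => g gG; have := act_flow p gG; rewrite pG //.
by move=> /(congr1 (fun q : {poly S} => q`_i)); rewrite coef_map.
Qed.

Definition inv_flow (x : R) : {poly R} :=
  \poly_(i < size (flow (inv_val x))) Invariant (flow_inv i (valP x)).

Lemma map_inv_flow x : map_poly (@inv_val F gT G n rG) (inv_flow x) = flow (inv_val x).
Proof.
apply/polyP => i; rewrite coef_map coef_poly; case: ltnP => // sz.
by rewrite raddf0 nth_default.
Qed.

Lemma map_inv_val_inj : injective (map_poly (@inv_val F gT G n rG)).
Proof. by apply: map_inj_poly => [x y /val_inj //|]; rewrite rmorph0. Qed.

Lemma inv_flow_is_additive : zmod_morphism inv_flow.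
Proof.
by move=> x y; apply: map_inv_val_inj; rewrite rmorphB /= !map_inv_flow !rmorphB.
Qed.

Lemma inv_flow_is_multiplicative : monoid_morphism inv_flow.
Proof.
split=> [|x y]; apply: map_inv_val_inj; first by rewrite map_inv_flow !rmorph1.
by rewrite rmorphM /= !map_inv_flow !rmorphM.
Qed.

HB.instance Definition _ := GRing.isZmodMorphism.Build R {poly R} inv_flow inv_flow_is_additive.
HB.instance Definition _ := GRing.isMonoidMorphism.Build R {poly R} inv_flow inv_flow_is_multiplicative.

Lemma inv_flow_coef x i : inv_val (inv_flow x)`_i = (flow (inv_val x))`_i.
Proof. by rewrite -map_inv_flow coef_map. Qed.

Lemma hann_flow k (f : 'I_k -> R) d r : r \in hann f R^o d ->
  forall i, (inv_flow r)`_i \in hann f R^o d.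
Proof.
apply: hann_hs => x; apply: inv_val_inj.
by rewrite inv_flow_coef flow_coef0.
Qed.

End Flow.

(** The flow is the dilation by [1 + t]. *)
Lemma flow_euler d p : p \is d.-homog -> flow (fun i => 'X_i) p = p%:P * (1 + 'X) ^+ d.
Proof.
move=> /dhomogP pd; rewrite {1 2}(mpolyE p) !rmorph_sum mulr_suml !big_seq.
apply: eq_bigr => m mp; rewrite -mul_mpolyC !rmorphM /= flowC -mulrA; congr (_ * _).
have <- : mdeg m = d := pd m mp.
rewrite mpolyXE_id !rmorph_prod mdegE -prodrXr -big_split; apply: eq_bigr => i _ /=.
rewrite !rmorphXn /= flowX -exprMn; congr (_ ^+ _).
by rewrite mulrDr mulr1.
Qed.

(** The coefficients of the Euler flow of [x] combine its homogeneous components with binomial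
    weights, which [binomial_separation] inverts. *)
Lemma hann_homog k (f : 'I_k -> R) i x d : x \in hann f R^o i ->
  inv_comp d x \in hann f R^o i.
Proof.
move=> xJ; pose D := msize (inv_val x).
have hJ := hann_ideal f R^o i.
have [dD|Dd] := ltnP d D; last first.
  have -> : inv_comp d x = 0; last exact: ideal0 hJ.
  apply: inv_val_inj; rewrite inv_compE rmorph0 (@pihomog_sum_ge (inv_val x) D) // linear_sum big1 // => j _.
  have jd : nat_of_ord j != d by rewrite neq_ltn (leq_trans (ltn_ord j) Dd).
  exact: (pihomog_ne0 jd (pihomogP _ _ _)).
apply: (binomial_separation (x := fun d => inv_comp d x)) hJ _ _ dD => l.
have equi g : g \in G -> forall i, mpoly_act rG g 'X_i = \sum_(j < n) rG (g^-1)%g i j *: 'X_j.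
  by move=> _ j; apply: actX.
have <- : (inv_flow equi x)`_l = \sum_(d < D) inv_comp d x *+ 'C(d, l); last exact: hann_flow.
apply: inv_val_inj; rewrite inv_flow_coef [in LHS](@pihomog_sum_ge (inv_val x) D) // !rmorph_sum coef_sum.
apply: eq_bigr => e _; rewrite rmorphMn /= (flow_euler (pihomogP _ _ _)).
rewrite coefCM exprDn coef_sum.
rewrite (eq_bigr (fun i : 'I_e.+1 => ((i == l :> nat) * 'C(e, i))%:R)) => [|j _]; last first.
  by rewrite expr1n !mul1r coefMn coefXn eq_sym natrM ?mul1r mulr_natr.
have [le|lt] := ltnP l e.+1.
  rewrite (bigD1 (Ordinal le)) //= eqxx mul1n big1 ?addr0 ?mulr_natr // => j.
  by rewrite -val_eqE /= => /negbTE->.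
rewrite big1 => [|j _]; first by rewrite mulr0 bin_small.
by have := ltn_ord j; case: eqP => // ->; rewrite ltnNge lt.
Qed.

(** In [p (x + t v)] the coefficient of [t ^ d] takes the part [t v] of every factor. *)
Lemma flow_translation d (p : S) (v : 'cV[F]_n) : p \is d.-homog ->
  (flow (fun i => (v i 0)%:MP) p)`_d = (p.@[fun i => v i 0])%:MP.
Proof.
move=> /dhomogP pd; rewrite {1}(mpolyE p) mevalE rmorph_sum coef_sum rmorph_sum !big_seq.
apply: eq_bigr => m mp; rewrite -mul_mpolyC !rmorphM /= flowC coefCM; congr (_ * _).
have <- : mdeg m = d := pd m mp.
rewrite mpolyXE_id !rmorph_prod /= mdegE.
(* Degree at most [e] with coefficient [c] there: a property stable under products. *)
pose Q (a : {poly S}) (e : nat) (c : S) := (size a <= e.+1)%N /\ a`_e = c.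
have QM a e c a' e' c' : Q a e c -> Q a' e' c' -> Q (a * a') (e + e')%N (c * c').
  move=> [sa ae] [sa' ae']; split.
    by apply: leq_trans (size_polyMleq _ _) _; lia.
  have eLt : (e < (e + e').+1)%N by lia.
  rewrite coefM (bigD1 (Ordinal eLt)) //= big1 ?addr0 ?addKn ?ae ?ae' // => j.
  rewrite -val_eqE /= neq_ltn => /orP[lt|lt].
    by rewrite [a'`__]nth_default ?mulr0 // (leq_trans sa') //; lia.
  by rewrite nth_default ?mul0r // (leq_trans sa).
have Q1 : Q 1 0%N 1 by split; rewrite ?size_poly1 ?coef1.
have QX i e : Q (flow (fun i => (v i 0)%:MP) ('X_i ^+ e)) e ((v i 0) ^+ e)%:MP.
  rewrite !rmorphXn /= flowX.
  have Qi : Q (('X_i)%:P + (v i 0)%:MP%:P * 'X) 1%N (v i 0)%:MP.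
    split; first by rewrite addrC size_MXaddC; case: ifP => // _; rewrite ltnS size_polyC leq_b1.
    by rewrite coefD coefC coefCM coefX mulr1 add0r.
  by elim: e => [|e IH]; rewrite ?expr0 // !exprS; apply: (QM _ 1%N _ _ e).
suff [] : Q (\prod_i flow (fun i => (v i 0)%:MP) ('X_i ^+ m i)) (\sum_i m i)%N (\prod_i ((v i 0) ^+ m i)%:MP) by [].
elim: (index_enum _) => [|i r IH]; first by rewrite !big_nil.
by rewrite !big_cons; apply: QM.
Qed.

End Action.

(** * Separation of points by polynomials *)

Section Separation.
Variables (F : fieldType) (n : nat).
Implicit Types (w : 'cV[F]_n) (p : {mpoly F[n]}).

Definition ev w p : F := p.@[fun i => w i 0].

HB.instance Definition _ w := GRing.RMorphism.copy (ev w) (meval (fun i => w i 0)).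

Lemma separate w w' : w != w' -> exists p, ev w p = 0 /\ ev w' p = 1.
Proof.
move=> ww'; have [i wi] : exists i, w i 0 != w' i 0.
  apply/existsP; apply: contraNT ww'; rewrite negb_exists => /forallP H.
  by apply/eqP/matrixP => i j; rewrite ord1; apply/eqP; move: (H i); rewrite negbK.
exists ((w' i 0 - w i 0)^-1 *: ('X_i - (w i 0)%:MP)); rewrite /ev.
rewrite !mevalZ !mevalB !mevalXU !mevalC subrr mulr0 mulVf // subr_eq0 eq_sym.
by [].
Qed.

Lemma separate_family (T : finType) (P : pred T) (w : T -> 'cV[F]_n) w' :
  (forall t, P t -> w t != w') ->
  exists p, (forall t, P t -> ev (w t) p = 0) /\ ev w' p = 1.
Proof.
move=> H; have H' t : exists p, P t -> ev (w t) p = 0 /\ ev w' p = 1.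
  by case: (boolP (P t)) => [/H/separate[p Hp]|_]; [exists p | exists 0].
have [p Hp] := choice H'; exists (\prod_(t | P t) p t); split=> [t Pt|].
  by rewrite rmorph_prod (bigD1 t) //= (Hp t Pt).1 mul0r.
by rewrite rmorph_prod big1 // => t Pt; exact: (Hp t Pt).2.
Qed.

Lemma ev0_homog d p : (0 < d)%N -> p \is d.-homog -> ev 0 p = 0.
Proof.
move=> d0 /dhomogP pd; rewrite /ev mevalE big_seq big1 // => m mp.
have [i mi] : exists i, m i != 0%N.
  apply/existsP; rewrite -negb_forall; apply/negP => /forallP m0.
  have : mdeg m = d := pd m mp; rewrite mdegE big1 => [d0'|i _]; first by rewrite -d0' in d0.
  exact/eqP/m0.
by rewrite (bigD1 i) //= mxE expr0n (negbTE mi) mul0r mulr0.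
Qed.

Lemma ev_homog0 w w' p : p \is 0.-homog -> ev w p = ev w' p.
Proof.
move=> /dhomogP pd; suff -> : p = (p@_0%MM)%:MP by rewrite /ev !mevalC.
apply: msize1_polyC; rewrite msizeE; apply/bigmax_leqP_seq => m mp _.
by have -> : mdeg m = 0%N := pd m mp.
Qed.

End Separation.

(** * Transfer from the stabilizer of a vector *)

Section Transfer.
Variables (F : fieldType) (gT : finGroupType) (G H : {group gT}) (n : nat).
Variables (rG : mx_representation F G n) (sHG : H \subset G) (v : 'cV[F]_n).
Hypothesis v_neq0 : v != 0.
Hypothesis stabv : forall g, g \in G -> (g \in H) = (rG g *m v == v).
Hypothesis indexF : (#|G : H|%g)%:R != 0 :> F.

Local Notation S := {mpoly F[n]}.
Local Notation rH := (subg_repr rG sHG).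
Local Notation R := (invariant_ring rG).
Local Notation T := (invariant_ring rH).
Local Notation act := (mpoly_act rG).
Local Notation grepr := fingroup.repr.

Lemma act_sub g p : mpoly_act rH g p = act g p. Proof. by []. Qed.

Lemma inv_sub p : p \in invariants rG -> p \in invariants rH.
Proof. by move=> /invP pG; apply/invP=> g gH; rewrite act_sub pG // (fintype.subsetP sHG). Qed.

Definition iota (x : R) : T := Invariant (inv_sub (valP x)).

Lemma iota_is_additive : zmod_morphism iota.
Proof. by move=> x y; apply: inv_val_inj. Qed.
Lemma iota_is_multiplicative : monoid_morphism iota.
Proof. by split=> [|x y]; apply: inv_val_inj. Qed.
HB.instance Definition _ := GRing.isZmodMorphism.Build R T iota iota_is_additive.
HB.instance Definition _ := GRing.isMonoidMorphism.Build R T iota iota_is_multiplicative.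

Lemma act_lcoset g h p : p \in invariants rH -> h \in H -> g \in G -> act (g * h)%g p = act g p.
Proof.
move=> /invP pH hH gG; rewrite actM //; last exact: (fintype.subsetP sHG).
by congr (mpoly_act _ _ _); apply: pH.
Qed.

Lemma repr_lcosets C : C \in lcosets H G -> grepr C \in G /\ C = (grepr C *: H)%g.
Proof.
move=> /lcosetsP[g gG ->]; have gr := mem_repr g (lcoset_refl H g).
case/lcosetP: gr => h hH E; split; first by rewrite E groupM // (fintype.subsetP sHG).
by rewrite E lcosetM (lcoset_id hH).
Qed.

Lemma act_repr C g p : C \in lcosets H G -> g \in C -> p \in invariants rH -> act (grepr C) p = act g p.
Proof.
move=> CG gC pH; have [rG' CE] := repr_lcosets CG.
move: gC; rewrite CE => /lcosetP[h hH ->].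
by rewrite -CE act_lcoset.
Qed.

Lemma lcosets_mul g C : g \in G -> C \in lcosets H G -> (g *: C)%g \in lcosets H G.
Proof.
move=> gG /lcosetsP[x xG ->]; apply/lcosetsP; exists (g * x)%g; first exact: groupM.
by rewrite -lcosetM.
Qed.

Lemma lcosets_reindex A idx (op : Monoid.com_law idx) (Q : pred {set gT}) g (E : {set gT} -> A) : g \in G ->
  (forall C, C \in lcosets H G -> Q (g *: C)%g = Q C) ->
  \big[op/idx]_(C in lcosets H G | Q C) E C = \big[op/idx]_(C in lcosets H G | Q C) E (g *: C)%g.
Proof.
move=> gG QE; rewrite (reindex_onto (fun C : {set gT} => (g *: C)%g) (fun C : {set gT} => (g^-1 *: C)%g)) /=.
  apply: eq_bigl => C; rewrite -lcosetM mulVg lcoset1 eqxx andbT.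
  case CG : (C \in lcosets H G); first by rewrite lcosets_mul //= QE.
  apply/negbTE; apply/negP => /andP[gCG _]; move/negP: CG; apply.
  by rewrite -[C]lcoset1 -(mulVg g) lcosetM lcosets_mul ?groupV.
by move=> C _; rewrite -lcosetM mulgV lcoset1.
Qed.

(** The transfer divided by the index, so that it restricts to the identity on [R]. *)
Definition traceS (p : S) : S := (#|G : H|%g)%:R^-1 *: \sum_(C in lcosets H G) act (grepr C) p.

Lemma act_repr_mul g C p : g \in G -> C \in lcosets H G -> p \in invariants rH ->
  act g (act (grepr C) p) = act (grepr (g *: C)%g) p.
Proof.
move=> gG CG pH; have [rC CE] := repr_lcosets CG.
rewrite -(actM rG p gG rC); apply/esym; apply: act_repr; last exact: pH.
  exact: lcosets_mul.
by rewrite mem_lcoset mulKg {2}CE lcoset_refl.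
Qed.

Lemma trace_inv (x : T) : traceS (inv_val x) \in invariants rG.
Proof.
apply/invP => g gG; rewrite /traceS actZ rmorph_sum /=; congr (_ *: _).
pose E C := act (grepr C) (inv_val x).
rewrite [RHS](eq_bigl (fun C => (C \in lcosets H G) && true)); last by move=> C; rewrite andbT.
rewrite (@lcosets_reindex _ _ _ xpredT g E gG (fun _ _ => erefl)).
apply: eq_big => [C|C CG]; first by rewrite andbT.
by apply: act_repr_mul => //; exact: valP.
Qed.

Definition trace (x : T) : R := Invariant (trace_inv x).

Lemma traceD : {morph trace : x y / x + y}.
Proof.
move=> x y; apply: inv_val_inj; rewrite rmorphD /= /traceS -scalerDr; congr (_ *: _).
rewrite -big_split; apply: eq_bigr => C _ /=.
by rewrite !rmorphD.
Qed.

Lemma traceM (r : R) (x : T) : trace (iota r * x) = r * trace x.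
Proof.
apply: inv_val_inj; rewrite [RHS]rmorphM /= /traceS -scalerAr; congr (_ *: _).
rewrite mulr_sumr; apply: eq_bigr => C CG /=.
have [rC _] := repr_lcosets CG.
by rewrite !rmorphM /= (inv_valP r rC).
Qed.

Lemma trace_iota (r : R) : trace (iota r) = r.
Proof.
apply: inv_val_inj; rewrite /= /traceS (eq_bigr (fun _ => inv_val r)).
  by rewrite sumr_const card_lcosets -scaler_nat scalerA mulVf // scale1r.
by move=> C CG; have [rC _] := repr_lcosets CG; rewrite (inv_valP r rC).
Qed.

Lemma ev_act g p : ev v (act g p) = ev (rG (g^-1)%g *m v) p.
Proof. exact: act_meval. Qed.

(** A polynomial equal to 1 at [v] and 0 on the rest of its orbit, made invariant by a product over
    [H]. *)
Lemma separating_invariant : exists b : T, ev v (inv_val b) = 1 /\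
  forall g, g \in G -> g \notin H -> ev v (act g (inv_val b)) = 0.
Proof.
have [|b0 [b00 b01]] := @separate_family F n gT [pred g | (g \in G) && (g \notin H)] (fun g => rG (g^-1)%g *m v) v.
  move=> g /andP[gG]; apply: contraNneq => E; rewrite -groupV stabv ?groupV //.
  by rewrite E.
pose b : S := \prod_(h in H) act h b0.
have bH : b \in invariants rH.
  apply/invP=> g gH; rewrite act_sub rmorph_prod (reindex_inj (mulgI g^-1%g)) /=.
  apply: eq_big => h; first by rewrite (groupMl _ (groupVr gH)).
  rewrite (groupMl _ (groupVr gH)) => hH; have hG := fintype.subsetP sHG h hH.
  have gG := fintype.subsetP sHG g gH.
  by rewrite -(actM rG b0 gG (groupM (groupVr gG) hG)) mulKVg.
exists (Invariant bH); split=> [|g gG gH].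
  rewrite /= rmorph_prod /= big1 // => h hH; rewrite ev_act -[RHS]b01; congr (ev _ _).
  by apply/eqP; rewrite -stabv ?groupV // (fintype.subsetP sHG).
rewrite /= ev_act rmorph_prod /= (bigD1 1%g) //= act1 b00 ?mul0r //.
by rewrite inE gG.
Qed.

(* The elements [phi_j] and [b ^ j] are dual bases for the trace form, up to the
   factor [s]; as [s] does not vanish at [v], the inclusion of rings is etale there. *)
Lemma dual_bases : exists (s b : T) (phi : nat -> T) m, ev v (inv_val s) = 1 /\
  forall x : T, s * x = \sum_(j < m) phi j * iota (trace (b ^+ j * x)).
Proof.
have [b [bv bg]] := separating_invariant.
(* The roots of [P] are the translates of [b] by the cosets other than [H]. *)
pose P : {poly S} := \prod_(C in lcosets H G | C != H) ('X - (act (grepr C) (inv_val b))%:P).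
have HG : (H : {set gT}) \in lcosets H G.
  by apply/lcosetsP; exists 1%g; rewrite ?group1 ?lcoset1.
have PH h : h \in H -> map_poly (act h) P = P.
  move=> hH; have hG := fintype.subsetP sHG h hH.
  rewrite /P rmorph_prod /=.
  rewrite [RHS](@lcosets_reindex _ _ _ (fun C => C != H) h) //; last first.
    move=> C CG; rewrite -[X in _ == X](lcoset_id hH); congr (~~ _).
    by apply/eqP/eqP => [/lcoset_inj|->].
  apply: eq_bigr => C /andP[CG _]; rewrite rmorphB /= map_polyX map_polyC /=.
  by rewrite act_repr_mul //; exact: valP.
have Pj j : P`_j \in invariants rH.
  apply/invP => h hH; have := PH h hH => /(congr1 (fun q : {poly S} => q`_j)).
  by rewrite coef_map.
pose c j : T := Invariant (Pj j).
(* [s] is [P] evaluated at [b]; the index in [phi] cancels the normalization of the transfer. *)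
exists (\sum_(j < size P) c j * b ^+ j), b, (fun j => (#|G : H|%g)%:R * c j), (size P).
have sE : inv_val (\sum_(j < size P) c j * b ^+ j) = P.[inv_val b].
  rewrite rmorph_sum horner_coef; apply: eq_bigr => j _.
  by rewrite rmorphM rmorphXn.
split=> [|x].
  rewrite sE horner_prod rmorph_prod big1 // => C /andP[CG CH] /=.
  rewrite hornerXsubC rmorphB /= bv bg ?subr0 //; first by case: (repr_lcosets CG).
  apply: contra_neqN CH => rH'; case: (repr_lcosets CG) => _ ->.
  exact: lcoset_id.
apply: inv_val_inj; rewrite rmorphM /= sE rmorph_sum /=.
(* [P] vanishes at every translate of [b] by another coset, so only the coset [H] contributes. *)
transitivity (\sum_(C in lcosets H G) P.[act (grepr C) (inv_val b)] * act (grepr C) (inv_val x)).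
  rewrite (bigD1 _ HG) /= big1 ?addr0 => [|C /andP[CG CH]].
    by rewrite !(act_repr HG (group1 H)) ?act1 //; exact: valP.
  rewrite /P (bigD1 C) /=; last by apply/andP; split.
  by rewrite hornerM hornerXsubC subrr !mul0r.
have t j : inv_val ((#|G : H|%g)%:R * c j * iota (trace (b ^+ j * x))) =
    \sum_(C in lcosets H G) P`_j * act (grepr C) (inv_val b) ^+ j * act (grepr C) (inv_val x).
  rewrite !rmorphM rmorph_nat /= /traceS -scalerAr -mulrA mulr_natl -scaler_nat.
  rewrite scalerA mulVf // scale1r mulr_sumr; apply: eq_bigr => C _ /=.
  by rewrite !rmorphM rmorphXn /= rmorphXn mulrA.
transitivity (\sum_(C in lcosets H G) \sum_(j < size P)
   P`_j * act (grepr C) (inv_val b) ^+ j * act (grepr C) (inv_val x)).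
  by apply: eq_bigr => C _; rewrite horner_coef mulr_suml.
by rewrite exchange_big; apply: eq_bigr => j _; rewrite /= -t.
Qed.

(** By [dual_bases], [s z] is a combination of extensions of the cocycles [trace (b ^+ j z)] over
    [R], each of which [r] turns into a coboundary. *)
Lemma hvan_descent k (f : 'I_k -> R) i r : r \in hann f R^o i ->
  exists s : T, ev v (inv_val s) = 1 /\ iota r * s \in hann (iota \o f) T^o i.
Proof.
move=> /asboolP rJ; have [s [b [phi [m [sv sE]]]]] := dual_bases.
exists s; split=> //; apply/asboolP => z zi dz.
pose tr (x : T^o) : R^o := trace x.
pose io (x : R^o) : T^o := iota x.
have trf j (x : T^o) : tr ((iota \o f) j *: x) = f j *: tr x by exact: traceM.
have trD : {morph tr : x y / x + y} by exact: traceD.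
have ioZ (a : R) (x : R^o) : io (a *: x) = iota a *: io x by exact: rmorphM.
have iof j (x : R^o) : io (f j *: x) = (iota \o f) j *: io x by exact: ioZ.
have ioD : {morph io : x y / x + y} by exact: rmorphD.
have H' j : exists w : cech f R^o, cech_degp i w /\ r *: cech_fun f tr (b ^+ j *: z) = cech_d w.
  apply: rJ; first by apply: (cech_fun_deg trD trf); apply: cech_degZ.
  by rewrite (cech_fun_d trD trf) cech_dZ dz scaler0 (cech_fun0 trD trf).
have [w /all_and2[wi wE]] := choice H'.
exists (\sum_(j < m) phi j *: cech_fun (iota \o f) io (w j)); split.
  apply: (big_ind (fun c : cech (iota \o f) T^o => cech_degp i c)).
  - exact: cech_degp_0.
  - exact: cech_degpD.
  - by move=> j _; apply: cech_degpZ; apply: (cech_fun_degp ioD iof).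
rewrite cech_d_sum.
transitivity (\sum_(j < m) (phi j * iota r) *: cech_fun (iota \o f) io (cech_fun f tr (b ^+ j *: z))); last first.
  apply: eq_bigr => j _; rewrite cech_dZ (cech_fun_d ioD iof) -wE.
  by rewrite (cech_funZ iof _ (ioZ r)) scalerA.
apply/ffunP => I; rewrite cech_sumE ffunE.
under eq_bigr => j _ do rewrite !ffunE.
elim/fracW: (z I) => x l.
have t j : (phi j * iota r) *: loc_fun (cech_prod (iota \o f) I) io (loc_fun (cech_prod f I) tr (b ^+ j *: frac (cech_prod (iota \o f) I) x l))
  = frac (cech_prod (iota \o f) I) ((phi j * iota r) *: io (tr (b ^+ j *: x))) l.
  have -> : b ^+ j *: frac (cech_prod (iota \o f) I) x l = frac _ (b ^+ j *: x) l by rewrite fracZ.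
  have -> := @loc_funE _ _ _ _ _ (cech_prod f I) tr (semilin_prod trf I) (b ^+ j *: x) l.
  have -> := @loc_funE _ _ _ _ _ (cech_prod (iota \o f) I) io (semilin_prod iof I) (tr (b ^+ j *: x)) l.
  by rewrite fracZ.
transitivity (\sum_(j < m) frac (cech_prod (iota \o f) I) ((phi j * iota r) *: io (tr (b ^+ j *: x))) l); last first.
  by apply: eq_bigr => j _; rewrite -t.
rewrite fracZ.
have -> : (iota r * s) *: x = \sum_(j < m) (phi j * iota r) *: io (tr (b ^+ j *: x)).
  transitivity (iota r * (s * x)); first by rewrite /GRing.scale /= mulrA.
  rewrite sE mulr_sumr; apply: eq_bigr => j _.
  by rewrite /GRing.scale /= mulrA [phi j * _]mulrC.
by elim/big_ind2: _ => [|x1 x2 y1 y2 <- <-|] //; rewrite ?frac0 ?fracDm.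
Qed.

(** The orbit of [v] avoids 0, so some invariant is 1 at [v] and 0 at 0; one of its components is
    nonzero at [v], and it is not the component of degree 0. *)
Lemma homog_invariant : exists d (h : R), [/\ (0 < d)%N, inv_val h \is d.-homog & ev v (inv_val h) != 0].
Proof.
have [|e [e0 e1]] := @separate_family F n gT (mem G) (fun g => rG (g^-1)%g *m v) 0.
  move=> g gG; apply: contraNneq v_neq0 => E.
  by rewrite -[v]mul1mx -(repr_mx1 rG) -(mulgV g) repr_mxM ?groupV // -mulmxA E mulmx0.
pose h0 : S := \prod_(g in G) act g (1 - e).
have h0G : h0 \in invariants rG.
  apply/invP=> g gG; rewrite rmorph_prod (reindex_inj (mulgI g^-1%g)) /=.
  apply: eq_big => h; first by rewrite (groupMl _ (groupVr gG)).
  rewrite (groupMl _ (groupVr gG)) => hG.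
  by rewrite -(actM rG (1 - e) gG (groupM (groupVr gG) hG)) mulKVg.
have h0v : ev v h0 = 1.
  rewrite rmorph_prod /= big1 // => g gG; rewrite ev_act rmorphB /= rmorph1 e0 ?subr0 //.
have h00 : ev 0 h0 = 0.
  rewrite rmorph_prod /= (bigD1 1%g) //= act1 rmorphB /= rmorph1 e1 subrr mul0r.
  by [].
pose D := msize h0.
have hsum : h0 = \sum_(d < D) pihomog mdeg d h0 by exact: pihomog_sum_ge.
have [d dv] : exists d : 'I_D, ev v (pihomog mdeg d h0) != 0.
  apply/existsP; rewrite -negb_forall; apply/negP => /forallP Hd.
  move: h0v; rewrite hsum rmorph_sum big1 => [/esym/eqP|j _]; first by rewrite oner_eq0.
  exact/eqP/Hd.
exists d, (Invariant (pihomog_inv d h0G)); split=> //; last exact: pihomogP.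
rewrite lt0n; apply: contraNneq dv => d0; rewrite d0.
rewrite -(ev_homog0 0) ?pihomogP //; apply/eqP.
transitivity (ev 0 h0) => //; have D0 : (0 < D)%N by rewrite (leq_ltn_trans _ (ltn_ord d)).
rewrite [in RHS]hsum [RHS]rmorph_sum (bigD1 (Ordinal D0)) //= [X in _ = _ + X]big1 ?addr0 // => j.
by rewrite -val_eqE /= -lt0n => j0; apply: (ev0_homog j0); apply: pihomogP.
Qed.

Lemma pihomog_mul_homog d e (p q : S) : p \is d.-homog ->
  pihomog mdeg (d + e) (p * q) = p * pihomog mdeg e q.
Proof.
move=> pd; pose D := maxn e.+1 (msize q).
rewrite [in LHS](@pihomog_sum_ge _ _ q D) ?leq_maxr // mulr_sumr linear_sum /=.
have eD : (e < D)%N by rewrite leq_max ltnSn.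
rewrite (bigD1 (Ordinal eD)) //= pihomog_dE; last exact: dhomogM (pihomogP _ _ _).
rewrite big1 ?addr0 // => j; rewrite -val_eqE /= => je.
apply: (@pihomog_ne0 _ _ _ (d + j)%N); last exact: dhomogM (pihomogP _ _ _).
by rewrite eqn_add2l.
Qed.

Lemma pihomog_mul_homog_lt d c (p q : S) : p \is d.-homog -> (c < d)%N ->
  pihomog mdeg c (p * q) = 0.
Proof.
move=> pd cd.
rewrite [in LHS](@pihomog_sum_ge _ _ q (msize q)) // mulr_sumr linear_sum /= big1 // => j _.
apply: (@pihomog_ne0 _ _ _ (d + j)%N); last exact: dhomogM (pihomogP _ _ _).
by rewrite neq_ltn ltn_addr ?orbT.
Qed.

Lemma finite_length_hvan k (f : 'I_k -> R) i :
  finite_length (local_cohomology f R^o i) -> hvan f R^o i.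
Proof.
move=> fl; have [d [h [d0 hd hv]]] := homog_invariant.
have [q [r hr]] := finite_length_ann h fl.
have hJ := hann_local_cohomology hr.
(* As [h] has positive degree, the lowest component of [h ^+ q - h ^+ q.+1 * r] is [h ^+ q]. *)
have hqJ : h ^+ q \in hann f R^o i.
  have <- : inv_comp (d * q) (h ^+ q * (1 - h * r)) = h ^+ q; last exact: hann_homog.
  apply: inv_val_inj; rewrite inv_compE !rmorphM rmorphXn rmorphB rmorphM rmorph1 /= mulrBr mulr1 mulrA -exprSr.
  have hq m : inv_val h ^+ m \is (d * m).-homog by apply: dhomogMn.
  rewrite linearB /= (pihomog_dE (hq q)) (pihomog_mul_homog_lt _ (hq q.+1)).
    by rewrite subr0 rmorphXn.
  by rewrite ltn_pmul2l.
have [s [sv sJ]] := hvan_descent hqJ.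
(* [s] need not be homogeneous, but some component of it is nonzero at [v]. *)
have [e ev_e] : exists e, ev v (pihomog mdeg e (inv_val s)) != 0.
  case: (pselect (exists e, ev v (pihomog mdeg e (inv_val s)) != 0)) => // E.
  move/eqP: sv; rewrite (@pihomog_sum_ge _ _ (inv_val s) (msize (inv_val s))) // rmorph_sum big1.
    by rewrite eq_sym oner_eq0.
  by move=> j _; apply/eqP/negPn/negP => Ej; apply: E; exists j.
pose p := inv_comp (d * q + e) (iota (h ^+ q) * s).
have pJ : p \in hann (iota \o f) T^o i by exact: hann_homog.
have hq : inv_val h ^+ q \is (d * q).-homog by apply: dhomogMn.
have pE : inv_val p = inv_val h ^+ q * pihomog mdeg e (inv_val s).
  by rewrite inv_compE rmorphM /= rmorphXn pihomog_mul_homog.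
(* The constant vector field [v] is [H]-equivariant because [H] fixes [v]. *)
have equi g : g \in H -> forall i, mpoly_act rH g (v i 0)%:MP = \sum_(j < n) rH (g^-1)%g i j *: (v j 0)%:MP.
  move=> gH j; rewrite actC; have gG := fintype.subsetP sHG g gH.
  have := stabv (groupVr gG); rewrite groupV gH => /esym/eqP E.
  rewrite -{1}E mxE rmorph_sum; apply: eq_bigr => l _.
  by rewrite rmorphM /= mul_mpolyC.
have cJ := hann_flow equi pJ (d * q + e).
have hJT := hann_ideal (iota \o f) T^o i.
(* The top coefficient of the translate of [p] is the nonzero constant [p(v)]: a unit in the
   annihilator. *)
have cE : (inv_flow equi p)`_(d * q + e) = inv_const rH (ev v (inv_val p)).
  apply: inv_val_inj; rewrite inv_flow_coef flow_translation //.
  by rewrite pE; apply: dhomogM => //; apply: pihomogP.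
have c0 : ev v (inv_val p) != 0.
  by rewrite pE rmorphM rmorphXn mulf_neq0 // expf_neq0.
have : hvan (iota \o f) T^o i.
  apply: hann1; have -> : 1 = inv_const rH (ev v (inv_val p))^-1 * inv_const rH (ev v (inv_val p)) :> T.
    by apply: inv_val_inj; rewrite rmorph1 rmorphM /= -mpolyCM mulVf // mpolyC1.
  by apply: (idealM hJT); rewrite -cE.
(* [R] is a retract of [T]: extend [z], solve over [T], apply the transfer. *)
move=> van z zi dz.
pose tr (x : T^o) : R^o := trace x.
pose io (x : R^o) : T^o := iota x.
have trf j (x : T^o) : tr ((iota \o f) j *: x) = f j *: tr x by exact: traceM.
have trD : {morph tr : x y / x + y} by exact: traceD.
have iof j (x : R^o) : io (f j *: x) = (iota \o f) j *: io x by exact: rmorphM.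
have ioD : {morph io : x y / x + y} by exact: rmorphD.
have [||b [bi bE]] := van (cech_fun (iota \o f) io z).
- exact: cech_fun_deg.
- by rewrite (cech_fun_d ioD iof) dz (cech_fun0 ioD iof).
exists (cech_fun f tr b); split; first exact: (cech_fun_degp trD trf).
rewrite (cech_fun_d trD trf) -bE (cech_fun_comp (chi := fun x => 1 *: x) iof trf) => [|x].
  by rewrite (@cech_fun_scale _ _ _ _ 1) // scale1r.
by rewrite scale1r /tr /io /= trace_iota.
Qed.

End Transfer.

(** * Choice of the stabilizer and degenerate cases *)

Section Vanishing.
Variables (F : fieldType) (gT : finGroupType) (G : {group gT}) (n : nat).
Variable rG : mx_representation F G n.

(** Stabilizers and fixed spaces of representations are stated for row vectors, whereas the points
    here are columns; the contragredient turns one into the other. *)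
Definition dual_mx (g : gT) : 'M[F]_n := (rG (g^-1)%g)^T.

Lemma dual_mx_repr : mx_repr G dual_mx.
Proof.
split=> [|g h gG hG]; first by rewrite /dual_mx invg1 repr_mx1 trmx1.
by rewrite /dual_mx invMg repr_mxM ?groupV // trmx_mul.
Qed.
Canonical dual_repr := MxRepresentation dual_mx_repr.

(* A Sylow [p]-subgroup has a nonzero fixed vector, and its stabilizer has
   index prime to [p]. *)
Lemma exists_stabilizer : (0 < n)%N -> exists (H : {group gT}) (v : 'cV[F]_n),
  [/\ H \subset G, v != 0, forall g, g \in G -> (g \in H) = (rG g *m v == v)
    & (#|G : H|%g)%:R != 0 :> F].
Proof.
move=> n0; pose H (u : 'rV[F]_n) := rstab dual_repr u.
suff [u [u0 uF]] : exists u : 'rV[F]_n, u != 0 /\ (#|G : H u|%g)%:R != 0 :> F.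
  exists (rstab_group dual_repr u), u^T; split=> //.
  - by apply/fintype.subsetP => g; rewrite inE => /andP[].
  - by apply: contraNneq u0 => /(congr1 trmx); rewrite trmxK trmx0 => ->.
  move=> g gG; rewrite -groupV inE groupV gG /= /dual_mx invgK.
  apply/eqP/eqP => [E|E]; first by rewrite -[in RHS]E trmx_mul trmxK.
  by apply: trmx_inj; rewrite trmx_mul trmxK.
(* In characteristic 0 any nonzero vector will do. *)
have [[p pF]|nF] := pselect (exists p, p \in [pchar F]); last first.
  pose w : 'rV[F]_n := const_mx 1; exists w; split.
    apply/eqP => /matrixP /(_ 0 (Ordinal n0)) /eqP; rewrite !mxE.
    by rewrite oner_eq0.
  have F0 : [pchar F] =i pred0 by move=> p; apply/negP => pF; apply: nF; exists p.
  by move/pcharf0P: F0 => ->; rewrite -lt0n indexg_gt0.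
have [P sylP] := sylow.Sylow_exists p G.
have PG := pgroup.pHall_sub sylP; have pP := pgroup.pHall_pgroup sylP.
have /rowV0Pn[u /rfix_mxP uP u0] := rfix_pgroup_pchar pF dual_repr n0 pP PG.
exists u; split=> //.
(* [P] fixes [u], so the index of the stabilizer divides that of [P], which is prime to [p]. *)
have PH : P \subset H u.
  by apply/fintype.subsetP => g gP; rewrite inE (fintype.subsetP PG) //= uP.
rewrite -(dvdn_pcharf pF); apply: contraTN (sylP) => pd.
rewrite /pgroup.pHall PG pP /= p'natE ?(pcharf_prime pF) // negbK.
by apply: dvdn_trans pd (indexgS _ PH).
Qed.

Lemma finite_length_vanishing k (f : 'I_k -> invariant_ring rG) i : (0 < n)%N ->
  finite_length (local_cohomology f (invariant_ring rG)^o i) ->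
  hvan f (invariant_ring rG)^o i.
Proof.
move=> n0; have [H [v [sHG v0 stabv iF]]] := exists_stabilizer n0.
exact: (finite_length_hvan sHG v0 stabv iF).
Qed.

End Vanishing.

(** By [comb_torsion], some power of 1 kills each class. *)
Lemma unit_ideal_hvan (R : comNzRingType) k (f : 'I_k -> R) i :
  in_comb f 1 -> hvan f R^o i.
Proof.
move=> [c cE] z zi dz; have h0 := zero_submod_closed R^o.
have [|N /asboolP[b [bi Hb]]] := comb_torsion h0 zi _ cE.
  by apply/incech_pred1.
exists b; split=> //; apply/eqP; rewrite -subr_eq0; apply/eqP/incech_pred1.
by rewrite expr1n scale1r in Hb.
Qed.

Lemma zero_gens_hvan (R : comNzRingType) k (f : 'I_k -> R) i :
  (forall j, f j = 0) -> (0 < i)%N -> hvan f R^o i.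
Proof.
move=> f0 i0 z /cech_degP zi _; exists 0; split; first exact: cech_degp_0.
rewrite cech_d0; apply/ffunP => I; rewrite [RHS]ffunE.
have [Ii|/zi//] := eqVneq #|I| i.
have /card_gt0P[j jI] : (0 < #|I|)%N by rewrite Ii.
elim/fracW: (z I) => x m; apply/frac_eq0; exists 1%N.
by rewrite (cech_prodD1 f jI) f0 mul0r expr1 scale0r.
Qed.

(** For [n = 0] the ring is a copy of [F], so the [f j] all vanish or generate the unit ideal. *)
Lemma trivial_space_hvan (F : fieldType) (gT : finGroupType) (G : {group gT})
  (rG : mx_representation F G 0) k (f : 'I_k -> invariant_ring rG) i :
  (0 < i)%N -> hvan f (invariant_ring rG)^o i.
Proof.
move=> i0; have [/existsP[j fj]|/existsPn f0] := boolP [exists j, f j != 0]; last first.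
  by apply: zero_gens_hvan => // j; apply/eqP; rewrite -[_ == _]negbK f0.
apply: unit_ideal_hvan; have cE (x : invariant_ring rG) : inv_val x = ((inv_val x)@_0%MM)%:MP.
  apply: msize1_polyC; rewrite msizeE; apply/bigmax_leqP_seq => m _ _.
  by rewrite mdegE big_ord0.
pose c := (inv_val (f j))@_0%MM; have c0 : c != 0.
  apply: contraNneq fj => c0; apply/eqP/inv_val_inj.
  by rewrite cE -/c c0 rmorph0.
exists (fun l => if l == j then inv_const rG c^-1 else 0).
rewrite (bigD1 j) //= eqxx big1 ?addr0 => [|l /negbTE->]; last by rewrite mul0r.
by apply: inv_val_inj; rewrite rmorph1 rmorphM /= cE -/c -mpolyCM mulVf // mpolyC1.
Qed.

(** * Noetherianity *)

Section Noetherian.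
Variable A : comNzRingType.
Implicit Types (B W X : {pred A}).

(** Submodules over a subring [B], both given as predicates on one ambient ring, so that towers of
    subrings need no change of type. *)
Definition bsub B W := [/\ 0 \in W, forall x y, x \in W -> y \in W -> x - y \in W
  & forall b x, b \in B -> x \in W -> b * x \in W].

Definition accB B X := forall W : nat -> {pred A}, (forall m, bsub B (W m)) ->
  (forall m, {subset W m <= X}) -> (forall m, {subset W m <= W m.+1}) ->
  exists N, forall m, (N <= m)%N -> {subset W m <= W N}.

Lemma chain_le (W : nat -> {pred A}) : (forall m, {subset W m <= W m.+1}) ->
  forall m m', (m <= m')%N -> {subset W m <= W m'}.
Proof.
move=> H m m' /subnK <-; elim: (m' - m)%N => // d IH x /IH; exact: H.
Qed.

Lemma bsubD B W x y : bsub B W -> x \in W -> y \in W -> x + y \in W.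
Proof. by move=> [W0 WB _] xW yW; rewrite -[y]opprK WB // -sub0r WB. Qed.

Lemma bsub_sum B W T (r : seq T) (P : pred T) (E : T -> A) : bsub B W ->
  (forall i, P i -> E i \in W) -> \sum_(i <- r | P i) E i \in W.
Proof.
move=> hW H; apply: (big_ind (fun x => x \in W)) => //; first by case: hW.
by move=> x y; apply: bsubD hW.
Qed.

Lemma accB0 B : accB B (pred1 0).
Proof.
by move=> W hW W0 _; exists 0%N => m _ x /W0 /eqP->; case: (hW 0%N).
Qed.

Definition sumP X1 s X2 : {pred A} := fun x => `[< exists x1 x2, [/\ x1 \in X1, x2 \in X2 & x = x1 + s * x2] >].

(** A submodule of [X1 + s X2] is controlled by its intersection with [X1] and by the elements of
    [X2] occurring as coefficients of [s]. *)
Lemma accB_sum B X1 s X2 : bsub B X1 -> bsub B X2 -> accB B X1 -> accB B X2 ->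
  accB B (sumP X1 s X2).
Proof.
move=> h1 h2 H1 H2 W hW WX Wm.
pose J m : {pred A} := fun b => `[< b \in X2 /\ exists2 x1, x1 \in X1 & x1 + s * b \in W m >].
pose W' m : {pred A} := fun x => (x \in X1) && (x \in W m).
have [] := H2 J.
- move=> m; have [W0 WB WM] := hW m; have [h10 h1B h1M] := h1; have [h20 h2B h2M] := h2.
  split=> [|x y /asboolP[x2 [x1 x1X xW]] /asboolP[y2 [y1 y1X yW]]|b x bB /asboolP[x2 [x1 x1X xW]]]; apply/asboolP; split; rewrite ?h2B ?h2M //.
  + by exists 0; rewrite // mulr0 addr0.
  + by exists (x1 - y1); rewrite ?h1B // mulrBr addrACA -opprD WB.
  + by exists (b * x1); rewrite ?h1M // mulrCA -mulrDr WM.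
- by move=> m x /asboolP[].
- by move=> m x /asboolP[xX [x1 x1X xW]]; apply/asboolP; split=> //; exists x1 => //; apply: Wm.
move=> N2 HN2; have [] := H1 W'.
- move=> m; have [W0 WB WM] := hW m; have [h10 h1B h1M] := h1.
  split=> [|x y /andP[? ?] /andP[? ?]|b x bB /andP[? ?]]; apply/andP; split; rewrite ?WB ?WM ?h1B ?h1M //.
- by move=> m x /andP[].
- by move=> m x /andP[xX xW]; apply/andP; split=> //; apply: Wm.
move=> N1 HN1; exists (maxn N1 N2) => m; rewrite geq_max => /andP[mN1 mN2] x xW.
have WN := chain_le Wm; have /asboolP[x1 [x2 [x1X x2X xE]]] := WX m x xW.
have /HN2 : x2 \in J m by apply/asboolP; split=> //; exists x1; rewrite -?xE.
move=> /(_ mN2) /asboolP[_ [y1 y1X yW]].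
have {}yW := WN N2 (maxn N1 N2) (leq_maxr _ _) _ yW.
have dW' : x1 - y1 \in W' m.
  have [_ h1B _] := h1; apply/andP; split; first exact: h1B.
  have [_ WB _] := hW m; have -> : x1 - y1 = x - (y1 + s * x2) by rewrite xE opprD addrACA subrr addr0.
  apply: WB => //.
  by apply: (WN _ _ _ _ yW); rewrite geq_max mN1.
have /andP[_ dW] := HN1 m mN1 _ dW'.
have -> : x = (x1 - y1) + (y1 + s * x2) by rewrite addrA subrK.
apply: (bsubD (hW _)) yW; exact: (WN _ _ (leq_maxl _ _) _ dW).
Qed.

Definition sub_ring B := [/\ 1 \in B, forall x y, x \in B -> y \in B -> x - y \in B
  & forall x y, x \in B -> y \in B -> x * y \in B].

Lemma sub_ring_bsub B : sub_ring B -> bsub B B.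
Proof. by move=> [B1 BB BM]; split=> //; rewrite -(subrr 1) BB. Qed.

Definition in_poly B (p : {poly A}) := forall i, p`_i \in B.

Definition adj B c : {pred A} := fun x => `[< exists2 p, in_poly B p & x = p.[c] >].

Section Adj.
Variables (B : {pred A}) (hB : sub_ring B) (c : A).

Let B0 : 0 \in B. Proof. by case: (sub_ring_bsub hB). Qed.
Let BM x y : x \in B -> y \in B -> x * y \in B. Proof. by case: hB => _ _; apply. Qed.
Let BB x y : x \in B -> y \in B -> x - y \in B. Proof. by case: hB => _ H _; apply: H. Qed.

Lemma in_polyB p q : in_poly B p -> in_poly B q -> in_poly B (p - q).
Proof. by move=> Hp Hq i; rewrite coefB BB. Qed.

Lemma in_polyC b : b \in B -> in_poly B b%:P.
Proof. by move=> bB i; rewrite coefC; case: ifP. Qed.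

Lemma in_polyM p q : in_poly B p -> in_poly B q -> in_poly B (p * q).
Proof.
move=> Hp Hq i; rewrite coefM; apply: (bsub_sum _ (sub_ring_bsub hB)) => j _.
exact: BM.
Qed.

Lemma in_polyX : in_poly B 'X.
Proof. by move=> i; rewrite coefX; case: eqP => // _; case: hB. Qed.

Lemma adjS : {subset B <= adj B c}.
Proof. by move=> b bB; apply/asboolP; exists b%:P; rewrite ?hornerC //; apply: in_polyC. Qed.

Lemma adj_gen : c \in adj B c.
Proof. by apply/asboolP; exists 'X; rewrite ?hornerX //; apply: in_polyX. Qed.

Lemma adj_sub_ring : sub_ring (adj B c).
Proof.
split=> [|x y /asboolP[p pB ->] /asboolP[q qB ->]|x y /asboolP[p pB ->] /asboolP[q qB ->]].
- by apply: adjS; case: hB.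
- by apply/asboolP; exists (p - q); rewrite ?hornerD ?hornerN //; apply: in_polyB.
- by apply/asboolP; exists (p * q); rewrite ?hornerM //; apply: in_polyM.
Qed.

(* Hilbert's basis theorem. *)
Lemma accB_adj : accB B B -> accB (adj B c) (adj B c).
Proof.
move=> acc W hW WX Wm; have WN := chain_le Wm.
(* Leading coefficients in degree [d]. As [c] may be algebraic over [B], membership in [W m] is
   tested after evaluation at [c]. *)
pose J m d : {pred A} := fun b => `[< exists p, [/\ in_poly B p, (size p <= d.+1)%N, p`_d = b & p.[c] \in W m] >].
have hJ m d : bsub B (J m d).
  have [W0 WB WM] := hW m; split.
  - apply/asboolP; exists 0; split; rewrite ?size_poly0 ?coef0 ?horner0 //.
    by move=> i; rewrite coef0.
  - move=> x y /asboolP[p [pB ps <- pW]] /asboolP[q [qB qs <- qW]]; apply/asboolP.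
    exists (p - q); split; rewrite ?coefB ?hornerD ?hornerN ?WB //; first exact: in_polyB.
    by rewrite (leq_trans (size_polyD _ _)) // size_polyN geq_max ps.
  - move=> b x bB /asboolP[p [pB ps <- pW]]; apply/asboolP.
    exists (b%:P * p); split; rewrite ?coefCM ?hornerM ?hornerC ?WM //.
    + by apply: in_polyM => //; apply: in_polyC.
    + by rewrite mul_polyC (leq_trans (size_scale_leq _ _)).
    + exact: adjS.
have JB m d : {subset J m d <= B} by move=> b /asboolP[p [pB _ <- _]].
have Jm m m' d : (m <= m')%N -> {subset J m d <= J m' d}.
  move=> mm b /asboolP[p [pB ps pd pW]]; apply/asboolP; exists p; split=> //.
  exact: WN pW.
have Jd m d d' : (d <= d')%N -> {subset J m d <= J m d'}.
  apply: (chain_le (W := J m)) => e b /asboolP[p [pB ps pd pW]]; apply/asboolP.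
  exists (p * 'X); split; rewrite ?coefMX //.
  - by apply: in_polyM => //; apply: in_polyX.
  - by rewrite (leq_trans (size_polyMleq _ _)) // size_polyX addn2.
  - by have [_ _ WM] := hW m; rewrite hornerM hornerX mulrC WM //; apply: adj_gen.
(* The diagonal chain settles all degrees from [D] on at once; the finitely many others are settled
   one by one. *)
have [|||D HD] := acc (fun m => J m m); [by move=> m; apply: hJ|by move=> m; apply: JB| |].
  by move=> m x /(Jd _ _ m.+1 (leqnSn m)); apply: Jm.
have HN d : exists N, forall m, (N <= m)%N -> {subset J m d <= J N d}.
  by apply: acc => [m|m|m]; [exact: hJ|exact: JB|exact: Jm].
have [Nd HNd] := choice HN.
pose N := maxn D (\max_(d < D) Nd d); exists N => m Nm.
have DN : (D <= N)%N by rewrite leq_maxl.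
have key d : {subset J m d <= J N d}.
  move=> b bJ; have [Dd|dD] := leqP D d.
    apply: (Jm D) => //; apply: (Jd _ D) => //.
    apply: (HD (maxn m d)); first by rewrite leq_max Dd orbT.
    by apply: (Jm m); rewrite ?leq_maxl //; apply: (Jd _ d); rewrite ?leq_maxr.
  have NdN : (Nd d <= N)%N.
    by rewrite leq_max; apply/orP; right; rewrite (bigD1 (Ordinal dD)) //= leq_maxl.
  by apply: (Jm (Nd d)) => //; apply: HNd bJ; apply: leq_trans Nm.
suff H s (p : {poly A}) : (size p <= s)%N -> in_poly B p -> p.[c] \in W m -> p.[c] \in W N.
  by move=> x xW; have /asboolP[p pB E] := WX m x xW; rewrite E; apply: (H (size p)); rewrite // -E.
elim: s p => [|d IH] p.
  rewrite leqn0 size_poly_eq0 => /eqP-> _ _; rewrite horner0; by case: (hW N).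
move=> ps pB pW; have /key/asboolP[q [qB qs qd qW]] : p`_d \in J m d.
  by apply/asboolP; exists p.
have -> : p.[c] = (p - q).[c] + q.[c] by rewrite hornerD hornerN subrK.
apply: (bsubD (hW N)) (qW); apply: IH.
- apply/leq_sizeP => j; rewrite leq_eqVlt => /orP[/eqP<-|dj]; first by rewrite coefB qd subrr.
  by rewrite coefB !nth_default ?subrr // (leq_trans _ dj).
- exact: in_polyB.
- have [_ WB _] := hW m; rewrite hornerD hornerN WB //; exact: WN qW.
Qed.

End Adj.

Fixpoint adjs B cs : {pred A} := if cs is c :: cs' then adj (adjs B cs') c else B.

Lemma adjs_sub_ring B cs : sub_ring B -> sub_ring (adjs B cs).
Proof. by move=> hB; elim: cs => //= c cs IH; apply: adj_sub_ring. Qed.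

Lemma accB_adjs B cs : sub_ring B -> accB B B -> accB (adjs B cs) (adjs B cs).
Proof. by move=> hB aB; elim: cs => //= c cs IH; apply: accB_adj => //; apply: adjs_sub_ring. Qed.

Lemma adjs_gen B cs c : sub_ring B -> c \in cs -> c \in adjs B cs.
Proof.
move=> hB; elim: cs => //= d cs IH; rewrite inE => /orP[/eqP->|/IH].
  by apply: adj_gen; apply: adjs_sub_ring.
by apply: adjS; apply: adjs_sub_ring.
Qed.

Lemma adjs_min B cs D : sub_ring D -> {subset B <= D} -> {subset cs <= D} ->
  {subset adjs B cs <= D}.
Proof.
move=> [D1 DB DM] BD; have hD := sub_ring_bsub (And3 D1 DB DM).
elim: cs => //= c cs IH csD x /asboolP[p pB ->].
rewrite horner_coef; apply: (bsub_sum _ hD) => i _; apply: (DM).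
  by apply: IH (pB i) => d dcs; apply: csD; rewrite inE dcs orbT.
elim: (nat_of_ord i) => [|j IHj]; rewrite ?expr0 // exprS DM // csD // inE eqxx //.
Qed.

Fixpoint spanB B ss : {pred A} := if ss is s :: ss' then sumP (spanB B ss') s B else pred1 0.

Lemma spanB_bsub B ss : sub_ring B -> bsub B (spanB B ss).
Proof.
move=> hB; have [B0 BB BM] := sub_ring_bsub hB.
elim: ss => [|s ss [IH0 IHB IHM]] /=.
  split=> [|x y|b x _]; rewrite ?inE //; first by move=> /eqP-> /eqP->; rewrite subrr.
  by move=> /eqP->; rewrite mulr0.
split.
- by apply/asboolP; exists 0, 0; rewrite mulr0 addr0.
- move=> x y /asboolP[x1 [x2 [x1X x2B ->]]] /asboolP[y1 [y2 [y1X y2B ->]]]; apply/asboolP.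
  by exists (x1 - y1), (x2 - y2); rewrite IHB ?BB // mulrBr opprD addrACA.
- move=> b x bB /asboolP[x1 [x2 [x1X x2B ->]]]; apply/asboolP.
  by exists (b * x1), (b * x2); rewrite IHM ?BM // mulrDr mulrCA.
Qed.

Lemma spanB_gen B ss s : sub_ring B -> s \in ss -> s \in spanB B ss.
Proof.
move=> hB; elim: ss => //= s' ss IH; rewrite inE => /orP[/eqP->|/IH sS]; apply/asboolP.
  exists 0, 1; rewrite add0r mulr1; have [h0 _ _] := spanB_bsub ss hB; split=> //.
  by case: hB.
exists s, 0; rewrite mulr0 addr0; split=> //; by case: (sub_ring_bsub hB).
Qed.

Lemma accB_span B ss : sub_ring B -> accB B B -> accB B (spanB B ss).
Proof.
move=> hB aB; elim: ss => [|s ss IH] /=; first exact: accB0.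
by apply: accB_sum => //; [exact: spanB_bsub | exact: sub_ring_bsub].
Qed.

End Noetherian.

(** * Ideals of the invariant ring and of the polynomial ring *)

Section IdealPoly.
Variables (A : comNzRingType) (J : {pred A}).
Hypothesis hJ : ideal J.

Definition ipoly (p : {poly A}) := forall j, p`_j \in J.

Lemma ipolyD p q : ipoly p -> ipoly q -> ipoly (p + q).
Proof. by move=> Hp Hq j; rewrite coefD (idealD hJ). Qed.

Lemma ipolyM p q : ipoly p -> ipoly (q * p).
Proof. by move=> Hp j; rewrite coefM; apply: (ideal_sum hJ) => i _; apply: (idealM hJ). Qed.

Lemma ipoly_prod (T : finType) (P : pred T) (E : T -> A) :
  (forall i, P i -> E i \in J) ->
  ipoly (\prod_(i | P i) ('X - (E i)%:P) - 'X^(\sum_(i | P i) 1)%N).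
Proof.
move=> HE; apply: (big_ind2 (fun p m => ipoly (p - 'X^m))) => [|p m q m' Hp Hq|i Pi].
- by move=> j; rewrite subrr coef0 (ideal0 hJ).
- have -> : p * q - 'X^(m + m')%N = q * (p - 'X^m) + 'X^m * (q - 'X^m').
    by rewrite exprD; ring.
  by apply: ipolyD; apply: ipolyM.
move=> j; rewrite expr1 addrC addKr coefN coefC; case: ifP => _.
  by apply: (idealN hJ); apply: HE.
by rewrite oppr0 (ideal0 hJ).
Qed.

End IdealPoly.

Lemma coef_comp_scaleX (A : comNzRingType) (p : {poly A}) c j :
  (p \Po (c *: 'X))`_j = c ^+ j * p`_j.
Proof.
elim/poly_ind: p j => [|p a IH] j; first by rewrite comp_poly0 !coef0 mulr0.
rewrite comp_polyD comp_polyM comp_polyX comp_polyC -scalerAr !coefD coefZ !coefMX !coefC.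
case: j => [|j] /=; first by rewrite mulr0 !add0r mul1r.
by rewrite IH !addr0 mulrA -exprS.
Qed.

Section InvariantIdeals.
Variables (F : fieldType) (gT : finGroupType) (G : {group gT}) (n : nat).
Variable rG : mx_representation F G n.
Local Notation S := {mpoly F[n]}.
Local Notation R := (invariant_ring rG).
Local Notation act := (mpoly_act rG).

(** The orbit polynomial of [z], monic with invariant coefficients: it makes [S] integral over
    [R]. *)
Definition chi (z : S) : {poly S} := \prod_(g in G) ('X - (act g z)%:P).

Lemma chi_inv z j : (chi z)`_j \in invariants rG.
Proof.
apply/invP => h hG; rewrite -[LHS](coef_map (mpoly_act rG h)).
suff -> : map_poly (act h) (chi z) = chi z by [].
rewrite /chi rmorph_prod [RHS](reindex_inj (mulgI h)) /=.
apply: eq_big => g; first by rewrite (groupMl _ hG).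
by move=> gG; rewrite rmorphB /= map_polyX map_polyC /= actM.
Qed.

Definition chi_coef z j : R := Invariant (chi_inv z j).

Lemma chi_root z : (chi z).[z] = 0.
Proof. by rewrite /chi (bigD1 1%g) //= hornerM hornerXsubC act1 subrr mul0r. Qed.

Lemma chi_monic z : chi z \is monic.
Proof. by apply: monic_prod => g _; apply: monicXsubC. Qed.

Lemma size_chi z : size (chi z) = #|G|.+1.
Proof.
rewrite /chi size_prod => [|g _]; last by rewrite polyXsubC_eq0.
rewrite (eq_bigr (fun _ => 2%N)) => [|g _]; last exact: size_XsubC.
by rewrite sum_nat_const muln2 -addnn subSn ?leq_addr // addnK.
Qed.

Lemma chi_root_sum z : z ^+ #|G| = - \sum_(j < #|G|) inv_val (chi_coef z j) * z ^+ j.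
Proof.
have := chi_root z; rewrite horner_coef size_chi big_ord_recr /=.
have -> : (chi z)`_#|G| = 1 by have /monicP := chi_monic z; rewrite /lead_coef size_chi.
by rewrite mul1r => /eqP; rewrite addrC addr_eq0 => /eqP.
Qed.

(** The extension [p S] of [p] to the polynomial ring. *)
Definition extI (p : {pred R}) : {pred S} := fun y =>
  `[< exists s : seq (S * R), (forall x, x \in s -> x.2 \in p) /\
      y = \sum_(x <- s) x.1 * inv_val x.2 >].

Lemma extI_ideal p : ideal (extI p).
Proof.
split; first by apply/asboolP; exists [::]; rewrite big_nil.
move=> a x y /asboolP[s [sp ->]] /asboolP[t [tp ->]]; apply/asboolP.
exists ([seq (a * u.1, u.2) | u <- s] ++ t); split.
  by move=> u; rewrite mem_cat => /orP[/mapP[w ws ->]|ut]; [exact: (sp w ws) | exact: tp].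
rewrite big_cat big_map scaler_sumr; congr (_ + _); apply: eq_bigr => u _.
by rewrite /GRing.scale /= mulrA.
Qed.

Lemma extI_in (p : {pred R}) r : r \in p -> inv_val r \in extI p.
Proof.
move=> rp; apply/asboolP; exists [:: (1, r)]; rewrite big_seq1 mul1r; split=> //.
by move=> x; rewrite inE => /eqP->.
Qed.

Lemma extIS (p q : {pred R}) : {subset p <= q} -> {subset extI p <= extI q}.
Proof. by move=> pq y /asboolP[s [sp ->]]; apply/asboolP; exists s; split=> // x /sp /pq. Qed.

Lemma extI_act p g y : g \in G -> y \in extI p -> act g y \in extI p.
Proof.
move=> gG /asboolP[s [sp ->]]; apply/asboolP; exists [seq (act g u.1, u.2) | u <- s]; split.
  by move=> u /mapP[w /sp wp ->].
rewrite rmorph_sum big_map; apply: eq_bigr => u _.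
by rewrite rmorphM /= (inv_valP u.2 gG).
Qed.

(* For [y = sum c_k r_k], expand [y ^ #|G| = prod_g (sum_k (g c_k) r_k)] as a
   polynomial in the [r_k]; its coefficients are invariant. *)
Lemma extI_contract p (x : R) : ideal p -> inv_val x \in extI p -> x ^+ #|G| \in p.
Proof.
move=> hp /asboolP[s [sp xE]]; pose m := size s.
pose c (l : 'I_m) : S := (tnth (in_tuple s) l).1.
pose r (l : 'I_m) : R := (tnth (in_tuple s) l).2.
have rp l : r l \in p by apply: sp; apply: mem_tnth.
have {}xE : inv_val x = \sum_l c l * inv_val (r l) by rewrite xE big_tnth.
pose Q : {mpoly S[m]} := \prod_(g in G) \sum_l (act g (c l))%:MP * 'X_l.
have Qinv w : Q@_w \in invariants rG.
  apply/invP => h hG; rewrite -[LHS]mcoeff_map_mpoly.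
  suff -> : map_mpoly (act h) Q = Q by [].
  rewrite /Q rmorph_prod [RHS](reindex_inj (mulgI h)) /=.
  apply: eq_big => g; first by rewrite (groupMl _ hG).
  move=> gG; rewrite rmorph_sum; apply: eq_bigr => l _ /=.
  by rewrite rmorphM /= map_mpolyC map_mpolyX actM.
have Qhom : Q \is #|G|.-homog.
  have -> : #|G| = (\sum_(g in G) 1)%N by rewrite sum1_card.
  apply: (big_ind2 (fun (q : {mpoly S[m]}) d => q \is d.-homog)) => [|q d q' d'|g _].
  - exact: dhomog1.
  - exact: dhomogM.
  apply: rpred_sum => l _; rewrite mul_mpolyC; apply: rpredZ.
  by rewrite dhomogX; apply/eqP; exact: mdeg1.
have xQ : inv_val x ^+ #|G| = Q.@[fun l => inv_val (r l)].
  rewrite /Q rmorph_prod /= -prodr_const; apply: eq_bigr => g gG.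
  rewrite -(inv_valP x gG) xE !rmorph_sum; apply: eq_bigr => l _ /=.
  by rewrite !rmorphM /= mevalC mevalXU (inv_valP (r l) gG).
have -> : x ^+ #|G| = \sum_(w <- msupp Q) Invariant (Qinv w) * \prod_l r l ^+ w l.
  apply: inv_val_inj; rewrite rmorphXn xQ mevalE rmorph_sum; apply: eq_bigr => w _ /=.
  congr (_ * _); rewrite rmorph_prod; apply: eq_bigr => l _.
  by rewrite rmorphXn.
rewrite big_seq; apply: (ideal_sum hp) => w wQ; apply: (idealM hp).
have wd : mdeg w = #|G| by move/dhomogP: Qhom => /(_ w wQ).
have [l wl] : exists l, w l != 0%N.
  apply/existsP; rewrite -negb_forall; apply/negP => /forallP w0.
  have := cardG_gt0 G; rewrite -wd mdegE big1 // => l _; exact/eqP/w0.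
rewrite (bigD1 l) //=; apply: (idealMr hp); apply: (@ideal_expW _ _ hp _ 1%N); last by rewrite expr1.
by rewrite lt0n.
Qed.

Lemma prime_ideal_ideal (A : comNzRingType) (p : {pred A}) : prime_ideal p -> ideal p.
Proof. by move=> [[p0 _ pM] _]; split=> // a x y; apply: pM. Qed.

Lemma prime_idealX (A : comNzRingType) (p : {pred A}) x m : prime_ideal p -> x ^+ m \in p -> x \in p.
Proof.
move=> [[p0 p1 pM] pp]; elim: m => [|m IH]; first by rewrite expr0 (negbTE p1).
by rewrite exprS => /pp /orP[|/IH].
Qed.

Lemma prime_idealM (A : comNzRingType) (p : {pred A}) x y : prime_ideal p ->
  x \notin p -> x * y \in p -> y \in p.
Proof. by move=> [_ pp] xp /pp; rewrite (negbTE xp). Qed.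

(** Compare the coefficients in the identity between the orbit polynomial of [r z] at [r X] and
    [r ^ #|G|] times that of [z]. *)
Lemma chi_coefZ (r : R) z j :
  r ^+ j * chi_coef (inv_val r * z) j = r ^+ #|G| * chi_coef z j.
Proof.
apply: inv_val_inj; rewrite !rmorphM !rmorphXn /=; set rr := inv_val r.
have E : chi (rr * z) \Po (rr *: 'X) = rr ^+ #|G| *: chi z.
  rewrite /chi rmorph_prod /= -prodr_const -scaler_prod; apply: eq_bigr => g gG.
  rewrite rmorphB /= comp_polyX comp_polyC rmorphM /= (inv_valP r gG) scalerBr.
  by rewrite polyCM mul_polyC.
by have := congr1 (fun q : {poly S} => q`_j) E; rewrite coefZ coef_comp_scaleX.
Qed.

(** The lower coefficients of the orbit polynomial of an element of [p S] lie in [p]. By [chi_coefZ]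
    and primality this passes from [t w] to [w], for [t] and [w] powers of [r] and [z]; the integral
    equation then puts a power of [w] in [p S]. *)
Lemma rad_cancel p (r : R) z : prime_ideal p -> r \notin p ->
  inrad (extI p) (inv_val r * z) -> inrad (extI p) z.
Proof.
move=> pp rp [N]; rewrite exprMn; set w := z ^+ N => rw.
have hp := prime_ideal_ideal pp; have hS := extI_ideal p.
pose t := r ^+ N; have tp : t \notin p by apply: contra_notN (negP rp) => /prime_idealX; apply.
have tw : inv_val t * w \in extI p by rewrite rmorphXn.
have Hc j : (j < #|G|)%N -> chi_coef w j \in p.
  move=> jG; have cp : chi_coef (inv_val t * w) j \in p.
    apply: (prime_idealX (m := #|G|) pp); apply: (extI_contract hp).
    have := @ipoly_prod _ _ hS gT (mem G) (fun g => act g (inv_val t * w)) (fun g gG => extI_act gG tw) j.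
    by rewrite sum1_card coefB coefXn (ltn_eqF jG) subr0.
  have : t ^+ #|G| * chi_coef w j \in p by rewrite -chi_coefZ; apply: (idealM hp).
  by apply: prime_idealM => //; apply: contra_notN (negP tp) => /prime_idealX; apply.
exists (N * #|G|)%N; rewrite exprM -/w chi_root_sum; apply: (idealN hS); apply: (ideal_sum hS) => j _.
by apply: (idealMr hS); apply: extI_in; apply: Hc.
Qed.

End InvariantIdeals.

(** * Regular sequences and chains of primes *)

Definition acc_ring (A : comNzRingType) := forall I : nat -> {pred A}, (forall m, ideal (I m)) ->
  (forall m, {subset I m <= I m.+1}) ->
  exists N, forall m, (N <= m)%N -> {subset I m <= I N}.

Section Acc.
Variables (A : comNzRingType) (accA : acc_ring A).
Implicit Types (I J P : {pred A}) (x y m r : A).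

(** Otherwise choice builds an infinite strictly increasing chain. *)
Lemma acc_max (Phi : {pred A} -> Prop) I0 : Phi I0 -> (forall I, Phi I -> ideal I) ->
  exists2 I, Phi I & forall J, Phi J -> {subset I <= J} -> {subset J <= I}.
Proof.
move=> H0 Hid; case: (pselect (exists2 I, Phi I & forall J, Phi J -> {subset I <= J} -> {subset J <= I})) => // nmax.
have next (I : {I | Phi I}) : exists J : {J | Phi J}, {subset sval I <= sval J} /\ ~ {subset sval J <= sval I}.
  case: (pselect (exists J : {J | Phi J}, {subset sval I <= sval J} /\ ~ {subset sval J <= sval I})) => // nJ.
  case: nmax; exists (sval I) => [|J PJ IJ]; first exact: (svalP I).
  case: (pselect {subset J <= sval I}) => // nJI; case: nJ.
  by exists (exist _ J PJ).
have [nx Hnx] := choice next.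
pose W k := iter k nx (exist _ I0 H0).
have [|k|N HN] := accA (I := fun k => sval (W k)).
- by move=> k; apply: Hid; apply: (svalP (W k)).
- exact: (Hnx (W k)).1.
by case: (Hnx (W N)) => _ []; apply: (HN N.+1).
Qed.

Lemma adjoin1_ideal I r : ideal I -> ideal (addmul (M := A^o) I r).
Proof. by move=> hI; apply: (addmul_submod r hI). Qed.

Lemma addmul_gen I r : ideal I -> r \in addmul (M := A^o) I r.
Proof. by move=> hI; apply/asboolP; exists 0, 1; rewrite add0r /GRing.scale /= mulr1 (ideal0 hI). Qed.

(** An ideal maximal among those containing [I] and avoiding [U] is prime. *)
Lemma exists_prime I (U : {pred A}) : ideal I -> 1 \in U ->
  (forall x y, x \in U -> y \in U -> x * y \in U) -> (forall x, x \in I -> x \notin U) ->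
  exists p, [/\ prime_ideal p, {subset I <= p} & forall x, x \in p -> x \notin U].
Proof.
move=> hI U1 UM IU.
pose Phi J := [/\ ideal J, {subset I <= J} & forall x, x \in J -> x \notin U].
have [||p [hp Ip pU] pmax] := @acc_max Phi I; [by split|by move=> J []|].
exists p; split=> //; split.
  split; first exact: ideal0 hp.
    by apply/negP => /pU; rewrite U1.
  by move=> a u v up vp; apply: (idealD hp) => //; apply: (idealM hp).
have big u : u \notin p -> exists s, s \in U /\ s \in addmul (M := A^o) p u.
  move=> up; case: (pselect (exists s, s \in U /\ s \in addmul (M := A^o) p u)) => // nU.
  case/negP: up; apply: (pmax (addmul (M := A^o) p u)); last exact: addmul_gen.
    split; first exact: adjoin1_ideal.
      by move=> x /Ip xp; apply: addmulL.
    by move=> x xJ; apply/negP => xU; apply: nU; exists x.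
  by move=> x xp; apply: addmulL.
move=> u v uv; apply/negPn/negP; rewrite negb_or => /andP[/big[s [sU /asboolP[p1 [a [p1p sE]]]]] /big[t [tU /asboolP[p2 [b [p2p tE]]]]]].
suff : s * t \in p by move=> /pU; rewrite UM.
rewrite sE tE /GRing.scale /= mulrDl !mulrDr; apply: (idealD hp).
  by apply: (idealD hp); [apply: (idealMr hp)|apply: (idealMr hp)].
apply: (idealD hp); first exact: (idealM hp).
by rewrite mulrACA; apply: (idealMr hp).
Qed.

Definition colon I m : {pred A} := fun r => r * m \in I.

Lemma colon_ideal I m : ideal I -> ideal (colon I m).
Proof.
move=> hI; split; first by rewrite unfold_in /colon mul0r (ideal0 hI).
move=> a x y; rewrite !unfold_in /colon => xI yI.
by rewrite mulrDl /GRing.scale /= -mulrA; apply: (idealD hI) => //; apply: (idealM hI).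
Qed.

Section ZeroDivisors.
Variables (I : {pred A}) (hI : ideal I).

(* [colon I m] is a maximal annihilator of elements of [A / I]. *)
Definition maxann m := m \notin I /\
  forall m', m' \notin I -> {subset colon I m <= colon I m'} -> {subset colon I m' <= colon I m}.

Lemma maxann_exists m : m \notin I -> exists m0, maxann m0 /\ {subset colon I m <= colon I m0}.
Proof.
move=> mI; pose Phi J := exists m', [/\ m' \notin I, J = colon I m' & {subset colon I m <= J}].
have [||J [m0 [m0I -> mm0]] Jmax] := @acc_max Phi (colon I m).
- by exists m; split.
- by move=> J [m' [_ -> _]]; apply: colon_ideal.
exists m0; split=> //; split=> // m' m'I m0m'; apply: Jmax => //.
by exists m'; split=> // x /mm0 /m0m'.
Qed.

(** If [r * m] is outside [I], its annihilator contains that of [m], hence equals it by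
    maximality. *)
Lemma maxann_prime m r s : maxann m -> r * s \in colon I m -> r \notin colon I m -> s \in colon I m.
Proof.
move=> [mI mmax] rs rm; apply: (mmax (r * m)).
- exact: rm.
- by move=> x; rewrite !unfold_in /colon => xm; rewrite mulrCA; apply: (idealM hI).
- by move: rs; rewrite !unfold_in /colon mulrA [s * r]mulrC.
Qed.

Lemma maxann_prod m T (l : seq T) (s : T -> A) : maxann m ->
  (forall t, s t \notin colon I m) -> \prod_(t <- l) s t \notin colon I m.
Proof.
move=> mm sm; elim: l => [|t l IH].
  by rewrite big_nil unfold_in /colon mul1r; case: mm.
by rewrite big_cons; apply/negP => /(maxann_prime mm) /(_ (sm t)); apply/negP.
Qed.

Lemma adjoin_colon K l m r : m \in adjoin (M := A^o) K l ->
  {subset K <= colon I r} -> (forall t, t \in l -> r * t \in I) -> r * m \in I.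
Proof.
elim: l K => [|t l IH] K /= mK KI rl; first by have := KI m mK; rewrite unfold_in /colon mulrC.
apply: (IH _ mK) => [x /asboolP[u [y [uK ->]]]|s sl]; last by apply: rl; rewrite inE sl orbT.
rewrite unfold_in /colon mulrDl; apply: (idealD hI); first exact: KI.
have rt : r * t \in I by apply: rl; rewrite inE eqxx.
by rewrite /GRing.scale /= mulrAC mulrC [t * r]mulrC; apply: (idealM hI).
Qed.

Lemma adjoin_gen K l t : ideal K -> t \in l -> t \in adjoin (M := A^o) K l.
Proof.
elim: l K => //= s l IH K hK; rewrite inE => /orP[/eqP<-|tl]; last first.
  by apply: IH => //; apply: adjoin1_ideal.
have : t \in addmul (M := A^o) K t by apply: addmul_gen.
move: (addmul _ _) => K'; elim: l K' {IH} => //= u l IH K' tK'; apply: IH.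
exact: addmulL.
Qed.

Lemma adjoin_base K l : {subset K <= adjoin (M := A^o) K l}.
Proof. by elim: l K => [|t l IH] K x xK //=; apply: IH; apply: addmulL. Qed.

(** Let [l] generate, together with [I], all such elements. If no annihilator from [l] contained
    that of [m], a product of elements killing the members of [l] would kill [m], against
    primality. *)
Lemma finite_maxann : exists l : seq A, (forall m, m \in l -> maxann m) /\
  forall m, maxann m -> exists2 m', m' \in l & {subset colon I m <= colon I m'}.
Proof.
pose Phi J := exists l : seq A, (forall m, m \in l -> maxann m) /\ J = adjoin (M := A^o) I l.
have [||J [l [lmax ->]] Jmax] := @acc_max Phi I.
- by exists [::].
- by move=> J [l [_ ->]]; apply: adjoin_submod.
exists l; split=> // m mm.
have ml : m \in adjoin (M := A^o) I l.
  apply: (Jmax (adjoin (M := A^o) I (rcons l m))).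
  - exists (rcons l m); split=> // x; rewrite mem_rcons inE => /orP[/eqP->//|]; exact: lmax.
  - by move=> x xl; rewrite /adjoin foldl_rcons; apply: addmulL.
  - by apply: adjoin_gen => //; rewrite mem_rcons inE eqxx.
case: (pselect (exists2 m', m' \in l & {subset colon I m <= colon I m'})) => // nm.
have Hs t : exists s, s \notin colon I m /\ (t \in l -> s * t \in I).
  case: (boolP (t \in l)) => [tl|_]; last first.
    by exists 1; split=> //; rewrite unfold_in /colon mul1r; case: mm.
  case: (pselect (exists2 s, s \in colon I t & s \notin colon I m)) => [[s st sm]|ns]; first by exists s; split.
  case: nm; exists t => //; have [_ tmax] := lmax t tl; apply: tmax; first by case: mm.
  by move=> s st; apply/negPn/negP => sm; apply: ns; exists s.
have [s /all_and2[sm st]] := choice Hs.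
have /negP := maxann_prod l mm sm; case.
rewrite unfold_in /colon; apply: (adjoin_colon ml).
  by move=> x xI; rewrite unfold_in /colon; apply: (idealMr hI).
move=> t tl; rewrite (big_rem t) //= mulrAC; apply: (idealMr hI); exact: st.
Qed.

(** Prime avoidance: if the [x] found for the tail lies in the prime of [m0], add to it [y] times
    elements [z t] lying in the primes of the tail but not in that of [m0]. *)
Lemma avoid_maxann (a : {pred A}) (l : seq A) : ideal a -> (forall m, m \in l -> maxann m) ->
  (forall m, m \in l -> exists2 r, r \in a & r \notin colon I m) ->
  exists2 r, r \in a & forall m, m \in l -> r \notin colon I m.
Proof.
move=> ha; elim: l => [|m0 l IH] lmax la; first by exists 0; rewrite // (ideal0 ha).
have [||x xa xl] := IH.
- by move=> m ml; apply: lmax; rewrite inE ml orbT.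
- by move=> m ml; apply: la; rewrite inE ml orbT.
have [xm0|xm0] := boolP (x \in colon I m0); last first.
  by exists x => // m; rewrite inE => /orP[/eqP->|/xl].
have mm0 : maxann m0 by apply: lmax; rewrite inE eqxx.
have [y ya ym0] : exists2 r, r \in a & r \notin colon I m0 by apply: la; rewrite inE eqxx.
have Hz t : exists z, z \notin colon I m0 /\ (t \in l -> z * t \in I).
  case: (boolP (t \in l)) => [tl|_]; last first.
    by exists 1; split=> //; rewrite unfold_in /colon mul1r; case: mm0.
  case: (pselect (exists2 z, z \in colon I t & z \notin colon I m0)) => [[z zt zm]|nz]; first by exists z; split.
  (* Otherwise the primes of [t] and [m0] coincide by maximality, yet [x] lies in only one of
     them. *)
  have /negP := xl t tl; case; have [tI tmax] : maxann t by apply: lmax; rewrite inE tl orbT.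
  apply: (tmax m0) => //; first by case: mm0.
  by move=> z zt; apply/negPn/negP => zm; apply: nz; exists z.
have [z /all_and2[zm zt]] := choice Hz.
exists (x + y * \prod_(t <- l) z t).
  by apply: (idealD ha) => //; apply: (idealMr ha).
have hc m := colon_ideal m hI.
move=> m; rewrite inE => /orP[/eqP->|ml]; apply/negP => H.
  have : y * \prod_(t <- l) z t \in colon I m0 by rewrite -[_ * _](addKr x) addrC; apply: (idealB (hc m0)).
  by move=> /(maxann_prime mm0) /(_ ym0); apply/negP; apply: maxann_prod.
have /negP := xl m ml; case; rewrite -[x](addrK (y * \prod_(t <- l) z t)).
apply: (idealB (hc m)) => //; apply: (idealM (hc m)).
by rewrite (big_rem m) //=; apply: (idealMr (hc m)); apply: zt.
Qed.

(** Zero divisors modulo [I] lie in finitely many maximal annihilators, and an ideal inside none of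
    these has an element outside all of them. *)
Lemma regular_or_annihilated (a : {pred A}) : ideal a ->
  (exists2 r, r \in a & regular_mod (M := A^o) I r) \/
  (exists2 x, x \notin I & forall r, r \in a -> r * x \in I).
Proof.
move=> ha; have [l [lmax lall]] := finite_maxann.
case: (pselect (exists2 m, m \in l & forall r, r \in a -> r * m \in I)) => [[m ml H]|nm].
  by right; exists m => //; case: (lmax m ml).
left; have [|r ra rl] := avoid_maxann ha lmax.
  move=> m ml; case: (pselect (exists2 r, r \in a & r \notin colon I m)) => // nr.
  case: nm; exists m => // r ra; apply/negPn/negP => rm; apply: nr; by exists r.
exists r => // x rx; apply/negPn/negP => xI.
have [m0 [mm0 xm0]] := maxann_exists xI.
have [m' m'l m0m'] := lall m0 mm0.
by have /negP := rl m' m'l; apply; apply: m0m'; apply: xm0.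
Qed.

End ZeroDivisors.

Lemma in_comb_ideal k (f : 'I_k -> A) : ideal (fun r => `[< in_comb f r >]).
Proof.
split; first by apply/asboolP; exists (fun _ => 0); rewrite big1 // => j _; rewrite mul0r.
move=> a x y /asboolP[c ->] /asboolP[d ->]; apply/asboolP; exists (fun j => a * c j + d j).
rewrite /GRing.scale /= mulr_sumr -big_split; apply: eq_bigr => j _ /=.
by rewrite mulrDl mulrA.
Qed.

Lemma in_comb_gen k (f : 'I_k -> A) j : in_comb f (f j).
Proof.
exists (fun l => (l == j)%:R); rewrite (bigD1 j) //= eqxx mul1r big1 ?addr0 // => l /negbTE->.
by rewrite mul0r.
Qed.

(** Vanishing of [H^0(A / I)] excludes a nonzero element killed by all generators, so their ideal
    contains a regular element; the quotient by it lowers [c] by one. *)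
Lemma exists_regular_seq k (f : 'I_k -> A) c I : ideal I ->
  (forall i, (i < c)%N -> rvan (M := A^o) f i I) ->
  exists rs, [/\ size rs = c, regular_seq (M := A^o) I rs & forall r, r \in rs -> in_comb f r].
Proof.
elim: c I => [|c IH] I hI H; first by exists [::].
have [[r /asboolP rf rI]|[x xI xf]] := regular_or_annihilated hI (in_comb_ideal f); last first.
  case/negP: xI; apply: (rvan0_torsion hI (H 0%N (ltn0Sn _))) => j; exists 1%N.
  by rewrite expr1; apply: xf; apply/asboolP; apply: in_comb_gen.
have [|i ic|rs [rsc rsr rsf]] := IH (addmul (M := A^o) I r).
- exact: adjoin1_ideal.
- by apply: rvan_addmul => //; apply: H; rewrite // ltnW.
exists (r :: rs); split=> //=; first by rewrite rsc.
by move=> s; rewrite inE => /orP[/eqP->|/rsf].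
Qed.

Lemma regular_seq_rcons I rs r : regular_seq (M := A^o) I (rcons rs r) <->
  regular_seq (M := A^o) I rs /\ regular_mod (M := A^o) (adjoin (M := A^o) I rs) r.
Proof.
elim: rs I => [|s rs IH] I /=; first by split=> [[]|[]].
by rewrite IH; split=> [[? []]|[[]]].
Qed.

Lemma adjoin_sub I rs p : {subset I <= p} -> ideal p -> {subset rs <= p} ->
  {subset adjoin (M := A^o) I rs <= p}.
Proof.
elim: rs I => //= r rs IH I Ip hp rsp; apply: IH => //; last first.
  by move=> s srs; apply: rsp; rewrite inE srs orbT.
move=> x /asboolP[u [y [/Ip up ->]]]; apply: (idealD hp) => //; apply: (idealMr hp).
by apply: rsp; rewrite inE eqxx.
Qed.

(* If [s r ^ k] lies in [adjoin I rs] then so does [s], hence a prime containing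
   [adjoin I rs] and avoiding the [s r ^ k] with [s \notin p] lies strictly below [p]. *)
Lemma regular_seq_chain I rs p : ideal I -> regular_seq (M := A^o) I rs ->
  prime_ideal p -> {subset I <= p} -> {subset rs <= p} -> prime_chain p (size rs).
Proof.
move=> hI; elim/last_ind: rs p => [|rs r IH] p.
  by move=> _ pp _ _; exists (fun _ => p).
move=> /regular_seq_rcons[rsr rr] pp Ip rsp.
have hp := prime_ideal_ideal pp; have [[_ p1 _] ppr] := pp.
pose J := adjoin (M := A^o) I rs.
have hJ : ideal J by apply: adjoin_submod.
have Jp : {subset J <= p}.
  by apply: adjoin_sub => // s srs; apply: rsp; rewrite mem_rcons inE srs orbT.
pose U : {pred A} := fun x => `[< exists s (m : nat), s \notin p /\ x = s * r ^+ m >].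
have [||x xJ|p' [pp' Jp' p'U]] := @exists_prime J U hJ.
- by apply/asboolP; exists 1, 0%N; rewrite mulr1.
- move=> x y /asboolP[s [m [sp ->]]] /asboolP[t [m' [tp ->]]]; apply/asboolP.
  exists (s * t), (m + m')%N; rewrite exprD mulrACA; split=> //.
  by apply/negP => /ppr; rewrite (negbTE sp) (negbTE tp).
- apply/negP => /asboolP[s [m [sp xE]]]; case/negP: sp; apply: Jp; rewrite xE in xJ.
  elim: m xJ {xE} => [|m IHm]; first by rewrite mulr1.
  by rewrite exprSr mulrA => sJ; apply: IHm; apply: rr; rewrite /GRing.scale /= mulrC.
have p'p : {subset p' <= p}.
  move=> x xp'; apply/negPn/negP => xp; have /negP := p'U x xp'; apply.
  by apply/asboolP; exists x, 0%N; rewrite mulr1.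
have rp' : r \notin p'.
  apply/negP => /p'U /negP; apply; apply/asboolP; exists 1, 1%N; rewrite mul1r expr1.
  by split.
have [||q [qp ql qlt]] := IH p' rsr pp'.
- by move=> x xI; apply: Jp'; apply: adjoin_base.
- by move=> s srs; apply: Jp'; apply: adjoin_gen.
exists (fun j => if (j <= size rs)%N then q j else p); rewrite size_rcons; split.
- by move=> j _; case: leqP => // jr; apply: qp.
- by rewrite ltnn.
move=> j; rewrite ltnS leq_eqVlt => /orP[/eqP->|jr] /=; last first.
  by rewrite jr orbT; apply: qlt.
rewrite eqxx ltnn /=; split=> [x|H]; first by rewrite ql; apply: p'p.
case/negP: rp'; rewrite -ql; apply: H; apply: rsp; by rewrite mem_rcons inE eqxx.
Qed.

End Acc.

(** * The invariant ring is Noetherian *)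

Section NoetherianInvariants.
Variables (F : fieldType) (gT : finGroupType) (G : {group gT}) (n : nat).
Variable rG : mx_representation F G n.
Local Notation S := {mpoly F[n]}.
Local Notation R := (invariant_ring rG).

Definition constP : {pred S} := fun x => `[< exists c, x = c%:MP >].

Lemma constP_sub_ring : sub_ring constP.
Proof.
split; first by apply/asboolP; exists 1; rewrite mpolyC1.
  by move=> x y /asboolP[c ->] /asboolP[d ->]; apply/asboolP; exists (c - d); rewrite mpolyCB.
by move=> x y /asboolP[c ->] /asboolP[d ->]; apply/asboolP; exists (c * d); rewrite mpolyCM.
Qed.

Lemma accB_constP : accB constP constP.
Proof.
move=> W hW WX Wm; case: (pselect (exists N x, x != 0 /\ x \in W N)) => [[N [x [x0 xW]]]|nW].
  exists N => m _ y /WX /asboolP[d ->]; have /asboolP[c cE] := WX N x xW.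
  have c0 : c != 0 by apply: contraNneq x0 => c0; rewrite cE c0 mpolyC0.
  have [_ _ WM] := hW N.
  have -> : d%:MP = (d / c)%:MP * x by rewrite cE -mpolyCM divfK.
  by apply: WM => //; apply/asboolP; exists (d / c).
exists 0%N => m _ x xW; have [-> |x0] := eqVneq x 0; first by case: (hW 0%N).
by case: nW; exists m, x.
Qed.

Definition chi_gens : seq S :=
  [seq (chi rG 'X_(p.1))`_(p.2 : nat) | p : 'I_n * 'I_#|G|].

(** Noether's argument: over the algebra generated by the coefficients of the orbit polynomials of
    the variables, [S] is a finite module. *)
Definition coef_ring : {pred S} := adjs constP chi_gens.

Lemma coef_ring_sub_ring : sub_ring coef_ring.
Proof. exact: adjs_sub_ring constP_sub_ring. Qed.

Lemma coef_ring_const c : c%:MP \in coef_ring.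
Proof.
rewrite /coef_ring; elim: chi_gens => [|d l IH] /=; first by apply/asboolP; exists c.
by apply: adjS => //; exact: adjs_sub_ring constP_sub_ring.
Qed.

Lemma coef_ring_gen i (j : 'I_#|G|) : (chi rG 'X_i)`_j \in coef_ring.
Proof.
apply: adjs_gen; first exact: constP_sub_ring.
by apply/mapP; exists (i, j); rewrite ?mem_enum.
Qed.

Lemma coef_ring_inv : {subset coef_ring <= invariants rG}.
Proof.
apply: adjs_min => [|x /asboolP[c ->]|x /mapP[p _ ->]].
- split=> [|x y /invP xG /invP yG|x y /invP xG /invP yG]; apply/invP => g gG.
  + exact: rmorph1.
  + by rewrite rmorphB /= xG ?yG.
  + by rewrite rmorphM /= xG ?yG.
- by apply/invP => g _; rewrite actC.
- exact: chi_inv.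
Qed.

Definition small_monomials : seq S :=
  [seq 'X_[ [multinom (phi i : nat) | i < n] ] | phi : {ffun 'I_n -> 'I_#|G|}].

(** An exponent at least [#|G|] is lowered by the integral equation of its variable, and the total
    degree decreases. *)
Lemma monomial_span (m : 'X_{1..n}) : 'X_[m] \in spanB coef_ring small_monomials.
Proof.
have hS := spanB_bsub small_monomials coef_ring_sub_ring.
move: {2}(mdeg m) (leqnn (mdeg m)) => d; elim: d m => [|d IH] m md.
all: case: (pselect (exists i, (#|G| <= m i)%N)) => [[i mi]|nm]; last first.
1,3: have mG i : (m i < #|G|)%N by rewrite ltnNge; apply/negP => mi; apply: nm; exists i.
1,2: apply: spanB_gen coef_ring_sub_ring _; apply/mapP; exists [ffun i => Ordinal (mG i)]; rewrite ?mem_enum //.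
1,2: by congr 'X_[_]; apply/mnmP => i; rewrite mnmE ffunE.
  have := cardG_gt0 G; have : (m i <= mdeg m)%N by rewrite mdegE (bigD1 i) //= leq_addr.
  by move: md mi; lia.
pose m' := (m - U_(i) *+ #|G|)%MM.
have mE : m = (m' + U_(i) *+ #|G|)%MM.
  apply/mnmP => j; rewrite mnmDE mnmBE mulmnE mnm1E; case: eqP => [<-|_].
    by rewrite mul1n subnK.
  by rewrite mul0n subn0 addn0.
rewrite {1}mE mpolyXD -mpolyXn (chi_root_sum rG) mulrN.
have [h0 hB hM] := hS; rewrite -[- _]sub0r; apply: hB => //; rewrite mulr_sumr.
apply: (bsub_sum _ hS) => j _; rewrite mulrCA; apply: hM; first exact: coef_ring_gen.
rewrite mpolyXn -mpolyXD; apply: IH; rewrite mdegD mdegMn mdeg1 mul1n.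
by move: md; rewrite {1}mE mdegD mdegMn mdeg1 mul1n; have := ltn_ord j; lia.
Qed.

Lemma mpoly_span (p : S) : p \in spanB coef_ring small_monomials.
Proof.
have hS := spanB_bsub small_monomials coef_ring_sub_ring.
rewrite (mpolyE p); apply: (bsub_sum _ hS) => m _; rewrite -mul_mpolyC.
have [_ _ hM] := hS; apply: hM; [exact: coef_ring_const | exact: monomial_span].
Qed.

Lemma accB_mpoly : accB coef_ring (spanB coef_ring small_monomials).
Proof.
apply: accB_span; first exact: coef_ring_sub_ring.
apply: accB_adjs; [exact: constP_sub_ring | exact: accB_constP].
Qed.

Lemma acc_mpoly : acc_ring S.
Proof.
move=> I hI Im; apply: accB_mpoly => // m; last by move=> p _; apply: mpoly_span.
split; [exact: ideal0 (hI m)|by move=> x y; apply: (idealB (hI m))|].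
by move=> b x _; apply: (idealM (hI m)).
Qed.

(** Ideals of [R] are [coef_ring]-submodules of [S], where chains stabilize. *)
Lemma acc_invariants : acc_ring R.
Proof.
move=> I hI Im; pose W m : {pred S} := fun y => `[< exists2 r, r \in I m & y = inv_val r >].
have WP m (r : R) : (inv_val r \in W m) = (r \in I m).
  by apply/asboolP/idP => [[s sI /inv_val_inj ->]|]; [|exists r].
have [|m p _|m y /asboolP[r rI ->]|N HN] := accB_mpoly (W := W).
- move=> m; split; first by rewrite -(rmorph0 (@inv_val F gT G n rG)) WP (ideal0 (hI m)).
    by move=> x y /asboolP[r rI ->] /asboolP[s sI ->]; rewrite -rmorphB WP (idealB (hI m)).
  move=> b x bB /asboolP[r rI ->]; have bG := coef_ring_inv bB.
  by rewrite -[b]/(inv_val (Invariant bG)) -rmorphM WP (idealM (hI m)).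
- exact: mpoly_span.
- by rewrite WP Im.
by exists N => m Nm r; rewrite -!WP; apply: HN.
Qed.

End NoetherianInvariants.

(** * Bounding chains of primes by counting polynomials *)

Section Dimension.
Variables (F : fieldType) (gT : finGroupType) (G : {group gT}) (n : nat).
Variable rG : mx_representation F G n.
Local Notation S := {mpoly F[n]}.
Local Notation R := (invariant_ring rG).

Definition indep_mod (Z : S -> Prop) (T : finType) (w : T -> S) :=
  forall c : T -> F, Z (\sum_i c i *: w i) -> forall i, c i = 0.

(** There are [D ^ n] monomials with all exponents below [D]; with more polynomials the coefficient
    matrix has a nonzero left kernel. *)
Lemma indep_card (T : finType) (w : T -> S) D :
  indep_mod (fun x => x = 0) w -> (forall i, (msize (w i) <= D)%N) -> (#|T| <= D ^ n)%N.
Proof.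
move=> wi wD.
have <- : #|{ffun 'I_n -> 'I_D}| = (D ^ n)%N by rewrite card_ffun !card_ord.
pose mon (phi : {ffun 'I_n -> 'I_D}) := [multinom (phi i : nat) | i < n].
pose M : 'M[F]_(#|T|, #|{ffun 'I_n -> 'I_D}|) :=
  \matrix_(i, j) (w (enum_val i))@_(mon (enum_val j)).
rewrite leqNgt; apply/negP => lt.
have kM : kermx M != 0.
  rewrite kermx_eq0 /row_free; apply/negP => /eqP E.
  by move: lt; rewrite -E ltnNge rank_leq_col.
have /rowV0Pn[u /sub_kermxP uM u0] := kM.
case/negP: u0; apply/eqP/rowP => i; rewrite mxE.
have := wi (fun t => u 0 (enum_rank t)) _ (enum_val i); rewrite enum_valK; apply.
apply/mpolyP => m; rewrite mcoeff0 raddf_sum /=.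
have [mD|/forallPn[j]] := boolP [forall j, (m j < D)%N]; last first.
  rewrite -leqNgt => Dm; rewrite big1 // => t _; rewrite mcoeffZ memN_msupp_eq0 ?mulr0 //.
  apply: msize_mdeg_ge; apply: leq_trans (wD t) (leq_trans Dm _).
  by rewrite mdegE (bigD1 j) //= leq_addr.
pose phi := [ffun j => Ordinal (forallP mD j)].
have mE : m = mon phi by apply/mnmP => j; rewrite mnmE ffunE.
transitivity ((u *m M) 0 (enum_rank phi)); last by rewrite uM mxE.
rewrite [RHS]mxE.
rewrite [LHS](reindex (fun i : 'I_#|T| => enum_val i)) /=; last first.
  by exists enum_rank => t _; rewrite ?enum_valK ?enum_rankK.
apply: eq_bigr => t _; rewrite mcoeffZ mxE enum_valK enum_rankK; congr (_ * _).
by rewrite mE.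
Qed.

Local Notation Z p := (inrad (@extI F gT G n rG p)).

(** In a relation [sum_b v_b r ^ b], reduction modulo [p] leaves [v_0], whose coefficients must
    vanish; [rad_cancel] then divides the rest by [r] modulo [p'], and one repeats. *)
Lemma indep_power (p p' : {pred R}) (r : R) (T : finType) (w : T -> S) m :
  prime_ideal p' -> {subset p' <= p} -> r \in p -> r \notin p' -> indep_mod (Z p) w ->
  indep_mod (Z p') (fun x : T * 'I_m => w x.1 * inv_val r ^+ x.2).
Proof.
move=> pp' p'p rp rp' wi.
have hp := extI_ideal p; have hp' := extI_ideal p'.
have H : forall c : T -> nat -> F,
    Z p' (\sum_(b < m) (\sum_i c i b *: w i) * inv_val r ^+ b) ->
    forall i b, (b < m)%N -> c i b = 0.
  elim: m => [|m IH] c //.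
  rewrite big_ord_recl expr0 mulr1; set v0 := \sum_i _.
  pose y := \sum_(b < m) (\sum_i c i b.+1 *: w i) * inv_val r ^+ b.
  have -> : \sum_(i < m) (\sum_(i0 : T) c i0 (lift ord0 i) *: w i0) * inv_val r ^+ lift ord0 i = inv_val r * y.
    by rewrite mulr_sumr; apply: eq_bigr => b _; rewrite /= /bump /= add1n exprS mulrCA.
  move=> Zy; have c0 : forall i, c i 0%N = 0.
    apply: wi; rewrite -/v0 -[v0](addrK (inv_val r * y)); apply: (inradB hp).
      by case: Zy => N yN; exists N; apply: extIS yN.
    rewrite mulrC; apply: (inradM hp); apply: inrad_in; exact: extI_in.
  have v00 : v0 = 0 by rewrite /v0 big1 // => i _; rewrite c0 scale0r.
  rewrite v00 add0r in Zy; have {}Zy := rad_cancel pp' rp' Zy.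
  by move=> i [_|b bm]; [exact: c0 | apply: (IH (fun i b => c i b.+1))].
move=> c Zc; suff H' i (b : 'I_m) : c (i, b) = 0 by case.
case: m c Zc b H => [|m] c Zc b H; first by case: b.
have := H (fun i b => c (i, inord b)) _ i b (ltn_ord b); rewrite inord_val; apply.
move: Zc; congr (inrad _ _).
rewrite (eq_bigr (fun x : T * 'I_m.+1 => (fun i b => c (i, b) *: (w i * inv_val r ^+ b)) x.1 x.2)); last by case.
rewrite -(pair_bigA _ (fun i (b : 'I_m.+1) => c (i, b) *: (w i * inv_val r ^+ b))) exchange_big /=.
apply: eq_bigr => j _; rewrite mulr_suml; apply: eq_bigr => t _.
by rewrite inord_val scalerAl.
Qed.

Lemma msizeM_leq (p q : S) : (msize (p * q) <= (msize p + msize q).-1)%N.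
Proof.
have [->|p0] := eqVneq p 0; first by rewrite mul0r msize0.
have [->|q0] := eqVneq q 0; first by rewrite mulr0 msize0.
by rewrite msizeM.
Qed.

Lemma msize_exp (p : S) b : (msize (p ^+ b) <= (b * msize p).+1)%N.
Proof.
elim: b => [|b IH]; first by rewrite expr0 msize1.
rewrite exprS; apply: leq_trans (msizeM_leq _ _) _; rewrite mulSn; lia.
Qed.

(* Every proper inclusion of primes multiplies the number of independent
   elements of bounded degree by [m]. *)
Lemma chain_indep (p : {pred R}) l : prime_chain p l -> exists C,
  forall (T : finType) (w : T -> S) m D, indep_mod (Z p) w -> (forall i, (msize (w i) <= D)%N) ->
  exists (T' : finType) (w' : T' -> S), [/\ #|T'| = (#|T| * m ^ l)%N,
    forall i, (msize (w' i) <= D + C * m)%N & indep_mod (fun x => x = 0) w'].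
Proof.
move=> [q [qp ql qlt]].
have [r Hr] : exists r : nat -> R, forall j, (j < l)%N -> r j \in q j.+1 /\ r j \notin q j.
  suff H : forall j, exists r : R, (j < l)%N -> r \in q j.+1 /\ r \notin q j.
    by have [r Hr] := choice H; exists r.
  move=> j.
  case: (ltnP j l) => [jl|_]; last by exists 0.
  case: (pselect (exists r, r \in q j.+1 /\ r \notin q j)) => [[r ?]|nr]; first by exists r.
  case: (qlt j jl) => _ []; move=> x xq; apply/negPn/negP => xn; apply: nr; by exists x.
(* The constant depends on the chain only and not on [m], which [chain_bound] takes large. *)
exists (\sum_(j < l) msize (inv_val (r j)))%N => T w m D wi wD.
suff H k : (k <= l)%N -> exists (T' : finType) (w' : T' -> S), [/\ #|T'| = (#|T| * m ^ k)%N,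
    forall i, (msize (w' i) <= D + (\sum_(l - k <= j < l) msize (inv_val (r j))) * m)%N & indep_mod (Z (q (l - k)%N)) w'].
  have [T' [w' [cT' sw' iw']]] := H l (leqnn l); rewrite subnn big_mkord in sw' iw'.
  exists T', w'; split=> // c c0; apply: iw'; rewrite c0; exact: inrad0 (extI_ideal _).
elim: k => [_|k IH kl].
  exists T, w; rewrite muln1 subn0 big_geq // mul0n addn0; split=> // c Zc; apply: wi.
  by case: Zc => N cN; exists N; apply: extIS cN => x; rewrite ql.
have [T' [w' [cT' sw' iw']]] := IH (ltnW kl).
set j := (l - k.+1)%N; have jE : (l - k = j.+1)%N by rewrite /j; lia.
have jl : (j < l)%N by rewrite /j; lia.
rewrite jE in sw' iw'; have [rq rnq] := Hr j jl; have [qq _] := qlt j jl.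
exists (T' * 'I_m)%type, (fun x : T' * 'I_m => w' x.1 * inv_val (r j) ^+ x.2); split.
- by rewrite card_prod card_ord cT' expnSr mulnA.
- move=> [i b] /=; rewrite big_ltn // mulnDl.
  apply: leq_trans (msizeM_leq _ _) _.
  have := msize_exp (inv_val (r j)) b; have := sw' i.
  have : (b * msize (inv_val (r j)) <= msize (inv_val (r j)) * m)%N.
    by rewrite mulnC leq_mul2l (ltnW (ltn_ord b)) orbT.
  lia.
- by apply: indep_power iw' => //; apply: qp; rewrite ltnW.
Qed.

Definition only_vars (E : {set 'I_n}) (p : S) :=
  forall m, m \in msupp p -> forall i, i \notin E -> m i = 0%N.

(** The [m ^ #|E|] monomials in [E] with exponents below [m] are independent modulo [q]. The chain
    turns them into [m ^ (#|E| + l)] independent polynomials of size linear in [m], against the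
    bound of [indep_card]. *)
Lemma chain_bound (q : {pred S}) (E : {set 'I_n}) l : prime_ideal q ->
  (forall p, only_vars E p -> p \in q -> p = 0) ->
  prime_chain (fun r : R => inv_val r \in q) l -> (#|E| + l <= n)%N.
Proof.
move=> pq qE ch; have hq := prime_ideal_ideal pq.
have [C HC] := chain_indep ch; rewrite leqNgt; apply/negP => lt.
(* [K * m] bounds the sizes [#|E| * m + 1 + C * m], and [m > K ^ n] makes [m ^ n.+1] exceed
   [(K * m) ^ n]. *)
pose K := (#|E| + 1 + C)%N; pose m := (K ^ n).+1.
pose mon (phi : {ffun 'I_#|E| -> 'I_m}) : 'X_{1..n} :=
  (\sum_(i < #|E|) U_(enum_val i) *+ phi i)%MM.
have monE phi i : mon phi (enum_val i) = phi i.
  rewrite /mon mnm_sumE (bigD1 i) //= mulmnE mnm1E eqxx mul1n big1 ?addn0 // => j ji.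
  by rewrite mulmnE mnm1E (inj_eq enum_val_inj) (negbTE ji).
have mon0 phi i : i \notin E -> mon phi i = 0%N.
  move=> iE; rewrite /mon mnm_sumE big1 // => j _; rewrite mulmnE mnm1E.
  by case: eqP => // ji; case/negP: iE; rewrite -ji; apply: enum_valP.
have mon_inj : injective mon.
  by move=> phi psi e; apply/ffunP => i; apply: val_inj; rewrite /= -!monE e.
have [||T' [w' [cT' sw' iw']]] := HC {ffun 'I_#|E| -> 'I_m} (fun phi => 'X_[mon phi]) m (#|E| * m).+1.
- move=> c [N cN] phi.
  (* [q] contains the radical of the extension of its contraction. *)
  have cq : \sum_psi c psi *: 'X_[mon psi] \in q.
    apply: (prime_idealX pq (m := N)); move/asboolP: cN => [s [sq ->]].
    by rewrite big_seq; apply: (ideal_sum hq) => x /sq xq; apply: (idealM hq).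
  have /(congr1 (mcoeff (mon phi))) : \sum_psi c psi *: 'X_[F, mon psi] = 0.
    apply: qE cq => w wP i iE.
    have [psi wE] : exists psi, w = mon psi.
      case: (pselect (exists psi, w = mon psi)) => // nw; move: wP; rewrite mcoeff_msupp raddf_sum /= big1 ?eqxx //.
      by move=> psi _; rewrite mcoeffZ mcoeffX; case: eqP => [e|]; [case: nw; exists psi | rewrite mulr0].
    by rewrite wE mon0.
  rewrite mcoeff0 raddf_sum /= (bigD1 phi) //= big1 ?addr0 => [|psi pp].
    by rewrite mcoeffZ mcoeffX eqxx mulr1.
  by rewrite mcoeffZ mcoeffX (inj_eq mon_inj) (negbTE pp) mulr0.
- move=> phi; rewrite msizeX ltnS /mon mdeg_sum.
  rewrite -[X in (_ <= X * _)%N](card_ord #|E|) -sum_nat_const; apply: leq_sum => i _.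
  by rewrite mdegMn mdeg1 mul1n ltnW.
have := indep_card iw' sw'; rewrite cT' card_ffun !card_ord -expnD leqNgt => /negP; apply.
have m0 : (0 < m)%N by [].
apply: (@leq_ltn_trans ((K * m) ^ n)%N).
  have expW a b e : (a <= b)%N -> (a ^ e <= b ^ e)%N.
    by move=> ab; elim: e => [|e IH]; rewrite ?expn0 // !expnS leq_mul.
  by apply: expW; rewrite /K !mulnDl mul1n leq_add2r -addn1 leq_add2l.
apply: (@leq_trans (m ^ n.+1)%N); last by rewrite leq_pexp2l.
by rewrite expnMn expnS ltn_pmul2r ?expn_gt0 // /m.
Qed.

End Dimension.

(** * Residue field of a prime *)

Section ResidueField.
Variables (A : comNzRingType) (q : {pred A}) (pq : prime_ideal q).

(* A copy of [q] carrying the structure of a prime ideal. *)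
Definition prime_pred : {pred A} := fun x => x \in q.
HB.instance Definition _ := isIdealr.Build A prime_pred pq.1.
HB.instance Definition _ := isPrimeIdealrClosed.Build A prime_pred pq.2.

Definition prime_quot := {ideal_quot prime_pred}.
HB.instance Definition _ := GRing.ComNzRing.on prime_quot.

(** The field of fractions is built on an integral domain, whose structure includes an inverse on
    units; it is chosen classically. *)
Definition prime_quot_unit : {pred prime_quot} := fun x => `[< exists y, y * x = 1 >].
Definition prime_quot_inv (x : prime_quot) : prime_quot :=
  if pselect (exists y, y * x = 1) is left e then sval (cid e) else x.

Lemma prime_quot_mulV : {in prime_quot_unit, left_inverse 1 prime_quot_inv *%R}.
Proof.
move=> x /asboolP xu; rewrite /prime_quot_inv; case: pselect => // e.
by case: (cid e).
Qed.

Lemma prime_quot_unitP x y : y * x = 1 -> prime_quot_unit x.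
Proof. by move=> xy; apply/asboolP; exists y. Qed.

Lemma prime_quot_inv_out : {in [predC prime_quot_unit], prime_quot_inv =1 id}.
Proof. by move=> x /asboolPn xu; rewrite /prime_quot_inv; case: pselect. Qed.

HB.instance Definition _ := GRing.ComNzRing_hasMulInverse.Build prime_quot
  prime_quot_mulV prime_quot_unitP prime_quot_inv_out.

Definition prime_pi (x : A) : prime_quot := \pi_(prime_quot)%qT x.

Lemma prime_pi_eq0 x : (prime_pi x == 0) = (x \in q).
Proof.
rewrite /prime_pi -(rmorph0 (\pi_prime_quot)%qT) -Quotient.idealrBE subr0.
by [].
Qed.

Lemma prime_quot_integral (x y : prime_quot) : x * y = 0 -> (x == 0) || (y == 0).
Proof.
rewrite -[x]reprK -[y]reprK => /eqP; rewrite -!/(prime_pi _) -rmorphM prime_pi_eq0.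
by rewrite !prime_pi_eq0; apply: pq.2.
Qed.

HB.instance Definition _ := GRing.ComUnitRing_isIntegral.Build prime_quot prime_quot_integral.

Lemma exists_residue_field : exists (L : fieldType) (psi : {rmorphism A -> L}),
  forall x, (psi x == 0) = (x \in q).
Proof.
exists {fraction prime_quot}, (@tofrac prime_quot \o \pi_(prime_quot)%qT) => x /=.
by rewrite tofrac_eq0 -prime_pi_eq0.
Qed.

End ResidueField.

(** * Top cohomology at a point of a complete intersection *)

Section SeparatedSequence.
Import Pdiv.Ring Pdiv.RingMonic.
Variables (L : fieldType) (n : nat).
Local Notation B := {mpoly L[n]}.
Implicit Types (p c : B) (g : {poly L}) (i j : 'I_n).

Definition at_var i g : B := (map_poly (@mpolyC n L) g).['X_i].

Lemma at_varM i g h : at_var i (g * h) = at_var i g * at_var i h.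
Proof. by rewrite /at_var rmorphM hornerM. Qed.

Lemma at_varX i g m : at_var i (g ^+ m) = at_var i g ^+ m.
Proof. by rewrite /at_var rmorphXn horner_exp. Qed.

Lemma at_var_XsubC i a : at_var i ('X - a%:P) = 'X_i - a%:MP.
Proof. by rewrite /at_var rmorphB /= map_polyX map_polyC hornerXsubC. Qed.

(* [p] as a polynomial in [X_j] over the other variables. *)
Definition single j (p : B) : {poly B} :=
  mmap (polyC \o @mpolyC n L) (fun i => if i == j then 'X else ('X_i)%:P) p.

HB.instance Definition _ j := GRing.RMorphism.copy (single j)
  (mmap (polyC \o @mpolyC n L) (fun i => if i == j then 'X else ('X_i)%:P)).

Lemma singleC j a : single j a%:MP = a%:MP%:P.
Proof. exact: mmapC. Qed.

Lemma singleX j i : single j 'X_i = if i == j then 'X else ('X_i)%:P.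
Proof. by rewrite /single mmapX mmap1U. Qed.

Lemma single_horner j p : (single j p).['X_j] = p.
Proof.
pose phi : {rmorphism B -> B} := horner_eval ('X_j : B) \o single j.
apply: (mpoly_rmorph_ext (phi := phi) (psi := idfun)) => [a|i] /=.
  by rewrite /horner_eval singleC hornerC.
by rewrite /horner_eval singleX; case: eqP => [->|_]; rewrite ?hornerX ?hornerC.
Qed.

Lemma single_at_var j i g : single j (at_var i g) =
  if i == j then map_poly (@mpolyC n L) g else (at_var i g)%:P.
Proof.
elim/poly_ind: g => [|g a IH].
  by rewrite /at_var !rmorph0 horner0 rmorph0 polyC0 if_same.
have E : at_var i (g * 'X + a%:P) = at_var i g * 'X_i + a%:MP.
  by rewrite /at_var rmorphD rmorphM /= map_polyX map_polyC hornerD hornerM hornerX hornerC.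
rewrite E rmorphD rmorphM /= IH singleX singleC; case: ifP => _.
  by rewrite rmorphD rmorphM /= map_polyX map_polyC.
by rewrite polyCD polyCM.
Qed.

Definition free_of j c := single j c = c%:P.

Lemma free_ofM j c d : free_of j c -> free_of j d -> free_of j (c * d).
Proof. by rewrite /free_of rmorphM /= => -> ->; rewrite polyCM. Qed.

Lemma free_of_at_var j i g : i != j -> free_of j (at_var i g).
Proof. by move=> /negbTE ij; rewrite /free_of single_at_var ij. Qed.

Lemma free_of1 j : free_of j 1.
Proof. by rewrite /free_of rmorph1. Qed.

Variables (g : 'I_n -> {poly L}).

Definition gpol j : {poly B} := map_poly (@mpolyC n L) (g j).

(** Remainder modulo [g j] taken at [X_j], dividing in that variable alone. *)
Definition vrem j p : B := (rmodp (single j p) (gpol j)).['X_j].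

Section OneVar.
Variable (j : 'I_n).
Hypothesis gmon : g j \is monic.

Lemma gpol_monic : gpol j \is monic.
Proof. exact: monic_map. Qed.

Lemma vremD p q : vrem j (p + q) = vrem j p + vrem j q.
Proof. by rewrite /vrem rmorphD /= (rmodpD gpol_monic) hornerD. Qed.

Lemma vremM c p : free_of j c -> vrem j (c * p) = c * vrem j p.
Proof.
move=> cj; rewrite /vrem rmorphM /= cj; set s := single j p.
have -> : c%:P * s = (c%:P * rdivp s (gpol j)) * gpol j + c%:P * rmodp s (gpol j).
  by rewrite [in LHS](rdivp_eq gpol_monic s) mulrDr mulrA.
rewrite (rmodpD gpol_monic) (rmodp_mull gpol_monic) add0r.
rewrite rmodp_small ?hornerM ?hornerC //.
rewrite mul_polyC (leq_ltn_trans (size_scale_leq _ _)) // ltn_rmodpN0 //.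
exact: monic_neq0 gpol_monic.
Qed.

Lemma vrem_mull p : vrem j (at_var j (g j) * p) = 0.
Proof.
rewrite /vrem rmorphM /= single_at_var eqxx -/(gpol j) mulrC.
by rewrite (rmodp_mull gpol_monic) horner0.
Qed.

Lemma vrem_sub p : exists b, p - vrem j p = at_var j (g j) * b.
Proof.
pose d := (rdivp (single j p) (gpol j)).['X_j]; exists d.
have E : p = d * at_var j (g j) + vrem j p.
  rewrite -[LHS](single_horner j p) [X in X.[_]](rdivp_eq gpol_monic (single j p)).
  by rewrite hornerD hornerM.
by rewrite [X in X - _]E addrK mulrC.
Qed.

Lemma at_var_neq0 : at_var j (g j) != 0.
Proof.
apply/eqP => E; have /eqP := single_at_var j j (g j).
by rewrite E eqxx rmorph0 eq_sym -/(gpol j) (negbTE (monic_neq0 gpol_monic)).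
Qed.

Lemma vrem_small c (h : {poly L}) : free_of j c -> (size h < size (g j))%N ->
  vrem j (at_var j h * c) = at_var j h * c.
Proof.
move=> cj hs; rewrite mulrC vremM //; congr (_ * _).
rewrite /vrem single_at_var eqxx rmodp_small //.
by rewrite /gpol !size_map_inj_poly ?mpolyC0 //; exact: (can_inj (mpolyCK n (R := L))).
Qed.

End OneVar.

Hypothesis gmon : forall j, g j \is monic.

(** Each [g j] involves its own variable only, so division by one commutes with multiplication by
    the others; [srem_sideal] and [srem_sub] make this a normal form modulo [sideal s]. *)
Definition srem (s : seq 'I_n) p : B := foldl (fun p j => vrem j p) p s.
Definition seqs (s : seq 'I_n) := [seq at_var j (g j) | j <- s].
Definition sideal (s : seq 'I_n) : {pred B} := adjoin (M := B^o) (pred1 0) (seqs s).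

Lemma sideal_ideal s : ideal (sideal s).
Proof.
exact: adjoin_submod (zero_submod_closed B^o).
Qed.

Lemma sideal_rcons s j : sideal (rcons s j) = addmul (M := B^o) (sideal s) (at_var j (g j)).
Proof. by rewrite /sideal /seqs map_rcons /adjoin foldl_rcons. Qed.

Lemma sremD s p q : srem s (p + q) = srem s p + srem s q.
Proof. by elim: s p q => //= j s IH p q; rewrite vremD // IH. Qed.

Lemma sremM s j p : j \notin s -> srem s (at_var j (g j) * p) = at_var j (g j) * srem s p.
Proof.
elim: s p => //= i s IH p; rewrite inE negb_or => /andP[ji js].
by rewrite vremM ?IH //; apply: free_of_at_var.
Qed.

Lemma srem_sideal s p : uniq s -> p \in sideal s -> srem s p = 0.
Proof.
elim/last_ind: s p => [|s j IH] p; first by rewrite inE => _ /eqP.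
rewrite rcons_uniq sideal_rcons => /andP[js us] /asboolP[u [b [us' ->]]].
rewrite /srem foldl_rcons -/(srem s _) sremD IH // add0r.
by rewrite [_ *: _]/(_ * _) sremM // vrem_mull.
Qed.

Lemma srem_sub s p : p - srem s p \in sideal s.
Proof.
elim/last_ind: s p => [|s j IH] p; first by rewrite subrr inE.
rewrite sideal_rcons /srem foldl_rcons -/(srem s p).
have [b bE] := vrem_sub (gmon j) (srem s p); apply/asboolP; exists (p - srem s p), b.
split; first exact: IH.
have -> : at_var j (g j) *: (b : B^o) = srem s p - vrem j (srem s p) by rewrite bE.
by rewrite addrA subrK.
Qed.

(** On normal forms, multiplication by the next polynomial is injective because the ring is a
    domain. *)
Lemma separated_regular_seq s : uniq s -> regular_seq (M := B^o) (pred1 0) (seqs s).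
Proof.
elim/last_ind: s => [|s j IH] //; rewrite rcons_uniq => /andP[js us].
rewrite /seqs map_rcons; apply/regular_seq_rcons; split; first exact: IH.
move=> x; rewrite -/(seqs s) -/(sideal s) => /(srem_sideal us).
rewrite [_ *: _]/(_ * _) sremM // => /eqP; rewrite mulf_eq0 (negbTE (at_var_neq0 (gmon j))) /= => /eqP x0.
by have := srem_sub s x; rewrite x0 subr0.
Qed.

(** In each variable of [s] the degree is below that of [g j], so the product is its own normal
    form. *)
Lemma cofactor_notin s (h : 'I_n -> {poly L}) : uniq s ->
  (forall j, (size (h j) < size (g j))%N) -> (forall j, h j != 0) ->
  \prod_(j <- s) at_var j (h j) \notin sideal s.
Proof.
move=> us hs h0; apply/negP => /(srem_sideal us).
have E t : {subset t <= s} -> srem t (\prod_(j <- s) at_var j (h j)) = \prod_(j <- s) at_var j (h j).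
  elim: t => //= j t IH ts; have js : j \in s by apply: ts; rewrite inE eqxx.
  have pE : \prod_(i <- s) at_var i (h i) = at_var j (h j) * \prod_(i <- rem j s) at_var i (h i).
    by rewrite (big_rem j).
  rewrite {1}pE vrem_small // -?pE.
    by apply: IH => i it; apply: ts; rewrite inE it orbT.
  rewrite big_seq; apply: (big_ind (free_of j)) => [|c d|i]; first exact: free_of1.
    exact: free_ofM.
  by rewrite mem_rem_uniq // inE => /andP[ij _]; apply: free_of_at_var.
rewrite E // => /eqP; rewrite prodf_seq_eq0 => /hasP[j _ /andP[_ /eqP hj]].
have /eqP := single_at_var j j (h j); rewrite hj eqxx rmorph0 eq_sym map_poly_eq0_id0 ?h0 //.
  by rewrite (negbTE (h0 j)).
by rewrite mpolyC_eq0 lead_coef_eq0 h0.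
Qed.

End SeparatedSequence.

Section Nonvanishing.
Variables (L : fieldType) (n : nat).
Local Notation B := {mpoly L[n]}.
Implicit Types (s : seq 'I_n) (J : {pred B}) (w : 'I_n -> L).

Lemma radical_ideal (A : comNzRingType) (J : {pred A}) :
  ideal J -> ideal (fun x => `[< inrad J x >]).
Proof.
move=> hJ; split; first by apply/asboolP; apply: inrad0.
move=> a x y /asboolP xJ /asboolP yJ; apply/asboolP; apply: inradD => //.
exact: inradM.
Qed.

Lemma in_combZ (A : comNzRingType) k (f : 'I_k -> A) r x : in_comb f x -> in_comb f (r * x).
Proof. by move=> /asboolP xf; apply/asboolP; apply: (idealM (in_comb_ideal f)). Qed.

(** The triple consists of the monic multiple of [g], the cofactor at the root [a], and the
    multiplicity of [a], whose positivity makes the cofactor smaller. *)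
Lemma monic_root_split (g : {poly L}) (a : L) : g != 0 -> root g a ->
  exists t : {poly L} * {poly L} * nat,
    [/\ t.1.1 \is monic, (size t.1.2 < size t.1.1)%N, t.1.2 != 0,
        t.1.1 = (lead_coef g)^-1 *: g & t.1.1 = t.1.2 * ('X - a%:P) ^+ t.2].
Proof.
move=> g0 ga; pose g' := (lead_coef g)^-1 *: g.
have lc0 : lead_coef g != 0 by rewrite lead_coef_eq0.
have g'm : g' \is monic by apply/monicP; rewrite lead_coefZ mulVf.
have [m [h hr gE]] := multiplicity_XsubC g' a.
have m0 : (0 < m)%N.
  rewrite lt0n; apply: contraTN (hr) => /eqP m0; rewrite monic_neq0 //= negbK.
  by rewrite -[h]mulr1 -[1](expr0 ('X - a%:P)) -{1}m0 -gE rootZ ?invr_eq0.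
have h0 : h != 0.
  by apply: contraTneq (monic_neq0 g'm) => h0; rewrite gE h0 mul0r eqxx.
exists (g', h, m); split=> //=; rewrite gE size_Mmonic ?monic_exp ?monicXsubC //.
by rewrite size_exp_XsubC addnS /= -[X in (X < _)%N]addn0 ltn_add2l.
Qed.

(* The ideal of the point [w] is associated to the complete intersection of the
   [g i]: the product of the cofactors of the factors [X_i - w_i] is killed by
   a power of it. *)
Lemma point_hvan k (f : 'I_k -> B) s w (g : 'I_n -> {poly L}) c : uniq s ->
  (forall i, i \in s -> [/\ g i != 0, root (g i) (w i) & in_comb f (at_var i (g i))]) ->
  (forall J, ideal J -> (forall i, i \in s -> 'X_i - (w i)%:MP \in J) -> forall j, f j \in J) ->
  (forall i, (c < i)%N -> hvan f B^o i) -> (size s <= c)%N.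
Proof.
move=> us Hg Hf van; rewrite leqNgt; apply/negP => cs.
have Ht i : exists t : {poly L} * {poly L} * nat,
    [/\ t.1.1 \is monic, (size t.1.2 < size t.1.1)%N, t.1.2 != 0
     & i \in s -> in_comb f (at_var i t.1.1) /\ t.1.1 = t.1.2 * ('X - (w i)%:P) ^+ t.2].
  have [si|si] := boolP (i \in s); last first.
    (* Default off [s]: a monic polynomial with a nonzero cofactor of smaller size. *)
    by exists ('X, 1, 0%N); rewrite /= monicX size_polyX size_poly1 oner_neq0.
  have [g0 gr gf] := Hg i si; have [t [t1 t2 t3 t4 t5]] := monic_root_split g0 gr.
  exists t; split=> // _; split=> //; rewrite t4 -mul_polyC at_varM.
  exact: in_combZ.
have [t Ht'] := choice Ht; clear Ht.
pose G i := (t i).1.1; pose h i := (t i).1.2.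
have Gm j : G j \is monic by case: (Ht' j).
have h0 j : h j != 0 by case: (Ht' j).
have hG j : (size (h j) < size (G j))%N by case: (Ht' j).
have Gf j : j \in s -> in_comb f (at_var j (G j)) by case: (Ht' j) => _ _ _ H /H[].
have GE j : j \in s -> G j = h j * ('X - (w j)%:P) ^+ (t j).2 by case: (Ht' j) => _ _ _ H /H[].
have I0 : ideal (pred1 (0 : B)) := zero_submod_closed B^o.
have reg := separated_regular_seq Gm us.
have sz : size (seqs G s) = size s by rewrite size_map.
(* Below [size s] the regular sequence gives vanishing; from there on the hypothesis does, as
   [c < size s]. *)
have van_all i : hvan f B^o i.
  have [ic|] := ltnP i (size s); last by move=> si; apply: van; apply: leq_trans si.
  apply/rvan0P; apply: (regular_seq_rvan I0 reg); last by rewrite sz.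
  by move=> r /mapP[j js ->]; apply: Gf.
(* So [H^0] of the complete intersection vanishes, which the class of [eps] contradicts. *)
have r0 : rvan (M := B^o) f 0 (sideal G s).
  by apply: (adjoin_rvan I0 reg (m := 0)) => // i _; apply/rvan0P.
pose eps := \prod_(j <- s) at_var j (h j).
have /negP := cofactor_notin Gm us hG h0; apply.
apply: (rvan0_torsion (sideal_ideal G s) r0) => j.
pose J := colon (sideal G s) eps.
have hJ : ideal J by apply: colon_ideal; apply: sideal_ideal.
(* A power of each ['X_i - (w i)%:MP] carries [eps] into the ideal, so the radical of [J] contains
   the ideal of the point, hence every [f j]. *)
have /asboolP[N fN] : f j \in (fun x => `[< inrad J x >] : bool).
  apply: Hf; first exact: radical_ideal.
  move=> i si; apply/asboolP; exists (t i).2; rewrite unfold_in /J /colon /eps.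
  rewrite (big_rem i) //= mulrA -at_var_XsubC -at_varX -at_varM [_ * h i]mulrC -GE //.
  apply: (idealMr (sideal_ideal G s)); apply: adjoin_gen => //.
  by apply/mapP; exists i.
by exists N.
Qed.

End Nonvanishing.

(** * Polynomials in a subset of the variables *)

Section OnlyVars.
Variables (F : fieldType) (n : nat).
Local Notation S := {mpoly F[n]}.
Implicit Types (E : {set 'I_n}) (p : S).

Lemma only_varsC E (c : F) : only_vars E c%:MP.
Proof.
move=> m; rewrite msuppC; case: eqP => // _; rewrite inE => /eqP -> i _.
by rewrite mnm0E.
Qed.

Lemma only_varsX E i : i \in E -> only_vars E ('X_i : S).
Proof.
move=> iE m; rewrite msuppX inE => /eqP -> j jE; rewrite mnm1E.
by case: eqP => // ij; move: jE; rewrite -ij iE.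
Qed.

Lemma only_varsD E p q : only_vars E p -> only_vars E q -> only_vars E (p + q).
Proof.
by move=> pE qE m /msuppD_le; rewrite mem_cat => /orP[/pE|/qE].
Qed.

Lemma only_varsM E p q : only_vars E p -> only_vars E q -> only_vars E (p * q).
Proof.
move=> pE qE m /msuppM_le /allpairsP[[m1 m2] /= [/pE m1E /qE m2E ->]] i iE.
by rewrite mnmDE m1E ?m2E.
Qed.

Lemma only_vars_sum E (T : Type) (r : seq T) (P : pred T) (D : T -> S) :
  (forall t, P t -> only_vars E (D t)) -> only_vars E (\sum_(t <- r | P t) D t).
Proof.
move=> H; apply: (big_ind (only_vars E)) => //; last exact: only_varsD.
by rewrite -(mpolyC0 n); apply: only_varsC.
Qed.

Lemma only_vars_ind E (P : S -> Prop) : (forall c : F, P c%:MP) -> (forall i, i \in E -> P 'X_i) ->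
  (forall p q, P p -> P q -> P (p + q)) -> (forall p q, P p -> P q -> P (p * q)) ->
  forall p, only_vars E p -> P p.
Proof.
move=> PC PX PD PM p pE; rewrite (mpolyE p) big_seq; apply: (big_ind P) => [|//|m mp].
  by rewrite -(mpolyC0 n).
rewrite -mul_mpolyC; apply: (PM) => //; rewrite mpolyXE_id.
have P1 : P 1 by rewrite -(mpolyC1 n).
apply: (big_ind P) => [//|p1 p2|i _]; [exact: PM|have [iE|iE] := boolP (i \in E)].
  by elim: (m i : nat) => [|d IH]; rewrite ?expr0 // exprS; apply: (PM) => //; apply: PX.
by rewrite (pE m mp i iE) expr0.
Qed.

Lemma only_vars_rmorph_ext E (A : nzRingType) (phi psi : {rmorphism S -> A}) :
  (forall c : F, phi c%:MP = psi c%:MP) -> (forall i, i \in E -> phi 'X_i = psi 'X_i) ->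
  forall p, only_vars E p -> phi p = psi p.
Proof.
move=> HC HX; apply: only_vars_ind => // p q; first by rewrite !rmorphD => -> ->.
by rewrite !rmorphM => -> ->.
Qed.

Lemma single_only_vars E i p d : i \notin E ->
  only_vars (i |: E)%SET p -> only_vars E (single i p)`_d.
Proof.
move=> iE pE; move: p pE d; apply: only_vars_ind => [c d|j jE d|p q pE qE d|p q pE qE d].
- rewrite singleC coefC; case: ifP => _; first exact: only_varsC.
  by rewrite -(mpolyC0 n); apply: only_varsC.
- rewrite singleX; case: eqP => [_|/eqP ji].
    by rewrite coefX -[_%:R]mpolyC_nat; apply: only_varsC.
  rewrite coefC; case: ifP => _; last by rewrite -(mpolyC0 n); apply: only_varsC.
  by apply: only_varsX; move: jE; rewrite finset.in_setU1 (negbTE ji).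
- have -> : single i (p + q) = single i p + single i q by exact: rmorphD.
  rewrite coefD.
  apply: only_varsD; [exact: pE|exact: qE].
- have -> : single i (p * q) = single i p * single i q by exact: rmorphM.
  rewrite coefM; apply: only_vars_sum => j _.
  apply: only_varsM; [exact: pE|exact: qE].
Qed.

End OnlyVars.

(** * A prime whose chains are bounded by the top degree *)

Section BoundedPrime.
Variables (F : fieldType) (gT : finGroupType) (G : {group gT}) (n : nat).
Variable rG : mx_representation F G n.
Local Notation S := {mpoly F[n]}.
Local Notation R := (invariant_ring rG).

Lemma in_comb_rmorph (A B : comNzRingType) (phi : {rmorphism A -> B}) k (f : 'I_k -> A) x :
  in_comb f x -> in_comb (phi \o f) (phi x).
Proof.
move=> [c ->]; exists (phi \o c); rewrite rmorph_sum; apply: eq_bigr => j _.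
exact: rmorphM.
Qed.

(** By [extI_contract] at 1, a proper ideal of [R] stays proper in [S]. *)
Lemma in_comb_inv_val1 k (f : 'I_k -> R) : in_comb (@inv_val F gT G n rG \o f) 1 -> in_comb f 1.
Proof.
move=> [c cE]; pose a : {pred R} := fun r => `[< in_comb f r >].
have ha : ideal a by apply: in_comb_ideal.
suff /(extI_contract ha) : inv_val (1 : R) \in extI a by rewrite expr1n => /asboolP.
rewrite rmorph1 cE; apply: (ideal_sum (extI_ideal a)) => j _.
apply: (idealM (extI_ideal a)); apply: extI_in; apply/asboolP; exact: in_comb_gen.
Qed.

(* [p] is the contraction of a prime [q] of the polynomial ring modulo which a
   maximal set [E] of variables stays algebraically independent; chains below
   [p] have length at most [h = n - #|E|], and extending the scalars to the residue
   field of [q] exhibits a nonzero [H^h]. *)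
Lemma exists_prime_bounded k (f : 'I_k -> R) c : ~ in_comb f 1 ->
  (forall i, (c < i)%N -> hvan f R^o i) ->
  exists p : {pred R}, [/\ prime_ideal p, forall r, in_comb f r -> r \in p
    & forall l, prime_chain p l -> (l <= c)%N].
Proof.
move=> nf1 van; pose fS := @inv_val F gT G n rG \o f.
have nfS1 : ~ in_comb fS 1 by move/in_comb_inv_val1.
(* Algebraic independence of the variables of [E] modulo the ideal of the [fS j]; the empty set
   qualifies because that ideal is proper. *)
pose indep (E : {set 'I_n}) := `[< forall P, only_vars E P -> in_comb fS P -> P = 0 >].
have indep0 : indep finset.set0.
  apply/asboolP => P PE Pf; apply: contrapT => /eqP P0; apply: nfS1.
  have PC : P = (P@_0%MM)%:MP.
    apply/mpolyP => m; rewrite mcoeffC; case: eqP => [->|m0]; first by rewrite mulr1.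
    rewrite mulr0; apply/eqP; rewrite mcoeff_eq0; apply/negP => mP; case: m0; apply/mnmP => i.
    by rewrite mnm0E (PE m) ?finset.in_set0.
  have c0 : P@_0%MM != 0 by rewrite -(mpolyC_eq0 n) -PC.
  rewrite -(mpolyC1 n) -(mulVf c0) mpolyCM; apply: in_combZ.
  by rewrite -PC.
pose E := [arg max_(D > finset.set0 | indep D) #|D|].
have [indE maxE] : indep E /\ forall D, indep D -> (#|D| <= #|E|)%N.
  by rewrite /E; case: arg_maxnP.
(* Avoiding [U] keeps the variables of [E] independent modulo [q]. *)
pose U : {pred S} := fun P => `[< only_vars E P /\ P != 0 >].
have [|||x|q [pq fq qU]] := @exists_prime S (acc_mpoly rG) (fun x => `[< in_comb fS x >]) U.
- exact: in_comb_ideal.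
- apply/asboolP; split; last exact: oner_neq0.
  by rewrite -(mpolyC1 n); apply: only_varsC.
- move=> x y /asboolP[xE x0] /asboolP[yE y0]; apply/asboolP; split.
    exact: only_varsM.
  by rewrite mulf_neq0.
- move=> /asboolP xf; apply/negP => /asboolP[xE /eqP]; apply.
  by move/asboolP: indE; apply.
have qE P : only_vars E P -> P \in q -> P = 0.
  move=> PE /qU /asboolPn nU; apply: contrapT => /eqP P0.
  by apply: nU.
exists (fun r : R => inv_val r \in q); split.
- split; first split.
  + by rewrite unfold_in rmorph0; apply: ideal0 (prime_ideal_ideal pq).
  + by rewrite unfold_in rmorph1; case: pq => [[]].
  + move=> a u v; rewrite !unfold_in rmorphD rmorphM => uq vq.
    apply: (idealD (prime_ideal_ideal pq)) => //.
    exact: (idealM (prime_ideal_ideal pq)).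
  + by move=> u v; rewrite !unfold_in rmorphM; case: pq => _; apply.
- by move=> r rf; apply: fq; apply/asboolP; apply: in_comb_rmorph.
move=> l ch; have El := chain_bound pq qE ch.
suff : (size (enum (~: E)%SET) <= c)%N.
  by rewrite -cardE; have := cardsC E; rewrite card_ord; lia.
have [L [psi psiE]] := exists_residue_field pq.
pose w i := psi 'X_i.
(* By maximality of [E], every further variable satisfies a nonzero relation over [E] in the
   ideal. *)
have HP i : exists P : S, i \notin E -> [/\ only_vars (i |: E)%SET P, in_comb fS P & P != 0].
  case: (boolP (i \in E)) => iE; first by exists 0.
  case: (pselect (exists P : S, [/\ only_vars (i |: E)%SET P, in_comb fS P & P != 0])).
    by move=> [P PP]; exists P.
  move=> nP; have : indep (i |: E)%SET.
    apply/asboolP => P PE Pf; apply: contrapT => /eqP P0.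
    by apply: nP; exists P.
  by move/maxE; rewrite cardsU1 iE add1n ltnn.
have [P {}HP] := choice HP.
pose psiC : {rmorphism F -> L} := psi \o @mpolyC n F.
(* The variables of [E] become their residues and the others stay free, so each relation [P i]
   becomes a polynomial in one variable. *)
pose phi : {rmorphism S -> {mpoly L[n]}} :=
  mmap (@mpolyC n L \o psiC) (fun i => if i \in E then (w i)%:MP else 'X_i).
have phiC a : phi a%:MP = (psi a%:MP)%:MP by apply: mmapC.
have phiX i : phi 'X_i = if i \in E then (w i)%:MP else 'X_i.
  by rewrite /phi /= mmapX mmap1U.
pose g i : {poly L} := map_poly psi (single i (P i)).
have phiP i : i \notin E -> phi (P i) = at_var i (g i).
  move=> iE; have [PE _ _] := HP i iE.
  pose th : {rmorphism S -> {mpoly L[n]}} :=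
    horner_eval ('X_i : {mpoly L[n]}) \o map_poly (@mpolyC n L) \o map_poly psi \o single i.
  apply: (only_vars_rmorph_ext (E := (i |: E)%SET) (phi := phi) (psi := th)) PE => [a|j jE].
    by rewrite phiC /th /= singleC !map_polyC /horner_eval hornerC.
  rewrite phiX /th /= singleX; move: jE; rewrite finset.in_setU1 => /orP[/eqP->|jE].
    by rewrite (negbTE iE) eqxx !map_polyX /horner_eval hornerX.
  rewrite jE; case: eqP => [ji|_]; first by rewrite -ji jE in iE.
  by rewrite !map_polyC /horner_eval hornerC.
apply: (point_hvan (f := phi \o fS) (w := w) (g := g)).
- exact: enum_uniq.
- move=> i; rewrite mem_enum finset.in_setC => iE; have [PE Pf P0] := HP i iE; split.
  (* The coefficients of [P i] involve only [E], where [q] contains no nonzero polynomial, so [P i]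
     survives the specialization. *)
  + apply: contraNneq P0 => gi0; rewrite -[P i](single_horner i).
    suff -> : single i (P i) = 0 by rewrite horner0.
    apply/polyP => d; rewrite coef0; apply: qE; first exact: single_only_vars.
    by rewrite -psiE -coef_map -/(g i) gi0 coef0.
  + by rewrite /root /g horner_map single_horner psiE; apply: fq; apply/asboolP.
  + by rewrite -phiP //; apply: in_comb_rmorph.
- move=> J hJ JX j.
  (* Modulo the ideal of the point [w], [phi] agrees with the residue map, which kills the
     [fS j]. *)
  have phi_psi x : phi x - (psi x)%:MP \in J.
    apply: (only_vars_ind (E := finset.setT) (P := fun x => phi x - (psi x)%:MP \in J)).
    + by move=> a; rewrite phiC subrr; apply: ideal0 hJ.
    + move=> i _; rewrite phiX; case: ifP => iE; first by rewrite subrr; apply: ideal0 hJ.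
      by apply: JX; rewrite mem_enum finset.in_setC iE.
    + by move=> y z yJ zJ; rewrite !rmorphD opprD addrACA; apply: (idealD hJ).
    + move=> y z yJ zJ; rewrite !rmorphM.
      have -> : phi y * phi z - (psi y)%:MP * (psi z)%:MP =
         phi y * (phi z - (psi z)%:MP) + (psi z)%:MP * (phi y - (psi y)%:MP) by ring.
      by apply: (idealD hJ); apply: (idealM hJ).
    + by move=> m _ i; rewrite finset.in_setT.
  have := phi_psi (fS j); suff -> : psi (fS j) = 0 by rewrite subr0.
  by apply/eqP; rewrite psiE; apply: fq; apply/asboolP; apply: in_comb_gen.
- by apply: (hvan_alg (s := phi \o @inv_val F gT G n rG)).
Qed.

End BoundedPrime.

(** * Suprema and infima of extended integers *)

Section ExtendedBounds.
Implicit Types (A : set ext_int) (N : set nat).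

Lemma ext_nat_le (i j : nat) : (ext_nat i <= ext_nat j)%O = (i <= j)%N.
Proof. by []. Qed.

Lemma ext_sup_max A x : A x -> (forall y, A y -> (y <= x)%O) -> ext_sup A = x.
Proof.
move=> Ax Ux; rewrite /ext_sup /supremum ifF; last by apply/negP => /eqP A0; rewrite A0 in Ax.
have xs : supremums A x by split=> [y /Ux //|y]; apply.
by case: xgetP => [z _ zs|/(_ x)//]; apply: (is_subset1_supremums zs xs).
Qed.

Lemma ext_inf_min A x : A x -> (forall y, A y -> (x <= y)%O) -> ext_inf A = x.
Proof.
move=> Ax Lx; rewrite /ext_inf /infimum ifF; last by apply/negP => /eqP A0; rewrite A0 in Ax.
have xs : infimums A x by split=> [y /Lx //|y]; apply.
by case: xgetP => [z _ zs|/(_ x)//]; apply: (is_subset1_infimums zs xs).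
Qed.

(** [ext_sup] is meaningful once a supremum exists: the maximum for a bounded set, [EPInf] for an
    unbounded one. *)
Lemma le_ext_sup N i : N i -> (ext_nat i <= ext_sup [set ext_nat j | j in N])%O.
Proof.
move=> Ni; apply: ge_supremum_Nmem; last by exists i.
case: (pselect (exists b, forall j, N j -> (j <= b)%N)) => [[b Hb]|unb].
  have ex : exists j, `[< N j >] by exists i; apply/asboolP.
  have bd j : `[< N j >] -> (j <= b)%N by move/asboolP/Hb.
  case: (ex_maxnP ex bd) => m /asboolP Nm mmax; exists (ext_nat m).
  split=> [_ [j Nj <-]|y]; last by apply; exists m.
  by rewrite ext_nat_le; apply: mmax; apply/asboolP.
exists (EPInf int); split=> [_ [j Nj <-] //|[[b|b]| |] ub //].
- by case: unb; exists b => j Nj; have := ub (ext_nat j); apply; exists j.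
- by have := ub (ext_nat i); case/(_ (ex_intro2 _ _ i Ni erefl)).
- by have := ub (ext_nat i); case/(_ (ex_intro2 _ _ i Ni erefl)).
Qed.

End ExtendedBounds.

(** * Finite generation in the top degree *)

Section TopCohomology.
Variables (R : comNzRingType) (k : nat) (f : 'I_k -> R).

(** Every class is killed by a power of [f j]; the sum of the exponents serves all generators. *)
Lemma finitely_generated_hann i j : finitely_generated (local_cohomology f R^o i) ->
  exists N, f j ^+ N \in hann f R^o i.
Proof.
move=> [m [g gE]].
have tors (t : 'I_m) : exists N, f j ^+ N *: g t = 0.
  elim/lquot_piW: (g t) => -[z cz].
  have := cz; rewrite unfold_in => /andP[zi /eqP dz].
  have dz0 : incech (pred1 0) (cech_d z) by apply/incech_pred1.
  have [N [b [bi Hb]]] := cech_torsion (zero_submod_closed R^o) j zi dz0.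
  exists N; rewrite [_ *: _]lquot_scaleE; apply/lquot_pi_eq0/asboolP; exists b => //.
  by apply/eqP; rewrite -subr_eq0; apply/eqP/incech_pred1.
have [N HN] := choice tors.
exists (\sum_t N t)%N; apply: hann_local_cohomology => x; have [c ->] := gE x.
rewrite scaler_sumr big1 // => t _; rewrite scalerA mulrC -scalerA.
by rewrite (bigD1 t) //= exprD mulrC -scalerA HN !scaler0.
Qed.

Lemma top_not_finitely_generated c : (0 < c)%N -> (forall i, (c < i)%N -> hvan f R^o i) ->
  finitely_generated (local_cohomology f R^o c) -> hvan f R^o c.
Proof.
move=> c0 van fg z zi dz.
have [N HN] := choice (fun j => finitely_generated_hann j fg).
have hA := hann_ideal f R^o c.
pose M := (\sum_j N j)%N.
have Hj j : f j ^+ M \in hann f R^o c.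
  by apply: (ideal_expW hA (m := N j)) => //; rewrite /M (bigD1 j) //= leq_addr.
have [w [wi dw ->]] := top_cocycle_comb M c0 van zi dz.
have Hb j : exists b, cech_degp c b /\ f j ^+ M *: w j = cech_d b.
  by have /asboolP := Hj j; apply.
have [b {}Hb] := choice Hb; exists (\sum_j b j); split.
  apply: (big_ind (cech_degp c)) => [|x y xc yc|j _]; first exact: cech_degp_0.
    exact: cech_degpD.
  by case: (Hb j).
have dD : {morph @cech_d R k f R^o : x y / x + y}.
  by move=> x y; rewrite -[x]scale1r cech_d_linear !scale1r.
rewrite (big_morph _ dD (cech_d0 f R^o)); apply: eq_bigr => j _.
by case: (Hb j).
Qed.

End TopCohomology.

(** * Existence of the top degree and the equalities *)

Section HeightAndVanishing.
Variables (F : fieldType) (gT : finGroupType) (G : {group gT}) (n : nat).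
Variable rG : mx_representation F G n.
Local Notation R := (invariant_ring rG).

Lemma vanishing_chain k (f : 'I_k -> R) c (p : {pred R}) :
  (forall i, (i < c)%N -> hvan f R^o i) -> prime_ideal p ->
  (forall r, in_comb f r -> r \in p) -> prime_chain p c.
Proof.
move=> van pp fp; have hp := prime_ideal_ideal pp.
have I0 : ideal (pred1 (0 : R)) := zero_submod_closed R^o.
have [i ic|rs [<- rsr rsf]] := exists_regular_seq (acc_invariants (rG := rG)) (f := f) (c := c) I0.
  by apply/rvan0P; apply: van.
apply: (regular_seq_chain (acc_invariants (rG := rG)) I0 rsr pp) => [x|x /rsf/fp //].
by rewrite inE => /eqP ->; apply: ideal0 hp.
Qed.

(** If all cohomology vanished, [exists_prime_bounded] with [c = 0] would give a prime without
    chains of length 1 below it, while [vanishing_chain] would provide one. *)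
Lemma exists_top k (f : 'I_k -> R) : ~ in_comb f 1 -> exists c, ~ hvan f R^o c /\
  forall i, (c < i)%N -> hvan f R^o i.
Proof.
move=> nf1; have bd i : `[< ~ hvan f R^o i >] -> (i <= k)%N.
  move/asboolP => H; rewrite leqNgt; apply/negP => ki; apply: H; apply/rvan0P.
  exact: rvan_gt (zero_submod_closed _) ki.
case: (pselect (exists i, `[< ~ hvan f R^o i >])) => [ex|nex].
  case: (ex_maxnP ex bd) => c /asboolP cv cmax; exists c; split=> // i ci.
  apply: contrapT => /asboolP /cmax; by rewrite leqNgt ci.
have van i : hvan f R^o i.
  by apply: contrapT => H; apply: nex; exists i; apply/asboolP.
have [p [pp fp pl]] := exists_prime_bounded (c := 0) nf1 (fun i _ => van i).
by have := pl _ (vanishing_chain (c := 1) (fun i _ => van i) pp fp).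
Qed.

(** [R] is a domain, so [r] alone is a regular sequence. *)
Lemma regular_hvan0 k (f : 'I_k -> R) r : in_comb f r -> r != 0 -> hvan f R^o 0.
Proof.
move=> rf r0; have I0 : ideal (pred1 (0 : R)) := zero_submod_closed R^o.
apply/rvan0P; apply: (regular_seq_rvan I0 (rs := [:: r])) => // [|s].
  split=> // x; rewrite !inE => /eqP rx; apply/eqP/inv_val_inj/eqP.
  have /eqP := congr1 (@inv_val F gT G n rG) rx.
  rewrite [_ *: _]/(_ * _) rmorphM rmorph0 mulf_eq0 => /orP[/eqP e|//].
  by case/eqP: r0; apply: inv_val_inj; rewrite e rmorph0.
by rewrite inE => /eqP ->.
Qed.

End HeightAndVanishing.

(** For the unit ideal all cohomology is zero, so [cd] is -oo and the grade is +oo; for the zero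
    ideal the only cohomology is [R] in degree 0, so [cd] is 0 and the finiteness dimension is +oo.
    The equalities are stated away from these cases. *)
Theorem mainTheorem1 (F : fieldType) (gT : finGroupType) (G : {group gT})
    (n : nat) (rG : mx_representation F G n)
    (a : {pred invariant_ring rG}) (k : nat) (f : 'I_k -> invariant_ring rG) :
  ideal a -> homogeneous a -> generates f a ->
  let M : lmodType (invariant_ring rG) := (invariant_ring rG)^o in
  let H i := local_cohomology f M i in
  let cd := cohomological_dimension f M in
  (forall i : nat, (ext_nat i < cd)%O -> finite_length (H i)) ->
  [/\ forall i : nat, (ext_nat i < cd)%O -> zero_module (H i),
      1 \notin a -> grade f M = height a /\ height a = cd
    & 1 \notin a -> (exists2 r, r \in a & r != 0) ->
        cd = finiteness_dimension f M].
Proof.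
move=> _ _ fa M H cd Hfl.
have ina r : r \in a <-> in_comb f r by apply: fa.
case: (pselect (in_comb f 1)) => [f1|nf1].
  have a1 : 1 \in a by apply/ina.
  split=> [i _||]; [|by rewrite a1|by rewrite a1].
  by apply/hvanP; apply: unit_ideal_hvan.
have [c [nvan van]] := exists_top nf1.
have cdE : cd = ext_nat c.
  apply: ext_sup_max; first by exists c => // /hvanP.
  move=> _ [i nz <-]; rewrite ext_nat_le leqNgt; apply/negP => ci.
  by apply: nz; apply/hvanP; apply: van.
(* The stabilizer argument requires a nonzero space; for [n = 0] nothing lives in positive
   degree. *)
have n0c : (0 < c)%N -> (0 < n)%N.
  move=> c0; rewrite lt0n; apply/eqP => n0; apply: nvan.
  clear - n0 c0; move: rG f; rewrite n0 => rG' f'.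
  exact: trivial_space_hvan.
have vanlt i : (i < c)%N -> hvan f M i.
  move=> ic; apply: finite_length_vanishing; first by apply: n0c; apply: leq_trans ic.
  by apply: Hfl; rewrite cdE.
have gradeE : grade f M = ext_nat c.
  apply: ext_inf_min; first by exists c => // /hvanP.
  move=> _ [i nz <-]; rewrite ext_nat_le leqNgt; apply/negP => ic.
  by apply: nz; apply/hvanP; apply: vanlt.
have heightE : height a = ext_nat c.
  have chain p : prime_ideal p -> {subset a <= p} -> prime_chain p c.
    by move=> pp ap; apply: vanishing_chain vanlt pp _ => r /ina/ap.
  (* Every prime containing [a] has a chain of length [c] below it, and this [p] has none longer, so
     it attains the infimum. *)
  have [p [pp fp pl]] := exists_prime_bounded nf1 van.
  have ap : {subset a <= p} by move=> r /ina/fp.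
  apply: ext_inf_min; last first.
    by move=> _ [q [pq aq ->]]; apply: le_ext_sup; apply: chain.
  exists p; split=> //; apply/esym/ext_sup_max; first by exists c => //; apply: chain.
  by move=> _ [l /pl lc <-].
split=> [i||_ [r ra r0]].
- by rewrite cdE => ic; apply/hvanP; apply: vanlt.
- by rewrite gradeE heightE cdE.
have c0 : (0 < c)%N.
  rewrite lt0n; apply/eqP => c0; apply: nvan; rewrite c0.
  by apply: regular_hvan0 r0; apply/ina.
rewrite cdE; apply/esym/ext_inf_min.
  by exists c => //= fg; apply: nvan; apply: top_not_finitely_generated.
move=> _ [i nfg <-]; rewrite ext_nat_le leqNgt; apply/negP => ic.
(* Below [c] the cohomology is zero, generated by the empty family. *)
case: nfg; exists 0%N, (fun _ => 0) => x; exists (fun _ => 0).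
by rewrite big_ord0; apply/hvanP: x; apply: vanlt.
Qed.
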